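(* Let $\mathcal H$ be a separable complex Hilbert space and $A\in B(\mathcal H)$. If $C\in B(\mathcal H)$ is a selfadjoint trace-class operator, then $W_{\mathcal O(C)}(A)$ is convex.
   Context: For trace-class $C$, $\mathcal U(C)=\{UCU^*:U\text{ unitary}\}$, $\mathcal O(C)$ is the closure of $\mathcal U(C)$ in the trace norm, and $W_{\mathcal O(C)}(A)=\{\operatorname{Tr}(XA):X\in\mathcal O(C)\}\subseteq\mathbb C$. *)

(* Defs.v *)
From HB Require Import structures.
From mathcomp Require Import all_boot all_order all_algebra.
From mathcomp Require Import complex.
From mathcomp Require Import all_classical all_reals all_analysis.
Set Implicit Arguments.
Unset Strict Implicit.
Unset Printing Implicit Defensive.
Import Order.TTheory GRing.Theory Num.Theory.
Import numFieldNormedType.Exports.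
Local Open Scope classical_set_scope.
Local Open Scope complex_scope.
Local Open Scope ring_scope.

(* The inner product is linear in its first argument and conjugate-linear in
   its second one. *)
HB.mixin Record isHilbert (R : realType) H of CompleteNormedModule R[i] H := {
  inner : {dot H for @Num.conj R[i]} ;
  inner_norm : forall x : H, inner x x = `|x| ^+ 2
}.

#[short(type="hilbertType")]
HB.structure Definition Hilbert (R : realType) :=
  {H of isHilbert R H & CompleteNormedModule R[i] H}.

Definition separable (T : topologicalType) :=
  exists2 D : set T, countable D & dense D.

(* Sum of the family f over E: the limit of the partial sums along the finite
   subsets of E directed by inclusion. *)
Definition unordered_sum (K : numFieldType) (V : normedModType K)
    (I : choiceType) (E : set I) (f : I -> V) : V :=
  lim ((fun F : set I => \sum_(i \in F) f i) @
    filter_from (fsets E) (fun F => [set G | fsets E G /\ F `<=` G])).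

Section operators.
Context {R : realType} {H : hilbertType R}.
Implicit Types (E : set H) (A C P S T U X Y : H -> H).

Local Notation "'[ x , y ]" := (@inner R H x y) : ring_scope.

Definition orthonormal_set E :=
  (forall e, E e -> '[e, e] = 1) /\
  (forall e f, E e -> E f -> e <> f -> '[e, f] = 0).

Definition orthonormal_basis E :=
  orthonormal_set E /\ (forall x, (forall e, E e -> '[x, e] = 0) -> x = 0).

(* B(H); operators are represented by their underlying functions. *)
Definition bounded_op : set (H -> H) :=
  [set T | linear T /\ exists M : R, forall x, `|T x| <= M%:C * `|x|].

(* The objects selected with xget below exist for every Hilbert space H and
   every bounded operator T, so that the default values are never reached; the
   adjoint and |T| are moreover unique, and Tr and the trace norm of a
   trace-class operator do not depend on the orthonormal basis. *)

Definition adjoint T : H -> H :=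
  xget (fun=> 0)
    [set S | bounded_op S /\ forall x y, '[T x, y] = '[x, S y]].

Definition selfadjoint T := adjoint T = T.

Definition unitary : set (H -> H) :=
  [set U | [/\ bounded_op U, adjoint U \o U = id & U \o adjoint U = id]].

(* On R[i], 0 <= z says that z is real and nonnegative. *)
Definition positive_op P := bounded_op P /\ forall x, 0 <= '[P x, x].

(* |T| = (T^* T)^(1/2) *)
Definition abs_op T : H -> H :=
  xget (fun=> 0) [set P | positive_op P /\ P \o P = adjoint T \o T].

Definition basis : set H := xget set0 orthonormal_basis.

(* Tr |T|, an element of [0, +oo] for every bounded T *)
Definition trace_norm T : \bar R :=
  \esum_(e in basis) (complex.Re '[abs_op T e, e])%:E.

Definition trace_class : set (H -> H) :=
  [set T | bounded_op T /\ (trace_norm T < +oo)%E].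

Definition trace T : R[i] := unordered_sum basis (fun e => '[T e, e] : R[i]^o).

Definition unitary_orbit C : set (H -> H) :=
  [set U \o C \o adjoint U | U in unitary].

Definition orbit_closure C : set (H -> H) :=
  [set X | trace_class X /\
    forall eps : R, 0 < eps ->
      exists2 Y, unitary_orbit C Y & (trace_norm (X \- Y)%R < eps%:E)%E].

Definition numerical_range C A : set R[i] :=
  [set trace (X \o A) | X in orbit_closure C].

End operators.

(* Main.v *)
Require Import Defs.
From mathcomp Require Import all_boot all_order all_algebra.
From mathcomp Require Import complex.
From mathcomp Require Import all_classical all_reals all_analysis.
From mathcomp Require Import ring lra.
Set Implicit Arguments.
Unset Strict Implicit.
Unset Printing Implicit Defensive.
Import Order.TTheory GRing.Theory Num.Theory.
Import numFieldNormedType.Exports.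
Local Open Scope classical_set_scope.
Local Open Scope complex_scope.
Local Open Scope ring_scope.

(** Let c be the sequence of the eigenvalues of C, ordered by decreasing modulus. For
X and Y in the orbit closure and 0 <= t <= 1 the operator Z = t X + (1 - t) Y need not have
the eigenvalues c, but it is majorised by c. The theorem follows from the fact that every
value Tr(Z A), for Z selfadjoint and majorised by c, equals \sum_i c_i <A u_i, u_i> for some
orthonormal vectors u_i: the operator \sum_i c_i <., u_i> u_i belongs to the orbit closure
(diagonal_orbit_closure), since finitely many vectors can be moved by a unitary operator and
the tail of c is small in the trace norm.

Majorisation is used in two forms. For operators (op_maj) it bounds the sums of
the excesses (d_j - mu)^+ of the diagonal entries d_j in any orthonormal system by those of
c; in this form it follows from Jensen's inequality for unitary conjugates of C, and passes
to limits in the trace norm and to convex combinations. For sequences (maj) it compares the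
eigenvalues z of Z, obtained from the spectral theorem, with c.

The vectors u_i are found one after the other. If c_0 > 0 is the largest term of c, the
largest term z_0 of z can be raised to c_0 while the others are lowered so that what remains
is majorised by c_1, c_2, ... (maj_split), where infinitely many terms may have to be lowered at
once; the case c_0 < 0 is symmetric. The vectors follow by rotations in the planes of e_0 and e_n, for n = 1, 2, ...: by the
elliptical range theorem the eigenvalues in a plane can be spread without changing the trace
against A (planar_spread), even though A is not selfadjoint, and the angle can be chosen so
small that the infinite product of rotations converges (infinite_spread). One vector with
eigenvalue c_0 is thus split off. If z has no largest term, all its terms are negative, and
two of them are merged first (maj_merge). After n steps the remainder is majorised by c_n,
c_(n+1), ..., so its trace norm tends to 0, and the limit of the procedure has exactly the
value Tr(Z A) (realise_majorised).

The other lemmas supply the theory of Hilbert space operators: adjoints by expansion in an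
orthonormal basis, the positive square root by a fixed-point iteration, the spectral theorem
for selfadjoint Hilbert-Schmidt operators by iterating T^2, and the identification of the
trace norm and of the trace with sums over eigenvalues. *)

(** * Complex numbers and the inner product *)

Notation Re := complex.Re.
Notation Im := complex.Im.

Section complex_modulus.
Variable R : rcfType.
Implicit Types (z w : R[i]).

Definition sq z : R := Re z ^+ 2 + Im z ^+ 2.

Lemma conjE z : Num.conj z = conjc z.
Proof. by []. Qed.
Lemma ReD z w : Re (z + w) = Re z + Re w. Proof. by case: z w => a b []. Qed.
Lemma ImD z w : Im (z + w) = Im z + Im w. Proof. by case: z w => a b []. Qed.
Lemma ReN z : Re (- z) = - Re z. Proof. by case: z. Qed.
Lemma ImN z : Im (- z) = - Im z. Proof. by case: z. Qed.
Lemma ReB z w : Re (z - w) = Re z - Re w. Proof. by rewrite ReD ReN. Qed.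
Lemma ImB z w : Im (z - w) = Im z - Im w. Proof. by rewrite ImD ImN. Qed.
Lemma ReM z w : Re (z * w) = Re z * Re w - Im z * Im w.
Proof. by case: z w => a b []. Qed.
Lemma ImM z w : Im (z * w) = Re z * Im w + Im z * Re w.
Proof. by case: z w => a b []. Qed.
Lemma ReJ z : Re (Num.conj z) = Re z. Proof. by rewrite conjE; case: z. Qed.
Lemma ImJ z : Im (Num.conj z) = - Im z. Proof. by rewrite conjE; case: z. Qed.
Lemma conjR (a : R) : Num.conj a%:C = a%:C.
Proof. by rewrite conjE conjc_real. Qed.
Lemma eqC z w : Re z = Re w -> Im z = Im w -> z = w.
Proof. by case: z w => a b [c d] /= -> ->. Qed.
Lemma Re_sum I (r : seq I) (P : pred I) (F : I -> R[i]) :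
  Re (\sum_(i <- r | P i) F i) = \sum_(i <- r | P i) Re (F i).
Proof. by apply: (big_morph _ ReD). Qed.
Lemma Im_sum I (r : seq I) (P : pred I) (F : I -> R[i]) :
  Im (\sum_(i <- r | P i) F i) = \sum_(i <- r | P i) Im (F i).
Proof. by apply: (big_morph _ ImD). Qed.

Lemma sq_ge0 z : 0 <= sq z. Proof. by rewrite addr_ge0 ?sqr_ge0. Qed.
Lemma sqM z w : sq (z * w) = sq z * sq w.
Proof. by rewrite /sq ReM ImM; ring. Qed.
Lemma sqJ z : sq (Num.conj z) = sq z. Proof. by rewrite /sq ReJ ImJ sqrrN. Qed.
Lemma sqN z : sq (- z) = sq z. Proof. by rewrite /sq ReN ImN !sqrrN. Qed.
Lemma sqR (a : R) : sq a%:C = a ^+ 2. Proof. by rewrite /sq /= expr0n addr0. Qed.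
Lemma sq0 : sq 0 = 0. Proof. by rewrite /sq /= expr0n addr0. Qed.
Lemma sq_eq0 z : sq z = 0 -> z = 0.
Proof.
move=> /eqP; rewrite paddr_eq0 ?sqr_ge0 // !sqrf_eq0 => /andP [/eqP a /eqP b].
exact: eqC.
Qed.
Lemma mulzJ z : z * Num.conj z = (sq z)%:C.
Proof. by apply: eqC; rewrite ?ReM ?ImM ?ReJ ?ImJ /sq /=; ring. Qed.
Lemma normC_sq z : `|z| = (Num.sqrt (sq z))%:C.
Proof. by rewrite normc_def. Qed.
Lemma Re2_le_sq z : Re z ^+ 2 <= sq z. Proof. by rewrite lerDl sqr_ge0. Qed.
Lemma Im2_le_sq z : Im z ^+ 2 <= sq z. Proof. by rewrite lerDr sqr_ge0. Qed.
End complex_modulus.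

Section hilbert_basics.
Context {R : realType} {H : hilbertType R}.
Implicit Types (x y z : H) (a b : R[i]).

Definition ip x y : R[i] := inner x y.
(** The norm of the space has values in R[i]; nr is the same norm as a real number. *)
Definition nr x : R := Re `|x|.

Lemma nrE x : `|x| = (nr x)%:C.
Proof. by apply: eqC => //=; apply: ger0_Im. Qed.
Lemma nr_ge0 x : 0 <= nr x.
Proof. by rewrite -ler0c -nrE. Qed.
Lemma nr0 : nr 0 = 0. Proof. by rewrite /nr normr0. Qed.
Lemma nr_eq0 x : nr x = 0 -> x = 0.
Proof. by move=> h; apply/eqP; rewrite -normr_eq0 nrE h. Qed.
Lemma nrZ a x : nr (a *: x) = Num.sqrt (sq a) * nr x.
Proof. by rewrite /nr normrZ normC_sq nrE -rmorphM. Qed.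
Lemma nrZR (a : R) x : nr (a%:C *: x) = `|a| * nr x.
Proof. by rewrite nrZ sqR sqrtr_sqr. Qed.
Lemma nrN x : nr (- x) = nr x. Proof. by rewrite /nr normrN. Qed.
Lemma nrB x y : nr (x - y) = nr (y - x). Proof. by rewrite /nr distrC. Qed.
Lemma nrD x y : nr (x + y) <= nr x + nr y.
Proof. by rewrite -lecR rmorphD /= -!nrE ler_normD. Qed.
Lemma nr_sum I (r : seq I) (P : pred I) (F : I -> H) :
  nr (\sum_(i <- r | P i) F i) <= \sum_(i <- r | P i) nr (F i).
Proof.
elim/big_ind2: _ => [|x1 x2 y1 y2 h1 h2|//]; first by rewrite nr0.
by apply: le_trans (nrD _ _) _; apply: lerD.
Qed.

Lemma ipDl x y z : ip (x + y) z = ip x z + ip y z. Proof. exact: linearDl. Qed.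
Lemma ipDr x y z : ip z (x + y) = ip z x + ip z y. Proof. exact: linearDr. Qed.
Lemma ipNl x z : ip (- x) z = - ip x z. Proof. exact: linearNl. Qed.
Lemma ipNr x z : ip z (- x) = - ip z x. Proof. exact: linearNr. Qed.
Lemma ipBl x y z : ip (x - y) z = ip x z - ip y z. Proof. exact: linearBl. Qed.
Lemma ipBr x y z : ip z (x - y) = ip z x - ip z y. Proof. exact: linearBr. Qed.
Lemma ip0l x : ip 0 x = 0. Proof. exact: linear0l. Qed.
Lemma ip0r x : ip x 0 = 0. Proof. exact: linear0r. Qed.
Lemma ipZl a x z : ip (a *: x) z = a * ip x z. Proof. exact: linearZl_LR. Qed.
Lemma ipZr a x z : ip z (a *: x) = Num.conj a * ip z x.
Proof. exact: linearZr_LR. Qed.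
Lemma ipC x y : ip y x = Num.conj (ip x y).
Proof. by rewrite /ip hermC expr0 mul1r. Qed.
Lemma ip_suml I (r : seq I) (P : pred I) (F : I -> H) z :
  ip (\sum_(i <- r | P i) F i) z = \sum_(i <- r | P i) ip (F i) z.
Proof. by apply: (big_morph (ip^~ z)) => [x y|]; rewrite ?ipDl ?ip0l. Qed.
Lemma ip_sumr I (r : seq I) (P : pred I) (F : I -> H) z :
  ip z (\sum_(i <- r | P i) F i) = \sum_(i <- r | P i) ip z (F i).
Proof. by apply: (big_morph (ip z)) => [x y|]; rewrite ?ipDr ?ip0r. Qed.
Lemma ipxx x : ip x x = (nr x ^+ 2)%:C.
Proof. by rewrite /ip inner_norm nrE -rmorphXn. Qed.
Lemma ip_eq0C x y : ip x y = 0 -> ip y x = 0.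
Proof. by move=> h; rewrite ipC h rmorph0. Qed.
Lemma sq_ipC x y : sq (ip x y) = sq (ip y x).
Proof. by rewrite ipC sqJ. Qed.

Lemma nr2D x y : nr (x + y) ^+ 2 = nr x ^+ 2 + 2 * Re (ip x y) + nr y ^+ 2.
Proof.
have /(congr1 (@Re R)) /= <- := ipxx (x + y).
by rewrite ipDl !ipDr !ReD (ipC x y) ReJ !ipxx /=; ring.
Qed.
Lemma nr2B x y : nr (x - y) ^+ 2 = nr x ^+ 2 - 2 * Re (ip x y) + nr y ^+ 2.
Proof. by rewrite nr2D nrN ipNr ReN; ring. Qed.
Lemma nr2D_orth x y : ip x y = 0 -> nr (x + y) ^+ 2 = nr x ^+ 2 + nr y ^+ 2.
Proof. by move=> h; rewrite nr2D h /= mulr0 addr0. Qed.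
Lemma nr2Z a x : nr (a *: x) ^+ 2 = sq a * nr x ^+ 2.
Proof. by rewrite nrZ exprMn sqr_sqrtr // sq_ge0. Qed.

(** The square norm of |y|^2 x - <x, y> y is nonnegative. *)
Lemma cauchy_schwarz x y : sq (ip x y) <= nr x ^+ 2 * nr y ^+ 2.
Proof.
have [y0|y0] := eqVneq (nr y) 0.
  by rewrite (nr_eq0 y0) ip0r sq0 nr0 expr0n mulr0.
have := sqr_ge0 (nr ((nr y ^+ 2)%:C *: x - ip x y *: y)).
rewrite nr2B !nr2Z sqR ipZl ipZr [Num.conj _ * _]mulrC mulzJ -rmorphM /=.
have y2 : 0 < nr y ^+ 2 by rewrite exprn_gt0 // lt_neqAle eq_sym y0 nr_ge0.
rewrite [X in 0 <= X](_ : _ = nr y ^+ 2 * (nr x ^+ 2 * nr y ^+ 2 - sq (ip x y))).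
  by rewrite pmulr_rge0 // subr_ge0.
by ring.
Qed.
Lemma absRe_ip x y : `|Re (ip x y)| <= nr x * nr y.
Proof.
rewrite -ler_sqr ?nnegrE ?mulr_ge0 ?nr_ge0 // real_normK ?num_real //.
by rewrite exprMn (le_trans (Re2_le_sq _)) // cauchy_schwarz.
Qed.
Lemma absIm_ip x y : `|Im (ip x y)| <= nr x * nr y.
Proof.
rewrite -ler_sqr ?nnegrE ?mulr_ge0 ?nr_ge0 // real_normK ?num_real //.
by rewrite exprMn (le_trans (Im2_le_sq _)) // cauchy_schwarz.
Qed.

Lemma ip_eqr x y : (forall z, ip z x = ip z y) -> x = y.
Proof.
move=> h; apply/eqP; rewrite -subr_eq0; apply/eqP/nr_eq0/eqP.
rewrite -sqrf_eq0; apply/eqP/(@complexI R).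
by rewrite -ipxx ipBr h subrr.
Qed.

End hilbert_basics.

(** * Limits of vectors and orthonormal systems *)

Section sequences_in_hilbert.
Context {R : realType} {H : hilbertType R}.
Implicit Types (x y z : H) (u v : nat -> H).

Definition tends u x := (fun n => nr (u n - x)) @ \oo --> (0 : R).

Lemma cvg0P (f : nat -> R) : (forall n, 0 <= f n) ->
  (f @ \oo --> (0 : R)) <->
  (forall eps : R, 0 < eps -> exists N, forall n, (N <= n)%N -> f n <= eps).
Proof.
move=> f0; split.
  move=> /cvgrPdist_le h eps e0; have [N _ hN] := h eps e0.
  exists N => n Nn; have := hN n Nn; rewrite sub0r normrN.
  exact/le_trans/ler_norm.
move=> h; apply/cvgrPdist_le => eps e0; have [N hN] := h eps e0.
by exists N => // n Nn; rewrite sub0r normrN ger0_norm //; apply: hN.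
Qed.

Lemma tendsP u x : tends u x <->
  (forall eps : R, 0 < eps -> exists N, forall n, (N <= n)%N -> nr (u n - x) <= eps).
Proof. by apply: cvg0P => n; apply: nr_ge0. Qed.

Lemma tends_squeeze u x (f : nat -> R) : f @ \oo --> (0 : R) ->
  (forall n, nr (u n - x) <= f n) -> tends u x.
Proof.
move=> hf h; apply: (squeeze_cvgr _ (cvg_cst (0 : R)) hf).
by near=> n; rewrite nr_ge0 h.
Unshelve. all: end_near. Qed.

Lemma tendsD u v x y : tends u x -> tends v y -> tends (fun n => u n + v n) (x + y).
Proof.
move=> hu hv; apply: (tends_squeeze (f := fun n => nr (u n - x) + nr (v n - y))).
  by rewrite -[0 in X in _ --> X]addr0; apply: cvgD.
by move=> n; rewrite opprD addrACA nrD.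
Qed.

Lemma tendsZ a u x : tends u x -> tends (fun n => a *: u n) (a *: x).
Proof.
move=> hu; apply: (tends_squeeze (f := fun n => Num.sqrt (sq a) * nr (u n - x))).
  by rewrite -[0 in X in _ --> X](mulr0 (Num.sqrt (sq a))); apply: cvgMr.
by move=> n; rewrite -scalerBr nrZ.
Qed.

Lemma tends_cst x : tends (fun=> x) x.
Proof. by rewrite /tends subrr nr0; apply: cvg_cst. Qed.

Lemma tendsN u x : tends u x -> tends (fun n => - u n) (- x).
Proof. by move=> h; rewrite /tends; under eq_fun => n do rewrite -opprD nrN. Qed.

Lemma tendsB u v x y : tends u x -> tends v y -> tends (fun n => u n - v n) (x - y).
Proof. by move=> hu hv; apply: tendsD => //; apply: tendsN. Qed.

Lemma tends_unique u x y : tends u x -> tends u y -> x = y.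
Proof.
move=> hx hy; have := tendsB hx hy; rewrite /tends.
under eq_fun => n do rewrite subrr sub0r nrN.
move=> /(cvg_lim (@norm_hausdorff _ _)); rewrite lim_cst //.
by move=> /nr_eq0 /eqP; rewrite subr_eq0 => /eqP.
Qed.

Lemma tends_shift u x k : tends u x -> tends (fun n => u (n + k)%N) x.
Proof. by move=> h; rewrite /tends (cvg_shiftn k (fun n => nr (u n - x))). Qed.

Lemma tends_bounded u x (T : H -> H) (M : R) :
  (forall x y, T (x - y) = T x - T y) -> (forall x, nr (T x) <= M * nr x) ->
  tends u x -> tends (fun n => T (u n)) (T x).
Proof.
move=> TB TM hu; apply: (tends_squeeze (f := fun n => M * nr (u n - x))).
  by rewrite -[0 in X in _ --> X](mulr0 M); apply: cvgMr.
by move=> n; rewrite -TB.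
Qed.

Lemma cvg_dist0 (f g : nat -> R) l : g @ \oo --> (0 : R) ->
  (forall n, `|f n - l| <= g n) -> f @ \oo --> l.
Proof.
move=> hg h; apply/subr_cvg0/norm_cvg0P.
apply: (squeeze_cvgr _ (cvg_cst (0 : R)) hg).
by near=> n; rewrite normr_ge0 /= h.
Unshelve. all: end_near. Qed.

Lemma tends_Re u x y : tends u x -> (fun n => Re (ip (u n) y)) @ \oo --> Re (ip x y).
Proof.
move=> hu; apply: (@cvg_dist0 _ (fun n => nr (u n - x) * nr y)).
  by rewrite -[0 in X in _ --> X](mul0r (nr y)); apply: cvgMl.
by move=> n; rewrite -ReB -ipBl absRe_ip.
Qed.
Lemma tends_Im u x y : tends u x -> (fun n => Im (ip (u n) y)) @ \oo --> Im (ip x y).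
Proof.
move=> hu; apply: (@cvg_dist0 _ (fun n => nr (u n - x) * nr y)).
  by rewrite -[0 in X in _ --> X](mul0r (nr y)); apply: cvgMl.
by move=> n; rewrite -ImB -ipBl absIm_ip.
Qed.

Lemma ler_nr_dist x y : `|nr x - nr y| <= nr (x - y).
Proof.
rewrite ler_norml; apply/andP; split.
  by rewrite lerBrDr addrC lerBlDr -[X in nr X <= _](subrK x) addrC -nrB nrD.
by rewrite lerBlDr -[X in nr X <= _](subrK y) nrD.
Qed.

Lemma tends_nr u x : tends u x -> (fun n => nr (u n)) @ \oo --> nr x.
Proof. by move=> hu; apply: (cvg_dist0 hu) => n; apply: ler_nr_dist. Qed.

Lemma complete_nr u :
  (forall eps : R, 0 < eps ->
    exists N, forall m n, (N <= m)%N -> (N <= n)%N -> nr (u m - u n) <= eps) ->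
  exists x, tends u x.
Proof.
move=> h; have : cvg (u @ \oo).
  apply: cauchy_cvg; apply: cauchy_exP => eps e0.
  have [e1 e2] : 0 < Re eps /\ eps = (Re eps)%:C.
    move: e0; rewrite ltcE => /andP [/eqP /= a b]; split => //.
    by apply: eqC => //=; rewrite a.
  have e3 : 0 < Re eps / 2 by rewrite divr_gt0.
  have [N hN] := h _ e3; exists (u N), N => // n /= Nn.
  rewrite /ball_ -ball_normE /=.
  rewrite nrE e2 ltcR; apply: le_lt_trans (hN N n _ Nn) _ => //.
  by rewrite ltr_pdivrMr // ltr_pMr // ltr1n.
move=> /cvg_ex [x /= hx]; exists x; apply/tendsP => eps e0.
have e1 : 0 < eps%:C by rewrite ltcR.
move: hx => /cvgrPdist_le /(_ _ e1) [N _ hN]; exists N => n Nn.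
by have := hN n Nn; rewrite nrE lecR nrB.
Qed.

End sequences_in_hilbert.

Section orthonormal_systems.
Context {R : realType} {H : hilbertType R}.
Implicit Types (x y z : H).

(** Zero vectors are allowed, so that a finite-dimensional space also has
systems indexed by all natural numbers. *)
Definition ortho_sys (I : eqType) (D : set I) (g : I -> H) :=
  (forall i j, D i -> D j -> i != j -> ip (g i) (g j) = 0) /\
  (forall i, D i -> g i = 0 \/ nr (g i) = 1).

Variables (I : eqType) (D : set I) (g : I -> H).
Hypothesis og : ortho_sys D g.

Lemma ip_comb (r : seq I) (a : I -> R[i]) j : uniq r ->
  (forall i, i \in r -> D i) -> j \in r ->
  ip (\sum_(i <- r) a i *: g i) (g j) = a j * (nr (g j) ^+ 2)%:C.
Proof.
move=> ur rD jr; rewrite ip_suml (bigD1_seq j) //= ipZl ipxx.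
rewrite big_seq_cond big1 ?addr0 // => i /andP [ir ij].
by rewrite ipZl og.1 ?mulr0 //; apply: rD.
Qed.

Lemma nr2_comb (r : seq I) (a : I -> R[i]) : uniq r ->
  (forall i, i \in r -> D i) ->
  nr (\sum_(i <- r) a i *: g i) ^+ 2 = \sum_(i <- r) sq (a i) * nr (g i) ^+ 2.
Proof.
move=> ur rD; apply: (@complexI R); rewrite -ipxx ip_sumr rmorph_sum /=.
apply: eq_big_seq => i ir; rewrite ipZr ip_comb // mulrA [Num.conj _ * _]mulrC.
by rewrite mulzJ -rmorphM.
Qed.

Lemma sq_ip_unit x i : D i -> sq (ip x (g i)) * nr (g i) ^+ 2 = sq (ip x (g i)).
Proof.
by move=> Di; case: (og.2 i Di) => [->|->]; rewrite ?ip0r ?sq0 ?mul0r ?expr1n ?mulr1.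
Qed.

Lemma ip_unit x i : D i -> ip x (g i) * (nr (g i) ^+ 2)%:C = ip x (g i).
Proof.
by move=> Di; case: (og.2 i Di) => [->|->]; rewrite ?ip0r ?mul0r ?expr1n ?mulr1.
Qed.

Lemma proj_orth x (r : seq I) j : uniq r -> (forall i, i \in r -> D i) -> j \in r ->
  ip (x - \sum_(i <- r) ip x (g i) *: g i) (g j) = 0.
Proof.
move=> ur rD jr; rewrite ipBl ip_comb // ip_unit ?subrr //; exact: rD.
Qed.

Lemma bessel_eq x (r : seq I) : uniq r -> (forall i, i \in r -> D i) ->
  nr (x - \sum_(i <- r) ip x (g i) *: g i) ^+ 2 =
  nr x ^+ 2 - \sum_(i <- r) sq (ip x (g i)).
Proof.
move=> ur rD; set p := \sum_(i <- r) _.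
have h : ip (x - p) p = 0.
  rewrite {2}/p ip_sumr big_seq big1 // => i ir.
  by rewrite ipZr proj_orth ?mulr0.
have -> : \sum_(i <- r) sq (ip x (g i)) = nr p ^+ 2.
  rewrite nr2_comb //; apply: eq_big_seq => i ir.
  by rewrite sq_ip_unit //; apply: rD.
by rewrite -[in RHS](subrK p x) (nr2D_orth h) addrK.
Qed.

Lemma bessel x (r : seq I) : uniq r -> (forall i, i \in r -> D i) ->
  \sum_(i <- r) sq (ip x (g i)) <= nr x ^+ 2.
Proof. by move=> ur rD; rewrite -subr_ge0 -bessel_eq // sqr_ge0. Qed.

Lemma nr_sys_le1 i : D i -> nr (g i) <= 1.
Proof. by move=> /og.2 [->|->]; rewrite ?nr0. Qed.

End orthonormal_systems.

Section limits_of_products.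
Context {R : realType} {H : hilbertType R}.

Lemma cvgR_unique (f : nat -> R) (a b : R) : f @ \oo --> a -> f @ \oo --> b -> a = b.
Proof. by move=> ha hb; apply: (cvg_unique _ ha hb); apply: norm_hausdorff. Qed.

Lemma tends_ip_eq (u v : nat -> H) x y z w : tends u x -> tends v w ->
  (forall n, ip (u n) y = ip z (v n)) -> ip x y = ip z w.
Proof.
move=> hu hv h.
have e n : ip (u n) y = Num.conj (ip (v n) z) by rewrite h -ipC.
rewrite (ipC w); apply: eqC; rewrite ?ReJ ?ImJ.
  apply: cvgR_unique (tends_Re hu) _.
  by under eq_fun => n do rewrite e ReJ; apply: tends_Re.
apply: cvgR_unique (tends_Im hu) _.
by under eq_fun => n do rewrite e ImJ; apply: cvgN; apply: tends_Im.
Qed.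
End limits_of_products.

Lemma cvgR_le {R : realType} (f : nat -> R) (l M : R) :
  f @ \oo --> l -> (forall n, f n <= M) -> l <= M.
Proof.
move=> hf h; rewrite -(cvg_lim (@norm_hausdorff _ _) hf).
by apply: limr_le; [apply/cvg_ex; exists l|apply: nearW].
Qed.

Lemma cvgR_ge {R : realType} (f : nat -> R) (l M : R) :
  f @ \oo --> l -> (forall n, M <= f n) -> M <= l.
Proof.
move=> hf h; rewrite -(cvg_lim (@norm_hausdorff _ _) hf).
by apply: limr_ge; [apply/cvg_ex; exists l|apply: nearW].
Qed.

Lemma cvgR_abs_le {R : realType} (f : nat -> R) (l M : R) :
  f @ \oo --> l -> (forall n, `|f n| <= M) -> `|l| <= M.
Proof.
move=> hf h; rewrite ler_norml (cvgR_le hf) ?(cvgR_ge hf) // => n;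
  by have := h n; rewrite ler_norml => /andP [].
Qed.

(** * Orthonormal bases and adjoints *)

Section bounded_operators.
Context {R : realType} {H : hilbertType R}.
Implicit Types (x y z : H) (T : H -> H).

Lemma bounded_opP T : bounded_op T <->
  linear T /\ exists M : R, 0 <= M /\ forall x, nr (T x) <= M * nr x.
Proof.
split=> [[lT [M hM]]|[lT [M [M0 hM]]]]; split => //.
  exists `|M|; split => // x; have := hM x; rewrite !nrE -rmorphM lecR => h.
  by apply: le_trans h _; rewrite ler_wpM2r ?nr_ge0 ?ler_norm.
by exists M => x; rewrite !nrE -rmorphM lecR.
Qed.

Lemma linD T : linear T -> forall x y, T (x + y) = T x + T y.
Proof. by move=> h x y; have := h 1 x y; rewrite !scale1r. Qed.
Lemma lin0 T : linear T -> T 0 = 0.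
Proof. by move=> h; apply: (addIr (T 0)); rewrite -linD // !add0r. Qed.
Lemma linZ T : linear T -> forall a x, T (a *: x) = a *: T x.
Proof. by move=> h a x; have := h a x 0; rewrite (lin0 h) !addr0. Qed.
Lemma linN T : linear T -> forall x, T (- x) = - T x.
Proof. by move=> h x; rewrite -scaleN1r (linZ h) scaleN1r. Qed.
Lemma linB T : linear T -> forall x y, T (x - y) = T x - T y.
Proof. by move=> h x y; rewrite (linD h) (linN h). Qed.
Lemma lin_sum T I (r : seq I) (P : pred I) (F : I -> H) : linear T ->
  T (\sum_(i <- r | P i) F i) = \sum_(i <- r | P i) T (F i).
Proof. by move=> h; apply: (big_morph T) => [x y|]; rewrite ?linD ?lin0. Qed.

Lemma bounded_opB T S : bounded_op T -> bounded_op S -> bounded_op (T \- S)%R.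
Proof.
move=> /bounded_opP [lT [M [M0 hM]]] /bounded_opP [lS [N [N0 hN]]].
apply/bounded_opP; split; last exists (M + N).
  by move=> a x y; rewrite /= lT lS scalerBr opprD addrACA.
split => [|x]; first exact: addr_ge0.
by apply: le_trans (nrD _ _) _; rewrite nrN mulrDl lerD.
Qed.

Lemma bounded_op_comp T S : bounded_op T -> bounded_op S -> bounded_op (T \o S).
Proof.
move=> /bounded_opP [lT [M [M0 hM]]] /bounded_opP [lS [N [N0 hN]]].
apply/bounded_opP; split; first by move=> a x y; rewrite /= lS lT.
exists (M * N); split => [|x /=]; first exact: mulr_ge0.
by apply: le_trans (hM _) _; rewrite -mulrA ler_wpM2l.
Qed.

Lemma tends_op T u x : bounded_op T -> tends u x -> tends (fun n => T (u n)) (T x).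
Proof.
move=> /bounded_opP [lT [M [M0 hM]]]; apply: tends_bounded (hM) => *; exact: linB.
Qed.
End bounded_operators.

Section bases.
Context {R : realType} {H : hilbertType R}.
Implicit Types (x y z : H) (T : H -> H) (s : seq H).

Lemma exists_orthonormal_basis : exists E : set H, orthonormal_basis E.
Proof.
have [|E [oE maxE]] := @Zorn_bigcup H (@orthonormal_set R H).
  move=> F FP tF; split=> [e [A FA Ae]|e f [A FA Ae] [B FB Bf] ef].
    exact: (FP A FA).1.
  by have [AB|BA] := tF A B FA FB; [apply: (FP B FB).2|apply: (FP A FA).2];
    rewrite //; [apply: AB|apply: BA].
exists E; split => // x xE; apply: contrapT => x0.
have nx : nr x != 0 by apply/eqP => /nr_eq0.
pose v := (nr x)^-1%:C *: x.
have nv : nr v = 1 by rewrite nrZR ger0_norm ?invr_ge0 ?nr_ge0 // mulVf.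
have vE e : E e -> ip v e = 0 by move=> Ee; rewrite ipZl [ip _ _]xE ?mulr0.
apply: (maxE (E `|` [set v])).
  split; first by move=> e Ee; left.
  move=> h; have Ev : E v by apply: h; right.
  have := vE v Ev; rewrite ipxx nv expr1n => /eqP.
  by rewrite oner_eq0.
split=> [e [Ee|->]|e f [Ee|->] [Ef|->] // ef]; first exact: oE.1.
- by rewrite -/(ip v v) ipxx nv expr1n.
- exact: oE.2.
- by apply: ip_eq0C; apply: vE.
- exact: vE.
Qed.

Lemma basisP : orthonormal_basis (@Defs.basis R H).
Proof. exact: (xgetPex set0 exists_orthonormal_basis). Qed.

Lemma nr_basis e : (@Defs.basis R H) e -> nr e = 1.
Proof.
move=> Ee; have := basisP.1.1 e Ee; rewrite -/(ip e e) ipxx => /complexI /eqP.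
by rewrite sqrf_eq1 => /orP [] /eqP // h; have := nr_ge0 e; rewrite h oppr_ge0 ler10.
Qed.

Lemma basis_sys : ortho_sys (@Defs.basis R H) id.
Proof.
split=> [e f Ee Ef /eqP ef|e Ee]; first exact: basisP.1.2.
right; exact: nr_basis.
Qed.

(** Finite subsets of the basis, as duplicate-free sequences *)
Definition bsub s := uniq s /\ forall e, e \in s -> (@Defs.basis R H) e.

Lemma bsubU s t : bsub s -> bsub t -> bsub (undup (s ++ t)).
Proof.
move=> hs ht; split=> [|e]; first exact: undup_uniq.
by rewrite mem_undup mem_cat => /orP [/hs.2|/ht.2].
Qed.

Lemma sum_subset (V : zmodType) s0 s (f : H -> V) : uniq s0 -> uniq s ->
  {subset s0 <= s} ->
  \sum_(e <- s) f e = \sum_(e <- s0) f e + \sum_(e <- [seq e <- s | e \notin s0]) f e.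
Proof.
move=> u0 us s0s; rewrite (bigID (mem s0)) /= big_filter; congr (_ + _).
rewrite -big_filter; apply: perm_big; apply: uniq_perm; rewrite ?filter_uniq //.
move=> e; rewrite mem_filter; apply/andP/idP => [[]//|h]; split => //.
exact: s0s.
Qed.

Lemma nr2_sum_subset (a : H -> R[i]) s0 s : bsub s0 -> bsub s -> {subset s0 <= s} ->
  nr (\sum_(e <- s) a e *: e - \sum_(e <- s0) a e *: e) ^+ 2 =
  \sum_(e <- s) sq (a e) - \sum_(e <- s0) sq (a e).
Proof.
move=> [u0 b0] [us bs] h; rewrite (sum_subset _ u0 us h) (sum_subset (fun e => sq (a e)) u0 us h).
have E (V : zmodType) (u v : V) : u + v - u = v by rewrite addrAC subrr add0r.
move: (\sum_(e <- s0) _) (\sum_(e <- s0) _) => u v; rewrite (E _ u) (E _ v).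
rewrite (nr2_comb basis_sys) ?filter_uniq //; last first.
  by move=> e; rewrite mem_filter => /andP [_ /bs].
by apply: eq_big_seq => e; rewrite mem_filter => /andP [_ /bs /nr_basis ->];
  rewrite expr1n mulr1.
Qed.

(** The finite partial sums form a Cauchy net because the sums of the |a_e|^2 have a
supremum; finite sets that come within 1/(n+1) of it give a sequence with the same limit. *)
Lemma riesz_fischer (a : H -> R[i]) (M : R) :
  (forall s, bsub s -> \sum_(e <- s) sq (a e) <= M) ->
  exists y, (forall e, (@Defs.basis R H) e -> ip y e = a e) /\
    forall eps : R, 0 < eps -> exists2 s0, bsub s0 &
    forall s, bsub s -> {subset s0 <= s} -> nr (y - \sum_(e <- s) a e *: e) <= eps.
Proof.
move=> hM; pose A := [set r | exists2 s, bsub s & r = \sum_(e <- s) sq (a e)].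
have bnil : bsub [::] by split.
have A0 : A !=set0 by exists 0; exists [::]; rewrite ?big_nil.
have Asup : has_sup A.
  by split => //; exists M => r [s bs ->]; exact: hM.
have net (d : R) : 0 < d -> exists s0, bsub s0 /\ forall s, bsub s -> {subset s0 <= s} ->
    nr (\sum_(e <- s) a e *: e - \sum_(e <- s0) a e *: e) <= d.
  move=> d0; have d2 : 0 < d ^+ 2 by rewrite exprn_gt0.
  have [r [s0 b0 ->] h] := sup_adherent d2 Asup; exists s0; split => // s bs ss.
  rewrite -ler_sqr ?nnegrE ?nr_ge0 ?(ltW d0) // nr2_sum_subset // lerBlDr.
  move: h; rewrite ltrBlDr addrC => /ltW; apply: le_trans.
  by apply: ub_le_sup; [exact: Asup.2|exists s].
have hh (n : nat) : 0 < n.+1%:R^-1 :> R by rewrite invr_gt0.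
have [f hf] := choice (fun n => net _ (hh n)).
have harm : forall eps : R, 0 < eps -> exists N, forall n, (N <= n)%N -> n.+1%:R^-1 <= eps.
  by apply/cvg0P; [move=> n; rewrite invr_ge0|exact: cvg_harmonic].
pose y_ n := \sum_(e <- f n) a e *: e.
have [|y hy] := @complete_nr R H y_.
  move=> eps e0; have e1 : 0 < eps / 2 by rewrite divr_gt0.
  have [N hN] := harm _ e1; exists N => m n Nm Nn.
  have bu := bsubU (hf m).1 (hf n).1.
  have h1 := (hf m).2 _ bu; have h2 := (hf n).2 _ bu.
  rewrite (splitr eps) -(subrKA (\sum_(e <- undup (f m ++ f n)) a e *: e)).
  apply: le_trans (nrD _ _) _; apply: lerD.
    rewrite nrB; apply: le_trans (hN m Nm); apply: h1 => e em.
    by rewrite mem_undup mem_cat em.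
  apply: le_trans (hN n Nn); apply: h2 => e em.
  by rewrite mem_undup mem_cat em orbT.
have lim (eps : R) : 0 < eps -> exists2 s0, bsub s0 &
    forall s, bsub s -> {subset s0 <= s} -> nr (y - \sum_(e <- s) a e *: e) <= eps.
  move=> e0; have e1 : 0 < eps / 2 by rewrite divr_gt0.
  have [N hN] := harm _ e1; move/tendsP: hy => /(_ _ e1) [N' hN'].
  pose n := maxn N N'; exists (f n); first exact: (hf n).1.
  move=> s bs ss; rewrite (splitr eps) -(subrKA (y_ n)).
  apply: le_trans (nrD _ _) _; apply: lerD.
    by rewrite nrB hN' // leq_maxr.
  by rewrite nrB; apply: le_trans (hN n (leq_maxl _ _)); apply: (hf n).2.
exists y; split => // e Ee; apply/eqP; rewrite -subr_eq0; apply/eqP/sq_eq0.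
apply/le_anti; rewrite sq_ge0 andbT; apply/ler_addgt0Pl => eps e0; rewrite addr0.
have e1 : 0 < Num.sqrt eps by rewrite sqrtr_gt0.
have [s0 b0 hs0] := lim _ e1.
have be : bsub [:: e] by split => // f'; rewrite inE => /eqP ->.
have bu := bsubU b0 be; set u := undup _ in bu.
have eu : e \in u by rewrite mem_undup mem_cat inE eqxx orbT.
have := hs0 u bu; move=> /(_ _) h.
have hu : nr (y - \sum_(e <- u) a e *: e) <= Num.sqrt eps.
  by apply: h => f' f's; rewrite mem_undup mem_cat f's.
have -> : a e = ip (\sum_(e <- u) a e *: e) e.
  by rewrite (ip_comb basis_sys) ?nr_basis ?expr1n ?mulr1 //; [exact: bu.1|exact: bu.2].
rewrite -ipBl; apply: le_trans (cauchy_schwarz _ _) _.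
rewrite (nr_basis Ee) expr1n mulr1 -[X in _ <= X](sqr_sqrtr (ltW e0)).
by rewrite ler_sqr ?nnegrE ?nr_ge0 ?sqrtr_ge0.
Qed.

Lemma parseval x (eps : R) : 0 < eps -> exists2 s0, bsub s0 &
  forall s, bsub s -> {subset s0 <= s} -> nr (x - \sum_(e <- s) ip x e *: e) <= eps.
Proof.
move=> e0; have [|y [ye hy]] := @riesz_fischer (ip x) (nr x ^+ 2).
  by move=> s [us bs]; apply: (bessel basis_sys).
have -> : x = y.
  apply/eqP; rewrite -subr_eq0; apply/eqP; apply: basisP.2 => e Ee.
  by rewrite -/(ip _ _) ipBl ye // subrr.
have [s0 b0 h] := hy _ e0; exists s0 => // s bs ss.
rewrite (eq_big_seq (fun e => ip x e *: e)); first exact: h.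
by move=> e /bs.2 /ye ->.
Qed.

Lemma functional_basis_eq0 (f : H -> R[i]) (K : R) :
  (forall x y, f (x + y) = f x + f y) -> (forall a x, f (a *: x) = a * f x) ->
  (forall x, sq (f x) <= K * nr x ^+ 2) ->
  (forall e, (@Defs.basis R H) e -> f e = 0) -> forall x, f x = 0.
Proof.
move=> fD fZ fK fe x; have f0 : f 0 = 0 by rewrite -(scale0r 0) fZ mul0r.
apply: sq_eq0; apply/le_anti; rewrite sq_ge0 andbT.
apply/ler_addgt0Pl => eps e0; rewrite addr0.
have K1 : 0 < `|K| + 1 by rewrite ltr_wpDl.
have e1 : 0 < Num.sqrt (eps / (`|K| + 1)) by rewrite sqrtr_gt0 divr_gt0.
have [s0 b0 /(_ _ b0) h] := parseval x e1.
have {}h := h (fun=> id); set p := \sum_(e <- s0) _ in h.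
have fp : f p = 0.
  rewrite (big_morph f fD f0) big_seq big1 // => e /b0.2 /fe.
  by rewrite fZ => ->; rewrite mulr0.
rewrite -(subrK p x) fD fp addr0; apply: le_trans (fK _) _.
have h2 : nr (x - p) ^+ 2 <= eps / (`|K| + 1).
  rewrite -[X in _ <= X]sqr_sqrtr ?divr_ge0 ?(ltW e0) ?(ltW K1) //.
  by rewrite ler_sqr ?nnegrE ?nr_ge0 ?sqrtr_ge0.
apply: (@le_trans _ _ ((`|K| + 1) * nr (x - p) ^+ 2)).
  by rewrite ler_wpM2r ?sqr_ge0 // (le_trans (ler_norm K)) // lerDl.
by rewrite -ler_pdivlMl // mulrC.
Qed.

(** The nontrivial half of Parseval's identity, for the supremum of the partial sums *)
Lemma nr2_le_sup x (M : R) :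
  (forall s, bsub s -> \sum_(e <- s) sq (ip x e) <= M) -> nr x ^+ 2 <= M.
Proof.
move=> hM; apply/ler_addgt0Pl => eps e0.
have e1 : 0 < Num.sqrt eps by rewrite sqrtr_gt0.
have [s0 b0 /(_ _ b0) h] := parseval x e1.
have {}h := h (fun=> id); have := bessel_eq basis_sys x b0.1 b0.2.
move=> /eqP; rewrite eq_sym subr_eq => /eqP ->; apply: lerD; last exact: hM.
by rewrite -[X in _ <= X](sqr_sqrtr (ltW e0)) ler_sqr ?nnegrE ?nr_ge0 ?sqrtr_ge0.
Qed.

(** The adjoint maps y to the vector with coordinates <y, T e>. These are square-summable:
if v is a finite part of this expansion, then |v|^2 = <y, T v> <= M |y| |v|. *)
Lemma adjoint_exists T : bounded_op T ->
  exists S, bounded_op S /\ forall x y, ip (T x) y = ip x (S y).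
Proof.
move=> /bounded_opP [lT [M [M0 hM]]].
have bnd y s : bsub s -> \sum_(e <- s) sq (ip y (T e)) <= M ^+ 2 * nr y ^+ 2.
  move=> bs; set sg := \sum_(e <- s) _.
  pose v := \sum_(e <- s) ip y (T e) *: e.
  have nv : nr v ^+ 2 = sg.
    rewrite (nr2_comb basis_sys) ?bs.1 //; last exact: bs.2.
    by apply: eq_big_seq => e /bs.2 /nr_basis ->; rewrite expr1n mulr1.
  have hv : ip y (T v) = sg%:C.
    rewrite lin_sum // ip_sumr rmorph_sum; apply: eq_bigr => e _ /=.
    by rewrite linZ // ipZr mulrC mulzJ.
  have sg0 : 0 <= sg by rewrite sumr_ge0 // => e _; rewrite sq_ge0.
  have := cauchy_schwarz y (T v); rewrite hv sqR => h.
  have {}h : sg ^+ 2 <= nr y ^+ 2 * (M ^+ 2 * sg).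
    apply: le_trans h _; rewrite ler_wpM2l ?sqr_ge0 // -nv -exprMn.
    by rewrite ler_sqr ?nnegrE ?mulr_ge0 ?nr_ge0.
  have [-> |sgn0] := eqVneq sg 0; first by rewrite mulr_ge0 ?sqr_ge0.
  have sgp : 0 < sg by rewrite lt_neqAle eq_sym sgn0.
  rewrite -(ler_pM2r sgp) -expr2; apply: le_trans h _.
  by rewrite mulrA [X in X * _ <= _]mulrC.
have hS0 y : exists w, forall e, @Defs.basis R H e -> ip w e = ip y (T e).
  by have [w [hw _]] := riesz_fischer (bnd y); exists w.
have [S hS] := choice hS0.
have adj x y : ip (T x) y = ip x (S y).
  apply/eqP; rewrite -subr_eq0; apply/eqP.
  pose f x := ip (T x) y - ip x (S y).
  apply: (@functional_basis_eq0 f (2 * (M ^+ 2 * nr y ^+ 2 + nr (S y) ^+ 2))).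
  - by move=> u v; rewrite /f linD // !ipDl opprD addrACA.
  - by move=> a u; rewrite /f linZ // !ipZl mulrBr.
  - move=> u; rewrite /f.
    have h1 : sq (ip (T u) y) <= M ^+ 2 * nr u ^+ 2 * nr y ^+ 2.
      apply: le_trans (cauchy_schwarz _ _) _; rewrite ler_wpM2r ?sqr_ge0 //.
      by rewrite -exprMn ler_sqr ?nnegrE ?mulr_ge0 ?nr_ge0.
    have h2 := cauchy_schwarz u (S y).
    have h3 (z w : R[i]) : sq (z - w) <= 2 * (sq z + sq w).
      rewrite /sq ReB ImB.
      have := sqr_ge0 (Re z + Re w); have := sqr_ge0 (Im z + Im w); nra.
    apply: le_trans (h3 _ _) _; rewrite -mulrA ler_wpM2l // mulrDl lerD //.
      by rewrite mulrAC.
    by rewrite mulrC.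
  - by move=> e Ee; rewrite /f (ipC (S y)) hS // -ipC subrr.
exists S; split=> //; apply/bounded_opP; split.
  move=> a u v; apply: ip_eqr => x.
  by rewrite -adj !ipDr !ipZr -!adj.
exists M; split => // y.
have [->|Sy] := eqVneq (nr (S y)) 0; first by rewrite mulr_ge0 ?nr_ge0.
have Sp : 0 < nr (S y) by rewrite lt_neqAle eq_sym Sy nr_ge0.
rewrite -(ler_pM2r Sp) -expr2.
have /(congr1 (@Re R)) /= <- := ipxx (S y); rewrite -adj.
apply: le_trans (ler_norm _) _; apply: le_trans (absRe_ip _ _) _.
by rewrite mulrAC ler_wpM2r ?nr_ge0.
Qed.

Lemma adjointP T : bounded_op T ->
  bounded_op (adjoint T) /\ forall x y, ip (T x) y = ip x (adjoint T y).
Proof.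
by move=> /adjoint_exists [S hS]; apply: (@xgetPex _ _ [set S | bounded_op S /\
  forall x y, ip (T x) y = ip x (S y)]); exists S.
Qed.

Lemma selfadjoint_sym T : bounded_op T -> selfadjoint T ->
  forall x y, ip (T x) y = ip x (T y).
Proof. by move=> /adjointP [_ h] e x y; rewrite h e. Qed.

Lemma adjoint_unique T S : bounded_op T -> (forall x y, ip (T x) y = ip x (S y)) ->
  adjoint T = S.
Proof.
move=> /adjointP [_ h] hS; apply/funext => y; apply: ip_eqr => x.
by rewrite -h hS.
Qed.

End bases.

(** * Square roots and absolute values of operators *)

Section square_root.
Context {R : realType} {H : hilbertType R}.
Implicit Types (x y z : H) (T P B : H -> H).

Definition symmetric T := forall x y, ip (T x) y = ip x (T y).

Lemma symmetric_Im T x : symmetric T -> Im (ip (T x) x) = 0.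
Proof.
move=> sT; have /(congr1 (@Im R)) := ipC (T x) x; rewrite -sT ImJ => h.
by move: h; lra.
Qed.

(** Polarisation: a quadratic form that is real on the diagonal is hermitian. *)
Lemma positive_sym P : positive_op P -> symmetric P.
Proof.
move=> [/bounded_opP [lP _] pP].
have im x : Im (ip (P x) x) = 0 by apply: ger0_Im; apply: pP.
have key x y : Im (ip (P x) y) + Im (ip (P y) x) = 0.
  have := im (x + y); rewrite (linD lP) ipDl !ipDr !ImD !im; lra.
move=> x y; rewrite (ipC (P y)); apply: eqC; rewrite ?ReJ ?ImJ.
  have := key x ('i *: y); rewrite (linZ lP) ipZl ipZr !ImM ReJ ImJ /=; lra.
by have := key x y; lra.
Qed.

Lemma positive_Re P x : positive_op P -> 0 <= Re (ip (P x) x).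
Proof. by move=> [_ /(_ x)]; rewrite lecE => /andP []. Qed.

(** The form of B is nonnegative at x - B x. *)
Lemma sym_contraction B x : linear B -> symmetric B ->
  (forall x, 0 <= Re (ip (B x) x) <= nr x ^+ 2) -> nr (B x) ^+ 2 <= Re (ip (B x) x).
Proof.
move=> lB sB hB; have /andP [h1 _] := hB (x - B x).
have /andP [_ h2] := hB (B x).
move: h1; rewrite (linB lB) ipBl !ipBr !ReB ipxx (sB (B x) x) ipxx /=; lra.
Qed.

Section iteration.
Variable B : H -> H.
Hypotheses (lB : linear B) (sB : symmetric B) (nB : forall x, nr (B x) <= nr x).

(** Fixed-point iteration for Y = (B + Y^2) / 2, so that (1 - Y)^2 = 1 - B *)
Fixpoint sqrt_iter (n : nat) : H -> H :=
  if n is m.+1 then fun x => 2^-1%:C *: (B x + sqrt_iter m (sqrt_iter m x))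
  else fun=> 0.

(** The same iteration for the number 1; it dominates the operator one. *)
Fixpoint one_iter (n : nat) : R :=
  if n is m.+1 then 2^-1 * (1 + one_iter m ^+ 2) else 0.

Lemma one_iter_itv n : 0 <= one_iter n <= 1.
Proof. by elim: n => [|n /andP [a b]] /=; rewrite ?lexx ?ler01 //; apply/andP; split; nra. Qed.

Lemma one_iter_incr n : one_iter n <= one_iter n.+1.
Proof. by rewrite /=; have := sqr_ge0 (one_iter n - 1); nra. Qed.

Lemma sqrt_iter_linear n : linear (sqrt_iter n).
Proof.
elim: n => [|n IH] a x y /=; first by rewrite scaler0 addr0.
rewrite lB !IH !scalerA [a * _]mulrC -scalerA -scalerDr; congr (_ *: _).
by rewrite scalerDr addrACA.
Qed.

Lemma sqrt_iter_sym n : symmetric (sqrt_iter n).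
Proof.
elim: n => [|n IH] x y /=; first by rewrite ip0l ip0r.
by rewrite ipZl ipZr conjR ipDl ipDr sB !IH.
Qed.

Lemma sqrt_iter_comm C n : linear C -> (forall x, C (B x) = B (C x)) ->
  forall x, C (sqrt_iter n x) = sqrt_iter n (C x).
Proof.
move=> lC CB; elim: n => [|n IH] x /=; first exact: lin0.
by rewrite (linZ lC) (linD lC) CB !IH.
Qed.

Lemma sqrt_iter_commB n x : B (sqrt_iter n x) = sqrt_iter n (B x).
Proof. exact: sqrt_iter_comm. Qed.

Lemma sqrt_iter_commY m n x : sqrt_iter m (sqrt_iter n x) = sqrt_iter n (sqrt_iter m x).
Proof.
by apply: sqrt_iter_comm; [exact: sqrt_iter_linear|move=> y; rewrite sqrt_iter_commB].
Qed.

Lemma sqrt_iter_nr n x : nr (sqrt_iter n x) <= one_iter n * nr x.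
Proof.
elim: n x => [|n IH] x /=; first by rewrite nr0 mul0r.
rewrite nrZR ger0_norm ?invr_ge0 // -mulrA ler_wpM2l ?invr_ge0 //.
apply: le_trans (nrD _ _) _; rewrite mulrDl mul1r lerD //.
apply: le_trans (IH _) _; rewrite expr2 -mulrA ler_wpM2l //.
by have /andP [] := one_iter_itv n.
Qed.

Lemma sqrt_iter_step n x :
  nr (sqrt_iter n.+1 x - sqrt_iter n x) <= (one_iter n.+1 - one_iter n) * nr x.
Proof.
elim: n x => [|n IH] x.
  rewrite /= addr0 !subr0 expr0n addr0 mulr1 nrZR ger0_norm ?invr_ge0 //.
  by rewrite ler_wpM2l ?invr_ge0.
set Y1 := sqrt_iter n.+1; set Y0 := sqrt_iter n.
have lY1 : linear Y1 := sqrt_iter_linear n.+1.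
have lY0 : linear Y0 := sqrt_iter_linear n.
have -> : sqrt_iter n.+2 x - Y1 x =
    2^-1%:C *: (Y1 (Y1 x - Y0 x) + Y0 (Y1 x - Y0 x)).
  rewrite (linB lY1) (linB lY0) -[Y0 (Y1 x)]sqrt_iter_commY -/Y1 -/Y0 addrA subrK.
  by rewrite [in LHS]/= -/Y0 -scalerBr; congr (_ *: _); rewrite opprD addrACA subrr add0r.
rewrite nrZR ger0_norm ?invr_ge0 //.
have d := IH x; rewrite -/Y1 -/Y0 in d; set D := Y1 x - Y0 x in d *.
have h1 : nr (Y1 D) <= one_iter n.+1 * nr D by apply: sqrt_iter_nr.
have h2 : nr (Y0 D) <= one_iter n * nr D by apply: sqrt_iter_nr.
apply: (@le_trans _ _ (2^-1 * ((one_iter n.+1 + one_iter n) * nr D))).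
  by rewrite ler_wpM2l ?invr_ge0 // (le_trans (nrD _ _)) // mulrDl lerD.
have -> : one_iter n.+2 - one_iter n.+1 = 2^-1 *
    ((one_iter n.+1 + one_iter n) * (one_iter n.+1 - one_iter n)).
  rewrite -[one_iter n.+2]/(2^-1 * (1 + one_iter n.+1 ^+ 2)).
  have : one_iter n.+1 = 2^-1 * (1 + one_iter n ^+ 2) by [].
  by move: (one_iter n.+1) (one_iter n) => a b; lra.
rewrite -[_ * nr x]mulrA ler_wpM2l ?invr_ge0 // -mulrA ler_wpM2l //.
by apply: addr_ge0; [have /andP [] := one_iter_itv n.+1|have /andP [] := one_iter_itv n].
Qed.

Lemma sqrt_iter_dist m n x : (n <= m)%N ->
  nr (sqrt_iter m x - sqrt_iter n x) <= (one_iter m - one_iter n) * nr x.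
Proof.
move=> /subnK <-; elim: (m - n)%N => [|k IH]; first by rewrite add0n !subrr nr0 mul0r.
rewrite addSn -(subrKA (sqrt_iter (k + n) x)); apply: le_trans (nrD _ _) _.
rewrite -(subrKA (one_iter (k + n)) (one_iter _.+1)) mulrDl.
by apply: lerD => //; apply: sqrt_iter_step.
Qed.

Lemma sqrt_iter_lim : exists Y : H -> H, [/\ linear Y, symmetric Y,
  (forall x, nr (Y x) <= nr x) & (forall x, Y x = 2^-1%:C *: (B x + Y (Y x)))].
Proof.
have oc : cvgn one_iter.
  apply: nondecreasing_is_cvgn; first by apply/nondecreasing_seqP => n; apply: one_iter_incr.
  by exists 1 => _ [n _ <-]; have /andP [] := one_iter_itv n.
have oC (eps : R) : 0 < eps -> exists N, forall m n, (N <= n <= m)%N ->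
    one_iter m - one_iter n <= eps.
  move=> e0; have e2 : 0 < eps / 2 by rewrite divr_gt0.
  move/cvg_ex: oc => [l /= /cvgrPdist_le /(_ _ e2) [N _ hN]].
  exists N => m n /andP [Nn nm].
  have := hN n Nn; have := hN m (leq_trans Nn nm); rewrite !ler_norml; lra.
have hY0 x : exists y, tends (fun n => sqrt_iter n x) y.
  apply: complete_nr => eps e0.
  have x1 : 0 < nr x + 1 by rewrite ltr_wpDl ?nr_ge0.
  have [N hN] := oC (eps / (nr x + 1)) (divr_gt0 e0 x1).
  have main m n : (N <= n <= m)%N -> nr (sqrt_iter m x - sqrt_iter n x) <= eps.
    move=> h; apply: le_trans (sqrt_iter_dist _ _) _; first by case/andP: h.
    apply: (@le_trans _ _ (eps / (nr x + 1) * nr x)).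
      by rewrite ler_wpM2r ?nr_ge0 // hN.
    by rewrite -mulrA ler_piMr ?(ltW e0) // ler_pdivrMl // mulr1 lerDl.
  exists N => m n Nm Nn; have [mn|nm] := leqP m n.
    by rewrite nrB main // Nm.
  by rewrite main // Nn ltnW.
have [Y hY] := choice hY0.
have lY : linear Y.
  move=> a x y; apply: tends_unique (hY _) _.
  rewrite (_ : (fun n => _) = (fun n => a *: sqrt_iter n x + sqrt_iter n y)).
    by apply: tendsD => //; apply: tendsZ.
  by apply/funext => n; rewrite sqrt_iter_linear.
have nY x : nr (Y x) <= nr x.
  apply: (cvgR_le (tends_nr (hY x))) => n; apply: le_trans (sqrt_iter_nr _ _) _.
  by rewrite ler_piMl ?nr_ge0 //; have /andP [] := one_iter_itv n.
exists Y; split => // [x y|x].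
  by apply: (tends_ip_eq (hY x) (hY y)) => n; apply: (sqrt_iter_sym n x y).
apply: (tends_unique (u := fun n => sqrt_iter (n + 1) x)); first exact: (tends_shift _ (hY x)).
under eq_fun => n do rewrite addn1 /=.
apply: tendsZ; apply: tendsD; first exact: tends_cst.
apply: (tends_squeeze (f := fun n => nr (sqrt_iter n x - Y x) + nr (sqrt_iter n (Y x) - Y (Y x)))).
  by rewrite -[0 in X in _ --> X]addr0; apply: cvgD; apply: hY.
move=> n; rewrite -(subrKA (sqrt_iter n (Y x))); apply: le_trans (nrD _ _) _.
rewrite lerD // -(linB (sqrt_iter_linear n)); apply: le_trans (sqrt_iter_nr _ _) _.
by rewrite ler_piMl ?nr_ge0 //; have /andP [] := one_iter_itv n.
Qed.
End iteration.

Lemma positive_sqrt S : positive_op S -> exists P, positive_op P /\ P \o P = S.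
Proof.
move=> pS; have sS := positive_sym pS.
have [lS [M [M0 hM]]] := (bounded_opP S).1 pS.1.
pose K := M + 1; have K0 : 0 < K by rewrite ltr_wpDl.
pose B x := x - K^-1%:C *: S x.
have lB : linear B.
  move=> a x y; rewrite /B lS scalerDr !scalerA [K^-1%:C * a]mulrC -scalerA.
  by rewrite scalerBr opprD addrACA.
have sB : symmetric B by move=> x y; rewrite ipBl ipBr ipZl ipZr conjR sS.
have qB x : Re (ip (B x) x) = nr x ^+ 2 - K^-1 * Re (ip (S x) x).
  by rewrite ipBl ReB ipxx ipZl ReM /= mul0r subr0.
have qS x : 0 <= K^-1 * Re (ip (S x) x) <= nr x ^+ 2.
  rewrite mulr_ge0 ?invr_ge0 ?(ltW K0) ?positive_Re //= ler_pdivrMl //.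
  apply: le_trans (ler_norm _) _; apply: le_trans (absRe_ip _ _) _.
  rewrite expr2 mulrA ler_wpM2r ?nr_ge0 //; apply: le_trans (hM _) _.
  by rewrite ler_wpM2r ?nr_ge0 // lerDl.
have nB x : nr (B x) <= nr x.
  rewrite -ler_sqr ?nnegrE ?nr_ge0 //; apply: (@le_trans _ _ (Re (ip (B x) x))).
    by apply: sym_contraction => // y; rewrite qB; have := qS y; lra.
  by rewrite qB; have := qS x; lra.
have [Y [lY sY nY hY]] := sqrt_iter_lim lB sB nB.
pose k := Num.sqrt K; have k2 : k * k = K by rewrite -expr2 sqr_sqrtr // ltW.
exists (fun x => k%:C *: (x - Y x)); split; last first.
  apply/funext => x /=; rewrite (linZ lY) -scalerBr scalerA -rmorphM /= k2.
  rewrite (linB lY); have hx := hY x.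
  have -> : x - Y x - (Y x - Y (Y x)) = K^-1%:C *: S x.
    have e : Y x + Y x = B x + Y (Y x).
      rewrite {1 2}hx -scalerDl -rmorphD /= [_ + _](_ : _ = 1) ?scale1r //.
      by field.
    transitivity (x + Y (Y x) - (Y x + Y x)); first by rewrite opprB opprD addrACA.
    by rewrite e opprD /B opprB addrACA subrr addr0 addrC subrK.
  by rewrite scalerA -rmorphM /= divff ?gt_eqF // scale1r.
split.
  apply/bounded_opP; split.
    move=> a x y; rewrite lY opprD addrACA -scalerBr scalerDr !scalerA.
    by rewrite [a * _]mulrC.
  exists (k * 2); split => [|x]; first by rewrite mulr_ge0 ?sqrtr_ge0.
  rewrite nrZR ger0_norm ?sqrtr_ge0 // -mulrA ler_wpM2l ?sqrtr_ge0 //.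
  by apply: le_trans (nrD _ _) _; rewrite nrN mulr_natl mulr2n lerD.
move=> x; rewrite -/(ip _ _) ipZl ipBl ipxx.
have -> : ip (Y x) x = (Re (ip (Y x) x))%:C.
  by apply: eqC => //=; rewrite symmetric_Im.
rewrite -rmorphB -rmorphM /= ler0c mulr_ge0 ?sqrtr_ge0 // subr_ge0.
apply: le_trans (ler_norm _) _; apply: le_trans (absRe_ip _ _) _.
by rewrite expr2 ler_wpM2r ?nr_ge0.
Qed.

Lemma abs_opP T : bounded_op T ->
  positive_op (abs_op T) /\ forall x, abs_op T (abs_op T x) = adjoint T (T x).
Proof.
move=> bT; have [bA hA] := adjointP bT.
have pA : positive_op (adjoint T \o T).
  split=> [|x /=]; first exact: bounded_op_comp.
  rewrite -/(ip _ _) ipC -hA ipxx conjR ler0c; exact: sqr_ge0.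
have [pP eP] := xgetPex (fun=> 0 : H) (positive_sqrt pA).
split => // x; exact: (congr1 (fun f => f x) eP).
Qed.

Lemma nr_abs_op T x : bounded_op T -> nr (abs_op T x) = nr (T x).
Proof.
move=> bT; have [pP eP] := abs_opP bT; have [bA hA] := adjointP bT.
apply/eqP; rewrite -(eqrXn2 (n := 2)) ?nr_ge0 //; apply/eqP/(@complexI R).
by rewrite -!ipxx (positive_sym pP) eP -hA.
Qed.

End square_root.

(** * The spectral theorem for selfadjoint Hilbert-Schmidt operators *)

(** Dependent choice along the natural numbers, where each choice may use all
the previous ones; G n p should only look at p up to n. *)
Lemma strong_choice (X : Type) (x0 : X) (G : nat -> (nat -> X) -> Prop) :
  (forall n p q, (forall i, (i <= n)%N -> p i = q i) -> G n p -> G n q) ->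
  (forall n p, (forall i, (i < n)%N -> G i p) ->
    exists x, G n (fun i => if i == n then x else p i)) ->
  exists p, forall n, G n p.
Proof.
move=> loc step.
have stepL (L : seq X) : exists x, (forall i, (i < size L)%N -> G i (nth x0 L)) ->
    G (size L) (nth x0 (rcons L x)).
  have [h|h] := pselect (forall i, (i < size L)%N -> G i (nth x0 L)); last by exists x0.
  have [x hx] := step _ _ h; exists x => _; apply: (loc) hx => i il.
  by rewrite nth_rcons; case: ltngtP il => // ->.
have [F hF] := choice stepL.
pose Ls := fix Ls n := if n is m.+1 then rcons (Ls m) (F (Ls m)) else [::].
have sL n : size (Ls n) = n by elim: n => //= n IH; rewrite size_rcons IH.
pose p n := F (Ls n).
have nL n i : (i < n)%N -> nth x0 (Ls n) i = p i.
  elim: n => // n IH; rewrite ltnS leq_eqVlt /= nth_rcons sL => /orP [/eqP ->|il].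
    by rewrite ltnn eqxx.
  by rewrite il IH.
exists p; elim/ltn_ind => n IH.
have := hF (Ls n); rewrite sL => /(_ _) h; apply: (loc) (h _).
  move=> i il; rewrite -[rcons _ _]/(Ls n.+1); exact: nL.
by move=> i il; apply: (loc) (IH i il) => j ji; rewrite nL // (leq_ltn_trans ji).
Qed.

Section spectral_theorem.
Context {R : realType} {H : hilbertType R}.
Implicit Types (x y z : H) (T : H -> H) (s : seq H) (M : R).

(** The square of the Hilbert-Schmidt norm is at most M. *)
Definition hs_le T M := forall s, bsub s -> \sum_(e <- s) nr (T e) ^+ 2 <= M.

Lemma hs_nr T M x : symmetric T -> hs_le T M -> nr (T x) ^+ 2 <= M * nr x ^+ 2.
Proof.
move=> sT hT; apply: nr2_le_sup => s bs.
apply: (@le_trans _ _ (\sum_(e <- s) nr (T e) ^+ 2 * nr x ^+ 2)).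
  apply: ler_sum => e _; rewrite sT mulrC; exact: cauchy_schwarz.
by rewrite -mulr_suml ler_wpM2r ?sqr_ge0 // hT.
Qed.

Lemma approx_bsub (ys : seq H) (eps : R) : 0 < eps ->
  exists2 s, bsub s & forall y, y \in ys -> nr y ^+ 2 <= \sum_(e <- s) sq (ip y e) + eps.
Proof.
move=> e0; elim: ys => [|y ys [s bs hs]]; first by exists [::].
have e1 : 0 < Num.sqrt eps by rewrite sqrtr_gt0.
have [t bt ht] := parseval y e1.
have bu := bsubU bs bt; exists (undup (s ++ t)) => // z; rewrite inE => /orP [/eqP ->|zy].
  have tu : {subset t <= undup (s ++ t)} by move=> e et; rewrite mem_undup mem_cat et orbT.
  have h := ht _ bu tu; have := bessel_eq basis_sys y bu.1 bu.2.
  move=> /eqP; rewrite eq_sym subr_eq addrC => /eqP ->; rewrite lerD2l.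
  by rewrite -[X in _ <= X](sqr_sqrtr (ltW e0)) ler_sqr ?nnegrE ?nr_ge0 ?sqrtr_ge0.
apply: le_trans (hs z zy) _; rewrite lerD2r (@sum_subset _ _ _ s (undup _)) ?bs.1 ?bu.1 //.
  by rewrite lerDl sumr_ge0 // => e _; rewrite sq_ge0.
by move=> e es; rewrite mem_undup mem_cat es.
Qed.

(** The Hilbert-Schmidt norm does not depend on the orthonormal system: exchange
the sums over the two systems and apply Bessel's inequality. *)
Lemma hs_ortho T M (I : eqType) (D : set I) (g : I -> H) (r : seq I) :
  symmetric T -> hs_le T M -> ortho_sys D g -> uniq r -> (forall i, i \in r -> D i) ->
  \sum_(i <- r) nr (T (g i)) ^+ 2 <= M.
Proof.
move=> sT hT og ur rD; apply/ler_addgt0Pl => eps e0.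
have e1 : 0 < eps / (size r).+1%:R by rewrite divr_gt0.
have [s bs hs] := approx_bsub [seq T (g i) | i <- r] e1.
apply: (@le_trans _ _ (\sum_(i <- r) (\sum_(e <- s) sq (ip (T (g i)) e) + eps / (size r).+1%:R))).
  by rewrite !big_seq; apply: ler_sum => i ir; apply: hs; rewrite map_f.
rewrite big_split /= addrC; apply: lerD.
  rewrite big_const_seq count_predT iter_addr_0 -(mulr_natr (eps / _)) -mulrA ler_piMr ?(ltW e0) //.
  by rewrite ler_pdivrMl ?mulr1 // ler_nat.
rewrite exchange_big /=; apply: le_trans (hT s bs); apply: ler_sum => e _.
under eq_bigr => i _ do rewrite sT sq_ipC.
exact: (bessel og).
Qed.

Section top_eigenvector.
Variable T : H -> H.
Hypotheses (lT : linear T) (sT : symmetric T) (nT : forall x, nr (T x) <= nr x).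

Lemma iter_sym m n x y : ip (iter m T x) (iter n T y) = ip (iter (m + n) T x) y.
Proof. by elim: n m y => [|n IH] m y; rewrite ?addn0 //= -sT addnS -addSn -IH. Qed.

Lemma nr_iter_decr x : nonincreasing_seq (fun n => nr (iter n T x) ^+ 2).
Proof.
apply/nonincreasing_seqP => n; rewrite ler_sqr ?nnegrE ?nr_ge0 //; exact: nT.
Qed.

Lemma nr_iter_double m x : nr (iter m T x) ^+ 2 <= nr (iter (m + m) T x) * nr x.
Proof.
have /(congr1 (@Re R)) /= <- := ipxx (iter m T x); rewrite iter_sym.
by apply: le_trans (ler_norm _) _; apply: absRe_ip.
Qed.

Lemma iter_even_dist m n x :
  nr (iter (m + m) T x - iter (n + n) T x) ^+ 2 =
  nr (iter (m + m) T x) ^+ 2 - 2 * nr (iter (m + n) T x) ^+ 2 + nr (iter (n + n) T x) ^+ 2.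
Proof.
rewrite nr2B; congr (_ - 2 * _ + _).
have /(congr1 (@Re R)) /= <- := ipxx (iter (m + n) T x).
by rewrite !iter_sym; congr (Re (ip (iter _ _ _) _)); rewrite addnACA.
Qed.

(** T^(2n) x converges since |T^n x| decreases; the limit is fixed by T^2. *)
Lemma iter_even_lim x : exists2 y, T (T y) = y &
  (fun n => nr (iter n T x) ^+ 2) @ \oo --> nr y ^+ 2.
Proof.
set a := fun n => nr (iter n T x) ^+ 2.
have ac : cvgn a.
  apply: nonincreasing_is_cvgn; first exact: nr_iter_decr.
  by exists 0 => _ [n _ <-]; rewrite sqr_ge0.
move/cvg_ex: ac => [l /= al].
have [y hy] : exists y, tends (fun n => iter (n + n) T x) y.
  apply: complete_nr => eps e0; have e1 : 0 < eps ^+ 2 / 4 by rewrite divr_gt0 // exprn_gt0.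
  move/cvgrPdist_le: (al) => /(_ _ e1) [N _ hN]; exists N => m n Nm Nn.
  rewrite -ler_sqr ?nnegrE ?nr_ge0 ?(ltW e0) // iter_even_dist.
  have h1 := hN _ (leq_trans Nm (leq_addr m m)).
  have h2 := hN _ (leq_trans Nm (leq_addr n m)).
  have h3 := hN _ (leq_trans Nn (leq_addr n n)).
  by move: h1 h2 h3; rewrite -/(a (m + m)) -/(a (m + n)) -/(a (n + n)) !ler_norml; lra.
exists y.
  apply: (tends_unique (u := fun n => iter (n.+1 + n.+1) T x)).
    rewrite (_ : (fun n => _) = (fun n => T (T (iter (n + n) T x)))).
      have bT : bounded_op T.
        by apply/bounded_opP; split => //; exists 1; split=> // z; rewrite mul1r.
      by apply: tends_op => //; apply: tends_op.
    by apply/funext => n; rewrite addnS.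
  by have := tends_shift 1 hy; rewrite /tends; under eq_fun do rewrite addn1.
have h2 : (fun n => a (n + n)%N) @ \oo --> nr y ^+ 2.
  by under eq_fun => n do rewrite /a expr2; apply: cvgM; apply: tends_nr.
suff -> : nr y ^+ 2 = l by [].
apply: cvgR_unique h2 _; apply: cvg_comp al.
apply/cvgnyPge => N; exists N => // n /= Nn; exact: leq_trans Nn (leq_addr _ _).
Qed.

(** |T^m x|^2 <= |T^(2m) x| |x| turns a bound for T^(2m) into one for T^m. *)
Lemma norm_root k (rho : R) : 0 <= rho < 1 ->
  (forall x, nr (iter (2 ^ k) T x) <= rho * nr x) ->
  exists2 rho', 0 <= rho' < 1 & forall x, nr (T x) <= rho' * nr x.
Proof.
elim: k rho => [|k IH] rho /andP [r0 r1] h; first by exists rho; rewrite ?r0.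
apply: (IH (Num.sqrt rho)).
  by rewrite sqrtr_ge0 /= -sqrtr1 ltr_sqrt.
move=> x; rewrite -ler_sqr ?nnegrE ?mulr_ge0 ?sqrtr_ge0 ?nr_ge0 // exprMn sqr_sqrtr //.
apply: le_trans (nr_iter_double _ _) _; rewrite addnn -muln2 -expnSr.
by rewrite expr2 mulrA ler_wpM2r ?nr_ge0.
Qed.

(** If T^(2n) tended to 0 on every basis vector, the Hilbert-Schmidt norm of T^n
would tend to 0 as well, by dominated convergence. *)
Lemma exists_fixed_by_square M : hs_le T M ->
  (forall rho, 0 <= rho < 1 -> ~ forall x, nr (T x) <= rho * nr x) ->
  exists2 y, y <> 0 & T (T y) = y.
Proof.
move=> hT one; apply: contrapT => no.
have lim0 x : (fun n => nr (iter n T x) ^+ 2) @ \oo --> (0 : R).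
  have [y hy] := iter_even_lim x.
  suff -> : y = 0 by rewrite nr0 expr0n.
  by apply: contrapT => y0; apply: no; exists y.
pose A := [set r | exists2 s, bsub s & r = \sum_(e <- s) nr (T e) ^+ 2].
have Asup : has_sup A.
  split; first by exists 0; exists [::]; rewrite ?big_nil //; split.
  by exists M => r [s bs ->]; apply: hT.
have [|_ [s0 b0 ->] hs0] := @sup_adherent _ A (8^-1) _ Asup; first by rewrite invr_gt0.
have tail s : bsub s -> \sum_(e <- [seq e <- s | e \notin s0]) nr (T e) ^+ 2 <= 8^-1.
  move=> bs; set s1 := [seq e <- s | e \notin s0].
  have b1 : bsub (s0 ++ s1).
    split=> [|e].
      rewrite cat_uniq b0.1 filter_uniq ?bs.1 // andbT; apply/hasPn => e.
      by rewrite mem_filter => /andP [].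
    by rewrite mem_cat mem_filter => /orP [/b0.2|/andP [_ /bs.2]].
  have : \sum_(e <- s0 ++ s1) nr (T e) ^+ 2 <= sup A.
    by apply: ub_le_sup; [exact: Asup.2|exists (s0 ++ s1)].
  by rewrite big_cat /=; move: hs0; lra.
have : (fun n => \sum_(e <- s0) nr (iter n T e) ^+ 2) @ \oo --> (0 : R).
  elim: (s0) => [|e s IH].
    by under eq_fun do rewrite big_nil; apply: cvg_cst.
  rewrite (_ : (fun n => _) = (fun n => nr (iter n T e) ^+ 2 +
      \sum_(e <- s) nr (iter n T e) ^+ 2)); last by apply/funext => n; rewrite big_cons.
  by rewrite -[X in _ --> X]addr0; apply: cvgD => //; apply: lim0.
move=> /cvg0P h0; have [n||N hN] := h0 _ (8^-1).
- by apply: sumr_ge0 => e _; rewrite sqr_ge0.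
- by rewrite invr_gt0.
have Nk : (N <= 2 ^ N)%N by rewrite ltnW // ltn_expl.
have hsN : hs_le (iter (2 ^ N) T) 4^-1.
  move=> s bs; rewrite (bigID (mem s0)) /=.
  have -> : 4^-1 = 8^-1 + 8^-1 :> R by field.
  apply: lerD; last first.
    rewrite -big_filter; apply: le_trans (tail s bs); apply: ler_sum => e _.
    have h : (1 <= 2 ^ N)%N by rewrite expn_gt0.
    exact: (nr_iter_decr e h).
  apply: le_trans (hN _ Nk); rewrite -big_filter.
  rewrite (@sum_subset _ _ _ [seq e <- s | e \in s0] s0) ?filter_uniq ?b0.1 ?bs.1 //.
    by rewrite lerDl sumr_ge0 // => e _; rewrite sqr_ge0.
  by move=> e; rewrite mem_filter => /andP [].
have sN : symmetric (iter (2 ^ N) T).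
  by move=> x y; have := iter_sym 0 (2 ^ N) x y; rewrite add0n.
have [||rho r01 hr] := @norm_root N 2^-1.
- by rewrite invr_ge0 ler0n invf_lt1 ?ltr1n.
- move=> x; rewrite -ler_sqr ?nnegrE ?mulr_ge0 ?invr_ge0 ?nr_ge0 // exprMn.
  apply: le_trans (hs_nr x sN hsN) _; rewrite ler_wpM2r ?sqr_ge0 //.
  by rewrite exprVn -natrX.
exact: one r01 hr.
Qed.
End top_eigenvector.

Lemma top_eigenvector T M : linear T -> symmetric T -> hs_le T M ->
  (exists x, T x <> 0) ->
  exists h (t : R), [/\ nr h = 1, t != 0, T h = t%:C *: h & forall x, nr (T x) <= `|t| * nr x].
Proof.
move=> lT sT hT [x0 Tx0].
pose A := [set r | exists2 x, nr x = 1 & r = nr (T x)].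
have unit x : nr x != 0 -> nr ((nr x)^-1%:C *: x) = 1.
  by move=> h; rewrite nrZR ger0_norm ?invr_ge0 ?nr_ge0 // mulVf.
have x0n : nr x0 != 0.
  by apply/eqP => /nr_eq0 h; apply: Tx0; rewrite h lin0.
have Asup : has_sup A.
  split; first by eexists; exists ((nr x0)^-1%:C *: x0); [exact: unit|reflexivity].
  exists (M + 1) => _ [x nx ->]; have := hs_nr x sT hT; rewrite nx expr1n mulr1.
  by have := sqr_ge0 (nr (T x) - 1); have := sqr_ge0 (nr (T x)); nra.
pose l := sup A.
have hl x : nr (T x) <= l * nr x.
  have [nx|nx] := eqVneq (nr x) 0.
    by rewrite (nr_eq0 nx) lin0 // nr0 mulr0.
  have xp : 0 < nr x by rewrite lt_neqAle eq_sym nx nr_ge0.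
  rewrite -ler_pdivrMr // mulrC.
  have -> : (nr x)^-1 * nr (T x) = nr (T ((nr x)^-1%:C *: x)).
    by rewrite linZ // nrZR ger0_norm ?invr_ge0 ?nr_ge0.
  by apply: ub_le_sup; [exact: Asup.2|exists ((nr x)^-1%:C *: x); rewrite ?unit].
have l0 : 0 < l.
  have p0 : 0 < nr (T x0).
    by rewrite lt_neqAle eq_sym nr_ge0 andbT; apply/eqP => /nr_eq0.
  by have := hl x0; have := nr_ge0 x0; nra.
pose T' x := l^-1%:C *: T x.
have nT'E x : nr (T' x) = l^-1 * nr (T x) by rewrite nrZR ger0_norm ?invr_ge0 ?(ltW l0).
have lT' : linear T' by move=> a x y; rewrite /T' lT scalerDr !scalerA [a * _]mulrC.
have sT' : symmetric T' by move=> x y; rewrite /T' ipZl ipZr conjR sT.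
have nT' x : nr (T' x) <= nr x by rewrite nT'E ler_pdivrMl.
have hT' : hs_le T' (l^-1 ^+ 2 * M).
  move=> s bs; under eq_bigr => e _ do rewrite nT'E exprMn.
  by rewrite -mulr_sumr ler_wpM2l ?sqr_ge0 // hT.
have [|y y0 hy] := exists_fixed_by_square lT' sT' nT' hT'.
  move=> rho /andP [r0 r1] h.
  suff : l <= rho * l by nra.
  apply: ge_sup; first exact: Asup.1.
  move=> _ [x nx ->]; have := h x; rewrite nT'E nx mulr1 ler_pdivrMl //.
  by rewrite [rho * _]mulrC.
(* Since (T' - 1) (T' + 1) y = 0, either T' y = - y or y + T' y is fixed by T' *)
have [w [s [w0 s1 ws]]] : exists w (s : R), [/\ w <> 0, `|s| = 1 & T' w = s%:C *: w].
  have [e|ne] := pselect (y + T' y = 0); last first.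
    exists (y + T' y), 1; split; rewrite ?normr1 // scale1r (linD lT') hy addrC //.
  exists y, (-1); split; rewrite ?normrN1 // rmorphN1 scaleN1r.
  by apply/eqP; rewrite -addr_eq0 addrC e.
have w1 : nr w != 0 by apply/eqP => /nr_eq0.
have s0 : s != 0 by rewrite -normr_eq0 s1 oner_eq0.
exists ((nr w)^-1%:C *: w), (s * l); split; first exact: unit.
- by rewrite mulf_neq0 // gt_eqF.
- rewrite (linZ lT).
  have -> : T w = (s * l)%:C *: w.
    have : l%:C *: T' w = (s * l)%:C *: w by rewrite ws scalerA -rmorphM mulrC.
    by rewrite /T' scalerA -rmorphM divff ?gt_eqF // scale1r.
  by rewrite !scalerA mulrC.
- by move=> x; rewrite normrM s1 mul1r gtr0_norm.
Qed.

(** Composing T with the projection Q to the orthogonal complement of the eigenvectors found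
so far yields the next one. If T vanishes there, any unit vector of the complement will do. *)
Lemma next_eigenvector T M (p : nat -> H * R) n : linear T -> symmetric T -> hs_le T M ->
  ortho_sys [set i | (i < n)%N] (fun i => (p i).1) ->
  (forall i, (i < n)%N -> T (p i).1 = (p i).2%:C *: (p i).1) ->
  exists q : H * R, [/\ nr q.1 = 1 \/ q = (0, 0) /\
      (forall x, (forall i, (i < n)%N -> ip x (p i).1 = 0) -> x = 0),
    forall i, (i < n)%N -> ip q.1 (p i).1 = 0, T q.1 = q.2%:C *: q.1 &
    forall x, (forall i, (i < n)%N -> ip x (p i).1 = 0) -> nr (T x) <= `|q.2| * nr x].
Proof.
move=> lT sT hT op ep.
pose r := index_iota 0 n; have rD i : i \in r -> [set i | (i < n)%N] i.
  by rewrite mem_index_iota.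
have ur : uniq r by apply: iota_uniq.
pose Q x := x - \sum_(i <- r) ip x (p i).1 *: (p i).1.
have Qp x i : (i < n)%N -> ip (Q x) (p i).1 = 0.
  by move=> il; apply: (proj_orth op) => //; rewrite mem_index_iota.
have Qid x : (forall i, (i < n)%N -> ip x (p i).1 = 0) -> Q x = x.
  move=> h; rewrite /Q big_seq big1 ?subr0 // => i /rD /h ->; exact: scale0r.
have lQ : linear Q.
  move=> a x y; rewrite /Q scalerBr scaler_sumr.
  under eq_bigr => i _ do rewrite ipDl ipZl scalerDl -scalerA.
  by rewrite big_split /= opprD addrACA.
have nQ x : nr (Q x) <= nr x.
  rewrite -ler_sqr ?nnegrE ?nr_ge0 // (bessel_eq op) // gerBl.
  by apply: sumr_ge0 => i _; apply: sq_ge0.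
have sQ : symmetric Q.
  move=> x y; rewrite /Q ipBl ipBr ip_suml ip_sumr; congr (_ - _).
  by apply: eq_bigr => i _; rewrite ipZl ipZr -ipC mulrC.
have TQ x : T (Q x) = Q (T x).
  rewrite /Q linB // lin_sum //; congr (_ - _); apply: eq_big_seq => i /rD il.
  by rewrite linZ // ep // scalerA sT ep // ipZr conjR mulrC.
have lTQ : linear (T \o Q) by move=> a x y /=; rewrite lQ lT.
have sTQ : symmetric (T \o Q) by move=> x y /=; rewrite sT sQ TQ.
have hTQ : hs_le (T \o Q) M.
  move=> s bs; apply: le_trans (hT s bs); apply: ler_sum => e _ /=.
  by rewrite TQ ler_sqr ?nnegrE ?nr_ge0.
have [Tn0|T0] := pselect (exists x, T (Q x) <> 0).
  have [h [t [h1 t0 hh ht]]] := top_eigenvector lTQ sTQ hTQ Tn0.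
  have hp i : (i < n)%N -> ip h (p i).1 = 0.
    move=> il; have : ip (T (Q h)) (p i).1 = 0 by rewrite TQ Qp.
    move/eqP; rewrite [T (Q h)]hh ipZl mulf_eq0 => /orP [/eqP/complexI/eqP|/eqP //].
    by rewrite (negbTE t0).
  exists (h, t); split => //=; first by left.
    by rewrite -hh /= Qid.
  by move=> x /Qid {1}<-; apply: ht.
have Tx0 x : (forall i, (i < n)%N -> ip x (p i).1 = 0) -> T x = 0.
  by move=> /Qid xQ; apply: contrapT => h; apply: T0; exists x; rewrite xQ.
have [[x [hx x0]]|no] := pselect (exists x, (forall i, (i < n)%N -> ip x (p i).1 = 0) /\ x <> 0).
  have x1 : nr x != 0 by apply/eqP => /nr_eq0.
  exists ((nr x)^-1%:C *: x, 0); split => /=.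
  - by left; rewrite nrZR ger0_norm ?invr_ge0 ?nr_ge0 // mulVf.
  - by move=> i il; rewrite ipZl hx ?mulr0.
  - by rewrite linZ // Tx0 // scaler0 scale0r.
  - by move=> y /Tx0 ->; rewrite nr0 normr0 mul0r.
exists (0, 0); split => /=.
- by right; split => // x hx; apply: contrapT => x0; apply: no; exists x.
- by move=> i _; rewrite ip0l.
- by rewrite lin0 // scaler0.
- by move=> y /Tx0 ->; rewrite nr0 normr0 mul0r.
Qed.

(** The vectors h n vanish from some index on if, and only if, the space is
finite-dimensional, whatever the rank of T. *)
Theorem spectral_theorem T M : linear T -> symmetric T -> hs_le T M ->
  exists (h : nat -> H) (t : nat -> R),
  [/\ ortho_sys setT h, forall n, T (h n) = (t n)%:C *: h n,
    forall n, `|t n.+1| <= `|t n|,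
    forall n, h n = 0 -> t n = 0 /\ forall x, (forall i, (i < n)%N -> ip x (h i) = 0) -> x = 0 &
    forall x, tends (fun n => \sum_(0 <= i < n) ((t i)%:C * ip x (h i)) *: h i) (T x)].
Proof.
move=> lT sT hT.
pose G n (p : nat -> H * R) := [/\ nr (p n).1 = 1 \/ p n = (0, 0) /\
      (forall x, (forall i, (i < n)%N -> ip x (p i).1 = 0) -> x = 0),
    forall i, (i < n)%N -> ip (p n).1 (p i).1 = 0, T (p n).1 = (p n).2%:C *: (p n).1 &
    forall x, (forall i, (i < n)%N -> ip x (p i).1 = 0) -> nr (T x) <= `|(p n).2| * nr x].
have sysG p (D : set nat) : (forall i, D i -> G i p) -> ortho_sys D (fun i => (p i).1).
  move=> h; split=> [i j Di Dj|i Di]; last first.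
    by have [[->|[-> _]] _ _ _] := h i Di; [right|left].
  rewrite neq_ltn => /orP [ij|ji]; first by apply: ip_eq0C; have [_ -> //] := h j Dj.
  by have [_ -> //] := h i Di.
have [p hp] : exists p, forall n, G n p.
  apply: (strong_choice (0, 0)) => [n p q pq [h1 h2 h3 h4]|n p hp].
    have pq' i : (i < n)%N -> p i = q i by move=> /ltnW; apply: pq.
    rewrite /G -pq //; split => //.
    - case: h1 => [|[-> h1]]; [by left|right; split=> // x hx; apply: h1 => i il].
      by rewrite pq' // hx.
    - by move=> i il; rewrite -pq' // h2.
    - by move=> x hx; apply: h4 => i il; rewrite pq' // hx.
  have [|i il|q [h1 h2 h3 h4]] := @next_eigenvector T M p n lT sT hT.
  - exact: sysG.
  - by have [_ _ ->] := hp i il.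
  exists q; rewrite /G eqxx; split => //.
  - case: h1 => [|[-> h1]]; [by left|right; split=> // x hx; apply: h1 => i il].
    by have := hx i il; rewrite (ltn_eqF il).
  - by move=> i il; rewrite (ltn_eqF il) h2.
  - by move=> x hx; apply: h4 => i il; have := hx i il; rewrite (ltn_eqF il).
pose h n := (p n).1; pose t n := (p n).2.
have oh : ortho_sys setT h by apply: sysG.
have th n : T (h n) = (t n)%:C *: h n by have [] := hp n.
have hz n : h n = 0 -> t n = 0 /\
    forall x, (forall i, (i < n)%N -> ip x (h i) = 0) -> x = 0.
  have [[n1|[n0 hx]] _ _ _] := hp n; rewrite /h /t; last by rewrite n0.
  by move=> n0; move: n1; rewrite n0 nr0 => /esym/eqP; rewrite oner_eq0.
have tn n : nr (T (h n)) = `|t n|.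
  rewrite th nrZR; have [/hz [-> _]|->] := oh.2 n I; last by rewrite mulr1.
  by rewrite normr0 mul0r.
have decr n : `|t n.+1| <= `|t n|.
  rewrite -tn; have [_ _ _ hx] := hp n.
  apply: le_trans (hx _ _) _ => [i il|].
    by have [_ -> //] := hp n.+1; rewrite ltnW.
  by rewrite ler_piMr // (nr_sys_le1 oh).
exists h, t; split => // x.
have decr2 i n : (i <= n)%N -> `|t n| <= `|t i|.
  by move=> /subnK <-; elim: (n - i)%N => // k IH; rewrite addSn (le_trans (decr _)).
have M0 : 0 <= M by apply: le_trans (hT [::] _); rewrite ?big_nil //; split.
have t2 n : t n ^+ 2 <= M / n.+1%:R.
  rewrite ler_pdivlMr // mulr_natr.
  have := @hs_ortho T M _ _ h (index_iota 0 n.+1) sT hT oh (iota_uniq _ _) (fun _ _ => I).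
  apply: le_trans; rewrite -[X in _ *+ X](subn0 n.+1) -sumr_const_nat.
  rewrite !big_nat; apply: ler_sum => i /andP [_ il]; rewrite tn.
  by rewrite -[X in X <= _]real_normK ?num_real // ler_sqr ?nnegrE // decr2.
have t0 : (fun n => `|t n|) @ \oo --> (0 : R).
  apply/cvg0P => // eps e0.
  have e1 : 0 < eps ^+ 2 / (M + 1) by rewrite divr_gt0 ?exprn_gt0 // ltr_wpDl.
  have [n|N hN] := (cvg0P (f := fun n => n.+1%:R^-1) _).1 cvg_harmonic _ e1.
    by rewrite invr_ge0.
  exists N => n /hN hn; rewrite -ler_sqr ?nnegrE ?(ltW e0) // real_normK ?num_real //.
  apply: le_trans (t2 n) _; move: hn; rewrite ler_pdivlMr ?ltr_wpDl //.
  apply: le_trans; rewrite mulrC ler_wpM2l ?invr_ge0 // lerDl //.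
apply: (tends_squeeze (f := fun n => `|t n| * nr x)).
  by rewrite -[0 in X in _ --> X](mul0r (nr x)); apply: cvgMl.
move=> n; rewrite nrB.
have -> : \sum_(0 <= i < n) ((t i)%:C * ip x (h i)) *: h i =
    T (\sum_(0 <= i < n) ip x (h i) *: h i).
  by rewrite lin_sum //; apply: eq_bigr => i _; rewrite linZ // th scalerA mulrC.
rewrite -linB //; have [_ _ _ hx] := hp n.
have op := fun i (il : (i < n)%N) => proj_orth oh x (iota_uniq 0 (n - 0)) (fun _ _ => I)
  (etrans (mem_index_iota 0 n i) il).
apply: le_trans (hx _ op) _; rewrite ler_wpM2l //.
rewrite -ler_sqr ?nnegrE ?nr_ge0 // (bessel_eq oh) ?iota_uniq // gerBl.
by apply: sumr_ge0 => i _; apply: sq_ge0.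
Qed.
End spectral_theorem.

(** * Absolutely summable real sequences *)

Section absolutely_summable_sequences.
Context {R : realType}.
Implicit Types (a b c z : nat -> R).

Definition summ a := exists M, forall n, \sum_(0 <= i < n) `|a i| <= M.
Definition tsum a : R := limn (series a).

Lemma seriesE a n : series a n = \sum_(0 <= i < n) a i.
Proof. by []. Qed.

Lemma summ_bound a M : (forall n, \sum_(0 <= i < n) `|a i| <= M) -> summ a.
Proof. by exists M. Qed.

Lemma summ_cvg a : summ a -> series a @ \oo --> tsum a.
Proof.
move=> [M hM]; suff /normed_cvg h : cvgn (series (fun i => `|a i|)) by apply: h.
apply: nondecreasing_is_cvgn.
  by apply/nondecreasing_seqP => n; rewrite seriesSr lerDl.
by exists M => _ [n _ <-]; apply: hM.
Qed.

Lemma summ_abs a : summ a -> summ (fun i => `|a i|).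
Proof. by move=> [M hM]; exists M => n; under eq_bigr do rewrite normr_id. Qed.

Lemma tsum_le_bound a M : summ a -> (forall n, \sum_(0 <= i < n) a i <= M) -> tsum a <= M.
Proof. by move=> /summ_cvg ha h; apply: cvgR_le ha h. Qed.

Lemma sum_le_tsum a n : summ a -> (forall i, 0 <= a i) -> \sum_(0 <= i < n) a i <= tsum a.
Proof.
move=> ha a0; have hc := summ_cvg ha.
apply: (@nondecreasing_cvgn_le _ (series a)); last by apply/cvg_ex; exists (tsum a).
by apply/nondecreasing_seqP => m; rewrite seriesSr lerDl.
Qed.
Arguments sum_le_tsum [a] n.

Lemma sum_abs_le_tsum a n : summ a -> \sum_(0 <= i < n) `|a i| <= tsum (fun i => `|a i|).
Proof. by move=> /summ_abs ha; apply: sum_le_tsum. Qed.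
Arguments sum_abs_le_tsum [a] n.

Lemma summ_le b a : summ b -> (forall i, `|a i| <= b i) -> summ a.
Proof.
move=> hb h; apply: (@summ_bound _ (tsum (fun i => `|b i|))) => n.
apply: le_trans (sum_abs_le_tsum n hb); apply: ler_sum => i _.
by apply: le_trans (h i) _; apply: ler_norm.
Qed.

Lemma summ_eq a b : a =1 b -> summ a -> summ b.
Proof. by move=> /funext ->. Qed.

Lemma tsum_eq a b : a =1 b -> tsum a = tsum b.
Proof. by move=> /funext ->. Qed.

Lemma summD a b : summ a -> summ b -> summ (fun i => a i + b i).
Proof.
move=> ha hb.
apply: (@summ_bound _ (tsum (fun i => `|a i|) + tsum (fun i => `|b i|))) => n.
apply: le_trans (lerD (sum_abs_le_tsum n ha) (sum_abs_le_tsum n hb)).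
by rewrite -big_split; apply: ler_sum => i _; apply: ler_normD.
Qed.

Lemma summZ k a : summ a -> summ (fun i => k * a i).
Proof.
move=> ha; apply: (@summ_bound _ (`|k| * tsum (fun i => `|a i|))) => n.
under eq_bigr do rewrite normrM.
by rewrite -mulr_sumr ler_wpM2l // sum_abs_le_tsum.
Qed.
Arguments summZ k [a].

Lemma summN a : summ a -> summ (fun i => - a i).
Proof. by move=> /(summZ (-1)); apply: summ_eq => i; rewrite mulN1r. Qed.

Lemma summB a b : summ a -> summ b -> summ (fun i => a i - b i).
Proof. by move=> ha /summN; apply: summD. Qed.

Lemma summ0 : summ (fun=> 0).
Proof. by apply: (@summ_bound _ 0) => n; rewrite big1 // => i _; rewrite normr0. Qed.

Lemma tsum_unique a l : series a @ \oo --> l -> tsum a = l.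
Proof. by move=> h; apply: (cvg_lim (@norm_hausdorff _ _) h). Qed.

Lemma tsumD a b : summ a -> summ b -> tsum (fun i => a i + b i) = tsum a + tsum b.
Proof.
move=> /summ_cvg ha /summ_cvg hb; apply: tsum_unique.
have -> : series (fun i => a i + b i) = (fun n => series a n + series b n).
  by apply/funext => n; rewrite !seriesE big_split.
exact: cvgD.
Qed.

Lemma tsumZ k a : summ a -> tsum (fun i => k * a i) = k * tsum a.
Proof.
move=> /summ_cvg ha; apply: tsum_unique.
have -> : series (fun i => k * a i) = (fun n => k * series a n).
  by apply/funext => n; rewrite !seriesE mulr_sumr.
exact: cvgMr.
Qed.

Lemma tsumN a : summ a -> tsum (fun i => - a i) = - tsum a.
Proof. by move=> ha; rewrite -mulN1r -tsumZ //; apply: tsum_eq => i; rewrite mulN1r. Qed.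

Lemma tsumB a b : summ a -> summ b -> tsum (fun i => a i - b i) = tsum a - tsum b.
Proof. by move=> ha hb; rewrite tsumD ?tsumN //; apply: summN. Qed.

Lemma tsum0 : tsum (fun=> 0) = 0.
Proof.
apply: tsum_unique; have -> : series (fun=> 0 : R) = fun=> 0.
  by apply/funext => n; rewrite seriesE big1.
exact: cvg_cst.
Qed.

Lemma tsum_ge0 a : summ a -> (forall i, 0 <= a i) -> 0 <= tsum a.
Proof. by move=> ha a0; apply: le_trans (sum_le_tsum 0 ha a0); rewrite big_nil. Qed.

Lemma tsum_le a b : summ a -> summ b -> (forall i, a i <= b i) -> tsum a <= tsum b.
Proof.
move=> ha hb h; rewrite -subr_ge0 -tsumB // tsum_ge0 ?subr_ge0 //; first exact: summB.
by move=> i; rewrite subr_ge0.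
Qed.

Lemma abs_tsum_le a : summ a -> `|tsum a| <= tsum (fun i => `|a i|).
Proof.
move=> ha; have ha' := summ_abs ha; rewrite ler_norml -tsumN //.
rewrite !tsum_le //; first by move=> i; apply: ler_norm.
  exact: summN.
by move=> i; rewrite lerNl -normrN ler_norm.
Qed.

Lemma ler_term_tsum a i : summ a -> (forall i, 0 <= a i) -> a i <= tsum a.
Proof.
move=> ha a0; apply: le_trans (sum_le_tsum i.+1 ha a0).
by rewrite big_nat_recr //= lerDr sumr_ge0.
Qed.
Arguments ler_term_tsum [a] i.

Lemma sum_shift a n m : \sum_(0 <= i < m) a (n + i)%N = \sum_(n <= i < n + m) a i.
Proof.
rewrite -[n in RHS]add0n [RHS]big_addn add0n addKn.
by apply: eq_bigr => i _; rewrite addnC.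
Qed.

Lemma summ_shift a n : summ a -> summ (fun i => a (n + i)%N).
Proof.
move=> ha; apply: (@summ_bound _ (tsum (fun i => `|a i|))) => m.
apply: le_trans (sum_abs_le_tsum (n + m) ha).
rewrite (sum_shift (fun i => `|a i|)) [leRHS](big_cat_nat _ (leq_addr m n)) //=.
by rewrite lerDr sumr_ge0.
Qed.
Arguments summ_shift [a] n _.

Lemma tsum_split a n : summ a -> tsum a = \sum_(0 <= i < n) a i + tsum (fun i => a (n + i)%N).
Proof.
move=> ha; apply: tsum_unique; rewrite -(cvg_shiftn n).
have -> : (fun m => series a (m + n)%N) =
    (fun m => \sum_(0 <= i < n) a i + series (fun i => a (n + i)%N) m).
  apply/funext => m; rewrite !seriesE sum_shift [in LHS]addnC.
  by rewrite (big_cat_nat _ (leq_addr m n)).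
apply: cvgD; first exact: cvg_cst.
by apply: summ_cvg; apply: summ_shift.
Qed.
Arguments tsum_split [a] n.

Lemma summ_tail a (eps : R) : summ a -> 0 < eps ->
  exists N, forall n, (N <= n)%N -> tsum (fun i => `|a (n + i)%N|) <= eps.
Proof.
move=> ha e0; have ha' := summ_abs ha; have /cvgrPdist_le /(_ _ e0) [N _ hN] := summ_cvg ha'.
exists N => n /hN; rewrite (tsum_split n ha') addrAC subrr add0r.
exact/le_trans/ler_norm.
Qed.

Lemma summ_small a (eps : R) : summ a -> 0 < eps ->
  exists N, forall n, (N <= n)%N -> `|a n| <= eps.
Proof.
move=> ha e0; have [N hN] := summ_tail ha e0; exists N => n /hN; apply: le_trans.
have := ler_term_tsum 0 (summ_shift n (summ_abs ha)).
by rewrite addn0; apply.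
Qed.

Lemma sum_indicator k (x : R) n :
  \sum_(0 <= i < n) (if i == k then x else 0) = if (k < n)%N then x else 0.
Proof.
elim: n => [|n IH]; first by rewrite big_nil.
rewrite big_nat_recr //= IH ltnS; case: (ltngtP k n) => // h; rewrite ?addr0 ?add0r //.
Qed.

Lemma summ1 k (x : R) : summ (fun i => if i == k then x else 0).
Proof.
apply: (@summ_bound _ `|x|) => n.
rewrite (eq_bigr (fun i => if i == k then `|x| else 0)).
  by rewrite sum_indicator; case: ifP.
by move=> i _; case: ifP; rewrite ?normr0.
Qed.

Lemma tsum1 k (x : R) : tsum (fun i => if i == k then x else 0) = x.
Proof.
apply: tsum_unique; rewrite -(cvg_shiftn k.+1).
have -> : (fun n => series (fun i => if i == k then x else 0) (n + k.+1)%N) = fun=> x.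
  by apply/funext => n; rewrite seriesE sum_indicator addnS ltnS leq_addl.
exact: cvg_cst.
Qed.

Lemma tsum_recl a : summ a -> tsum a = a 0 + tsum (fun i => a i.+1).
Proof. by move=> ha; rewrite (tsum_split 1 ha) big_nat1. Qed.

Lemma summ_change2 a b (j k : nat) x y : summ a -> j != k ->
  (forall i, b i = a i + (if i == j then x else 0) + (if i == k then y else 0)) ->
  summ b /\ tsum b = tsum a + x + y.
Proof.
move=> ha jk /funext ->; have hj : summ _ := @summ1 j x; have hk : summ _ := @summ1 k y.
have hjk := summD ha hj; split; first exact: summD.
by rewrite (tsumD hjk hk) (tsumD ha hj) !tsum1.
Qed.

Lemma tsum_sum I (r : seq I) (f : I -> nat -> R) : (forall j, summ (f j)) ->
  summ (fun i => \sum_(j <- r) f j i) /\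
  tsum (fun i => \sum_(j <- r) f j i) = \sum_(j <- r) tsum (f j).
Proof.
move=> hf; elim: r => [|j r [h1 h2]].
  rewrite big_nil; have -> : (fun i => \sum_(j <- [::]) f j i) = (fun=> 0).
    by apply/funext => i; rewrite big_nil.
  by split; [exact: summ0|exact: tsum0].
have -> : (fun i => \sum_(j <- j :: r) f j i) = (fun i => f j i + \sum_(j <- r) f j i).
  by apply/funext => i; rewrite big_cons.
by rewrite big_cons -h2; split; [exact: summD|rewrite tsumD].
Qed.

End absolutely_summable_sequences.
Arguments sum_le_tsum {R} [a] n.
Arguments sum_abs_le_tsum {R} [a] n.
Arguments summZ {R} k [a].
Arguments ler_term_tsum {R} [a] i.
Arguments summ_shift {R} [a] n _.
Arguments tsum_split {R} [a] n.

(** * Trace norm and trace in terms of eigenvalues *)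

Section trace_norm_and_trace.
Context {R : realType} {H : hilbertType R}.
Implicit Types (x y : H) (z w : R[i]) (T A : H -> H) (s : seq H) (r : R).

Lemma trace_norm_leP T r : (trace_norm T <= r%:E)%E <->
  forall s, bsub s -> \sum_(e <- s) Re (ip (abs_op T e) e) <= r.
Proof.
split=> h.
  move=> s [us bs]; rewrite -lee_fin; apply: le_trans h.
  apply: ereal_sup_ubound; exists [set` s].
    by split; [exact: finite_seq|move=> e /= /bs].
  by rewrite -fsbig_seq // sumEFin.
apply: ge_ereal_sup => _ [A [fA Ab] <-]; rewrite fsbig_finite //= sumEFin lee_fin.
apply: h; split=> [|e]; first exact: finmap.fset_uniq.
by rewrite in_fset_set // inE => /Ab.
Qed.

Section finite_trace_norm.
Variables (T : H -> H) (r : R).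
Hypotheses (bT : bounded_op T) (hT : (trace_norm T <= r%:E)%E).

(** A square root of |T| turns the trace norm of T into a Hilbert-Schmidt norm, which can be
computed in any orthonormal system. *)
Lemma abs_op_sqrt : exists Q : H -> H, [/\ positive_op Q, symmetric Q,
  forall x, Q (Q x) = abs_op T x & hs_le Q r].
Proof.
have [pP _] := abs_opP bT; have [Q [pQ eQ]] := positive_sqrt pP.
have sQ := positive_sym pQ; exists Q; split => //.
  by move=> x; rewrite -eQ.
move=> s bs; apply: le_trans ((trace_norm_leP _ _).1 hT s bs).
apply: ler_sum => e _; rewrite -eQ /= sQ.
by have /(congr1 (@Re R)) /= -> := ipxx (Q e).
Qed.

Lemma trace_norm_ge0 : 0 <= r.
Proof. by have := (trace_norm_leP _ _).1 hT [::]; rewrite big_nil; apply; split. Qed.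

Lemma nr_le_trace_norm x : nr (T x) <= r * nr x.
Proof.
have [Q [pQ sQ eQ hQ]] := abs_op_sqrt.
rewrite -(nr_abs_op x bT) -eQ -ler_sqr ?nnegrE ?mulr_ge0 ?nr_ge0 ?trace_norm_ge0 //.
apply: le_trans (hs_nr _ sQ hQ) _; rewrite exprMn expr2 -mulrA.
by rewrite ler_wpM2l ?trace_norm_ge0 // hs_nr.
Qed.

Lemma hs_trace_norm : hs_le T (r * r).
Proof.
have [Q [pQ sQ eQ hQ]] := abs_op_sqrt; move=> s bs.
apply: (@le_trans _ _ (\sum_(e <- s) r * nr (Q e) ^+ 2)).
  by apply: ler_sum => e _; rewrite -(nr_abs_op e bT) -eQ hs_nr.
by rewrite -mulr_sumr ler_wpM2l ?trace_norm_ge0 // hQ.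
Qed.

Lemma sum_abs_op (I : eqType) (D : set I) (g : I -> H) (l : seq I) :
  ortho_sys D g -> uniq l -> (forall i, i \in l -> D i) ->
  \sum_(i <- l) Re (ip (abs_op T (g i)) (g i)) <= r.
Proof.
move=> og ul lD; have [Q [pQ sQ eQ hQ]] := abs_op_sqrt.
apply: le_trans (hs_ortho sQ hQ og ul lD); apply: ler_sum => i _.
by rewrite -eQ sQ; have /(congr1 (@Re R)) /= -> := ipxx (Q (g i)).
Qed.

End finite_trace_norm.

(** The vector w = |T| h - |t| h satisfies |T| w = - |t| w, while |T| is positive. *)
Lemma abs_op_eigen T h (t : R) : bounded_op T -> symmetric T -> T h = t%:C *: h ->
  abs_op T h = `|t|%:C *: h.
Proof.
move=> bT sT Th; have [pP hP] := abs_opP bT.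
have [lP _] := (bounded_opP _).1 pP.1; have [lT _] := (bounded_opP _).1 bT.
have [t0|t0] := eqVneq t 0.
  rewrite t0 normr0 scale0r; apply: nr_eq0.
  by rewrite (nr_abs_op h bT) Th t0 scale0r nr0.
pose w := abs_op T h - `|t|%:C *: h.
have Pw : abs_op T w = - (`|t|%:C *: w).
  rewrite (linB lP) (linZ lP) hP (adjoint_unique bT sT) Th (linZ lT) Th !scalerA -!rmorphM.
  rewrite scalerBr scalerA -rmorphM opprB; congr (_ *: _ - _).
  by rewrite -normrM ger0_norm // -expr2 sqr_ge0.
apply/eqP; rewrite -subr_eq0; apply/eqP/nr_eq0/eqP; rewrite -/w -sqrf_eq0.
have := positive_Re w pP; rewrite Pw ipNl ipZl ipxx ReN -rmorphM /= oppr_ge0 => h1.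
have : `|t| * nr w ^+ 2 == 0 by rewrite eq_le h1 mulr_ge0 ?sqr_ge0.
by rewrite mulf_eq0 normr_eq0 (negbTE t0).
Qed.

(** T is the operator \sum_n t_n <., h_n> h_n. *)
Definition diagonal_in T (t : nat -> R) (h : nat -> H) :=
  forall x, tends (fun n => \sum_(0 <= i < n) ((t i)%:C * ip x (h i)) *: h i) (T x).

Lemma diagonal_Re T t h x y : diagonal_in T t h ->
  (fun n => \sum_(0 <= i < n) t i * Re (ip x (h i) * ip (h i) y)) @ \oo --> Re (ip (T x) y).
Proof.
move=> /(_ x) /tends_Re => /(_ y).
under eq_fun do (rewrite ip_suml Re_sum; under eq_bigr do
  rewrite ipZl -mulrA ReM /= mul0r subr0).
by [].
Qed.
Arguments diagonal_Re [T t h] x y.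

Lemma diagonal_Im T t h x y : diagonal_in T t h ->
  (fun n => \sum_(0 <= i < n) t i * Im (ip x (h i) * ip (h i) y)) @ \oo --> Im (ip (T x) y).
Proof.
move=> /(_ x) /tends_Im => /(_ y).
under eq_fun do (rewrite ip_suml Im_sum; under eq_bigr do
  rewrite ipZl -mulrA ImM /= mul0r addr0).
by [].
Qed.
Arguments diagonal_Im [T t h] x y.

Lemma diagonal_quad T t h x : diagonal_in T t h ->
  (fun n => \sum_(0 <= i < n) t i * sq (ip x (h i))) @ \oo --> Re (ip (T x) x).
Proof.
move=> /(diagonal_Re x x); under eq_fun do under eq_bigr do rewrite (ipC x) mulzJ /=.
by [].
Qed.
Arguments diagonal_quad [T t h] x.

Lemma abs_op_diagonal T t h : bounded_op T -> symmetric T -> ortho_sys setT h ->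
  (forall n, T (h n) = (t n)%:C *: h n) -> diagonal_in T t h ->
  diagonal_in (abs_op T) (fun n => `|t n|) h.
Proof.
move=> bT sT oh th dT x; have [pP hP] := abs_opP bT.
have [lP _] := (bounded_opP _).1 pP.1; have [lT _] := (bounded_opP _).1 bT.
apply: (tends_squeeze (dT x)) => n.
have E (V : H -> H) (c : nat -> R) : linear V -> (forall n, V (h n) = (c n)%:C *: h n) ->
    \sum_(0 <= i < n) ((c i)%:C * ip x (h i)) *: h i = V (\sum_(0 <= i < n) ip x (h i) *: h i).
  move=> lV hV; rewrite lin_sum //; apply: eq_bigr => i _.
  by rewrite linZ // hV scalerA mulrC.
rewrite (E _ _ lP (fun n => abs_op_eigen bT sT (th n))) (E _ _ lT th) -!linB //.
by rewrite nr_abs_op.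
Qed.

Lemma cvg_sum_seq (I : Type) (l : seq I) (f : nat -> I -> R) (g : I -> R) :
  (forall i, (fun n => f n i) @ \oo --> g i) ->
  (fun n => \sum_(i <- l) f n i) @ \oo --> \sum_(i <- l) g i.
Proof.
move=> h; elim: l => [|i l IH].
  by rewrite big_nil; under eq_fun do rewrite big_nil; apply: cvg_cst.
by rewrite big_cons; under eq_fun do rewrite big_cons; apply: cvgD.
Qed.
Arguments cvg_sum_seq [I] l [f g].

(** The diagonal entries of |T| at the eigenvectors of T are the |t_n|, so that the trace
norm bounds their sum. *)
Lemma trace_class_diagonal T r : bounded_op T -> symmetric T ->
  (trace_norm T <= r%:E)%E ->
  exists (h : nat -> H) (t : nat -> R),
  [/\ ortho_sys setT h, forall n, T (h n) = (t n)%:C *: h n,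
    forall n, `|t n.+1| <= `|t n|,
    forall n, h n = 0 -> t n = 0 /\ forall x, (forall i, (i < n)%N -> ip x (h i) = 0) -> x = 0 &
    diagonal_in T t h /\ forall n, \sum_(0 <= i < n) `|t i| <= r].
Proof.
move=> bT sT hT; have [lT _] := (bounded_opP _).1 bT.
have [h [t [h1 h2 h3 h4 h5]]] := spectral_theorem lT sT (hs_trace_norm bT hT).
exists h, t; split => //; split => // n.
apply: le_trans (sum_abs_op bT hT h1 (iota_uniq 0 (n - 0)) (fun _ _ => I)).
apply: ler_sum => i _; rewrite (abs_op_eigen bT sT (h2 i)) ipZl ipxx -rmorphM /=.
by have [/h4 [-> _]|->] := h1.2 i I; rewrite ?normr0 ?mul0r // expr1n mulr1.
Qed.

(** The eigenvectors of T form one of the systems h, and there the sum of the moduli of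
the diagonal entries is the trace norm. *)
Lemma trace_norm_le T M r : bounded_op T -> symmetric T -> hs_le T M ->
  (forall (h : nat -> H) n, ortho_sys setT h ->
    \sum_(0 <= i < n) `|Re (ip (T (h i)) (h i))| <= r) ->
  (trace_norm T <= r%:E)%E.
Proof.
move=> bT sT hT hr; have [lT _] := (bounded_opP _).1 bT.
have [h [t [oh th _ hz dT]]] := spectral_theorem lT sT hT.
apply/trace_norm_leP => s bs; have dP := abs_op_diagonal bT sT oh th dT.
apply: (cvgR_le (cvg_sum_seq s (fun e => diagonal_quad e dP))) => n.
rewrite exchange_big /=; apply: le_trans (hr h n oh); apply: ler_sum => i _.
rewrite -mulr_sumr th ipZl ipxx -rmorphM /= normrM [`|_ ^+ 2|]ger0_norm ?sqr_ge0 //.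
have [/[dup] /hz [-> _] _|->] := oh.2 i I; first by rewrite normr0 !mul0r.
rewrite expr1n ler_wpM2l //; under eq_bigr do rewrite sq_ipC.
by apply: le_trans (bessel basis_sys _ bs.1 bs.2) _; rewrite -(expr1n _ 2) ler_sqr
  ?nnegrE ?nr_ge0 // (nr_sys_le1 oh).
Qed.

(** The limit that defines the trace, in real coordinates and with sequences in place of
finite sets; unlike the value of trace, it is additive by its very form. *)
Definition has_trace T (z : R[i]) := forall eps : R, 0 < eps -> exists2 s0, bsub s0 &
  forall s, bsub s -> {subset s0 <= s} ->
  `|Re (\sum_(e <- s) ip (T e) e - z)| <= eps /\ `|Im (\sum_(e <- s) ip (T e) e - z)| <= eps.

Lemma has_traceE T z : has_trace T z -> trace T = z.
Proof.
move=> hz; rewrite /trace /unordered_sum; set FF := filter_from _ _.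
have FFp : ProperFilter FF.
  apply: filter_from_proper.
    apply: filter_from_filter; first by exists set0; split.
    move=> A B [fA Ab] [fB Bb]; exists (A `|` B).
      by split; [rewrite finite_setU|move=> e [/Ab|/Bb]].
    move=> C [fC ABC]; split; split => //; apply: subset_trans ABC; [left|right];
      done.
  by move=> A fA; exists A; split.
apply: (@cvg_lim (R[i]^o) _ _ _ _ _ (z : R[i]^o)); first exact: norm_hausdorff.
apply/cvgrPdist_le => eps e0.
have [e1 e2] : 0 < Re eps /\ eps = (Re eps)%:C.
  move: e0; rewrite ltcE => /andP [/eqP /= a b]; split => //.
  by apply: eqC => //=; rewrite a.
have e3 : 0 < Re eps / 2 by rewrite divr_gt0.
have [s0 b0 hs0] := hz _ e3.
exists [set` s0]; first by split; [exact: finite_seq|move=> e /= /b0.2].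
move=> A [[fA Ab] sA] /=; rewrite fsbig_finite //= distrC.
have bA : bsub (finmap.enum_fset (fset_set A)).
  by split=> [|e]; [exact: finmap.fset_uniq|rewrite in_fset_set // inE => /Ab].
have [|h1 h2] := hs0 _ bA; first by move=> e es; rewrite in_fset_set // inE; apply: sA.
set w := _ - z; rewrite e2 normC_sq lecR.
have -> : Re eps = Num.sqrt (Re eps ^+ 2) by rewrite sqrtr_sqr ger0_norm // ltW.
rewrite ler_wsqrtr // /sq -[X in X + _]real_normK ?num_real //.
rewrite -[X in _ + X]real_normK ?num_real //.
have := normr_ge0 (Re w); have := normr_ge0 (Im w); move: h1 h2; rewrite -/w; nra.
Qed.

Lemma has_trace_unique T z w : has_trace T z -> has_trace T w -> z = w.
Proof. by move=> /has_traceE <- /has_traceE. Qed.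

Lemma has_traceD T U z w (a b : R) : has_trace T z -> has_trace U w ->
  has_trace (fun x => a%:C *: T x + b%:C *: U x) (a%:C * z + b%:C * w).
Proof.
move=> hT hU eps e0; pose K := `|a| + `|b| + 1.
have K0 : 0 < K by rewrite ltr_wpDl // addr_ge0.
have e1 : 0 < eps / K by rewrite divr_gt0.
have [s0 b0 hs0] := hT _ e1; have [t0 c0 ht0] := hU _ e1.
exists (undup (s0 ++ t0)); first exact: bsubU.
move=> s bs ss.
have [|h1 h2] := hs0 s bs; first by move=> e es; apply: ss; rewrite mem_undup mem_cat es.
have [|h3 h4] := ht0 s bs; first by move=> e es; apply: ss; rewrite mem_undup mem_cat es orbT.
have -> : \sum_(e <- s) ip (a%:C *: T e + b%:C *: U e) e - (a%:C * z + b%:C * w) =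
   a%:C * (\sum_(e <- s) ip (T e) e - z) + b%:C * (\sum_(e <- s) ip (U e) e - w).
  under eq_bigr do rewrite ipDl !ipZl.
  by rewrite big_split /= -!mulr_sumr; ring.
have fin (u v : R) : `|u| <= eps / K -> `|v| <= eps / K -> `|a * u + b * v| <= eps.
  move=> hu hv; apply: le_trans (ler_normD _ _) _; rewrite !normrM.
  apply: (@le_trans _ _ (`|a| * (eps / K) + `|b| * (eps / K))).
    by apply: lerD; rewrite ler_wpM2l.
  rewrite -mulrDl mulrCA ler_piMr ?(ltW e0) // ler_pdivrMr // mul1r.
  by rewrite lerDl.
by rewrite ReD ImD !ReM !ImM /= !mul0r !subr0 !addr0; split; apply: fin.
Qed.

(** For X = \sum_n t_n <., h_n> h_n the sum of the <X A e, e> over a finite part s of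
the basis is \sum_n t_n <A p_n, h_n>, with p_n the projection of h_n to the span of s. *)
Lemma has_trace_diagonal X A t h z : bounded_op A -> ortho_sys setT h -> summ t ->
  diagonal_in X t h ->
  Re z = tsum (fun i => t i * Re (ip (A (h i)) (h i))) ->
  Im z = tsum (fun i => t i * Im (ip (A (h i)) (h i))) ->
  has_trace (X \o A) z.
Proof.
move=> bA oh st dX zr zi eps e0; have [lA [M [M0 hM]]] := (bounded_opP _).1 bA.
pose B := tsum (fun i => `|t i|).
have B0 : 0 <= B by apply: tsum_ge0 => //; apply: summ_abs.
pose d := eps / (2 * (M + 1) * (B + 1)).
have d0 : 0 < d by rewrite divr_gt0 // !mulr_gt0 // ltr_wpDl.
have e1 : 0 < eps / (2 * (M + 1)) by rewrite divr_gt0 // mulr_gt0 // ltr_wpDl.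
have [N hN] := summ_tail st e1.
have [s0 b0 hs0] : exists2 s0, bsub s0 & forall s i, bsub s -> {subset s0 <= s} -> (i < N)%N ->
    nr (h i - \sum_(e <- s) ip (h i) e *: e) <= d.
  elim: (N) => [|k [s1 b1 hs1]]; first by exists [::].
  have [s2 b2 hs2] := parseval (h k) d0.
  exists (undup (s1 ++ s2)); first exact: bsubU.
  move=> s i bs ss; rewrite ltnS leq_eqVlt => /orP [/eqP ->|ik].
    by apply: hs2 => // e es; apply: ss; rewrite mem_undup mem_cat es orbT.
  by apply: hs1 => // e es; apply: ss; rewrite mem_undup mem_cat es.
exists s0 => // s bs ss.
pose p i := \sum_(e <- s) ip (h i) e *: e.
have np i : nr (h i - p i) <= 1.
  rewrite -ler_sqr ?nnegrE ?nr_ge0 // (bessel_eq basis_sys _ bs.1 bs.2) expr1n.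
  rewrite lerBlDr -[leLHS]addr0 lerD //.
    by rewrite -(expr1n _ 2) ler_sqr ?nnegrE ?nr_ge0 // (nr_sys_le1 oh).
  by apply: sumr_ge0 => e _; apply: sq_ge0.
have n1 i : nr (h i) <= 1 by apply: (nr_sys_le1 oh).
(* Of the real and the imaginary part only their additivity and the Cauchy-Schwarz bound
matter for the estimate. *)
have main (f : R[i] -> R) : (forall z1 z2, f (z1 - z2) = f z1 - f z2) ->
    (forall x y, `|f (ip x y)| <= nr x * nr y) ->
    (fun n => \sum_(0 <= i < n) t i * f (ip (A (p i)) (h i))) @ \oo -->
      f (\sum_(e <- s) ip (X (A e)) e) ->
    f z = tsum (fun i => t i * f (ip (A (h i)) (h i))) ->
    `|f (\sum_(e <- s) ip (X (A e)) e - z)| <= eps.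
  move=> fB fb hc fz.
  have bd i : `|t i * f (ip (A (h i)) (h i))| <= `|t i| * M.
    rewrite normrM ler_wpM2l //; apply: le_trans (fb _ _) _.
    rewrite -[leRHS]mulr1 ler_pM ?nr_ge0 //; apply: le_trans (hM _) _.
    by rewrite -[leRHS]mulr1 ler_wpM2l.
  have sa : summ (fun i => t i * f (ip (A (h i)) (h i))).
    apply: (@summ_le _ (fun i => M * `|t i|)); first exact/summZ/summ_abs.
    by move=> i; rewrite [M * _]mulrC; apply: bd.
  have hc2 : (fun n => \sum_(0 <= i < n) t i * f (ip (A (p i) - A (h i)) (h i))) @ \oo -->
      f (\sum_(e <- s) ip (X (A e)) e - z).
    rewrite fB fz (_ : (fun n => _) = (fun n =>
      \sum_(0 <= i < n) t i * f (ip (A (p i)) (h i)) -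
      series (fun i => t i * f (ip (A (h i)) (h i))) n)).
      by apply: cvgB => //; apply: summ_cvg.
    apply/funext => n; rewrite seriesE -sumrB.
    by apply: eq_bigr => i _; rewrite ipBl fB mulrBr.
  apply: (cvgR_abs_le hc2) => n.
  apply: le_trans (ler_norm_sum _ _ _) _.
  have bd2 i : `|t i * f (ip (A (p i) - A (h i)) (h i))| <= `|t i| * (M * nr (h i - p i)).
    rewrite normrM ler_wpM2l //; apply: le_trans (fb _ _) _.
    rewrite -[leRHS]mulr1 ler_pM ?nr_ge0 //.
    by rewrite -(linB lA) [nr (h i - _)]nrB hM.
  apply: le_trans (ler_sum _ (fun i _ => bd2 i)) _.
  have part1 : \sum_(0 <= i < N) `|t i| * (M * nr (h i - p i)) <= eps / 2.
    apply: (@le_trans _ _ (\sum_(0 <= i < N) `|t i| * ((M + 1) * d))).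
      rewrite !big_nat; apply: ler_sum => i /andP [_ iN]; rewrite ler_wpM2l // ler_pM ?nr_ge0 //.
        by rewrite lerDl.
      exact: hs0.
    rewrite -mulr_suml; apply: (@le_trans _ _ ((B + 1) * ((M + 1) * d))).
      rewrite ler_wpM2r //; first by rewrite mulr_ge0 ?addr_ge0 ?(ltW d0).
      by apply: le_trans (sum_abs_le_tsum N st) _; rewrite lerDl.
    rewrite /d le_eqVlt; apply/orP; left; apply/eqP; field.
    by rewrite !gt_eqF // ltr_wpDl.
  have part2 m : \sum_(0 <= i < m) `|t (N + i)%N| * (M * nr (h (N + i)%N - p (N + i)%N)) <= eps / 2.
    apply: (@le_trans _ _ (\sum_(0 <= i < m) `|t (N + i)%N| * (M + 1))).
      apply: ler_sum => i _; rewrite ler_wpM2l // -[leRHS]mulr1 ler_pM ?nr_ge0 //.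
      by rewrite lerDl.
    rewrite -mulr_suml; have := le_trans (sum_abs_le_tsum m (summ_shift N st)) (hN N (leqnn _)).
    by rewrite ler_pdivlMr ?mulr_gt0 ?ltr_wpDl // => h'; lra.
  rewrite (splitr eps); have [nN|Nn] := leqP n N.
    rewrite -[leLHS]addr0 lerD ?divr_ge0 ?(ltW e0) //; apply: le_trans part1.
    rewrite [leRHS](big_cat_nat _ nN) //= lerDl; apply: sumr_ge0 => i _.
    by rewrite !mulr_ge0 ?nr_ge0.
  rewrite (big_cat_nat _ (ltnW Nn)) //=; apply: lerD => //.
  rewrite -(subnKC (ltnW Nn)) -(sum_shift (fun i => `|t i| * (M * nr (h i - p i)))).
  exact: part2.
have pE i : \sum_(e <- s) ip (A e) (h i) * ip (h i) e = ip (A (p i)) (h i).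
  rewrite /p (lin_sum _ _ _ lA) ip_suml; apply: eq_bigr => e _.
  by rewrite (linZ lA) ipZl mulrC.
split; apply: main.
- exact: ReB.
- exact: absRe_ip.
- rewrite Re_sum.
  have := cvg_sum_seq s (fun e => diagonal_Re (A e) e dX).
  under eq_fun do (rewrite exchange_big /=; under eq_bigr do rewrite -mulr_sumr -Re_sum pE).
  by [].
- by [].
- exact: ImB.
- exact: absIm_ip.
- rewrite Im_sum.
  have := cvg_sum_seq s (fun e => diagonal_Im (A e) e dX).
  under eq_fun do (rewrite exchange_big /=; under eq_bigr do rewrite -mulr_sumr -Im_sum pE).
  by [].
- by [].
Qed.

End trace_norm_and_trace.
Arguments diagonal_Re {R} {H} [T t h] x y.
Arguments diagonal_Im {R} {H} [T t h] x y.
Arguments diagonal_quad {R} {H} [T t h] x.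
Arguments cvg_sum_seq {R} [I] l [f g].

(** * Majorisation of real sequences *)

Section majorisation.
Context {R : realType}.
Implicit Types (c z p q d : nat -> R) (x mu tau : R).

Definition pospart x : R := if 0 <= x then x else 0.

Variant pospart_spec x : R -> Type :=
  | PospartPos of 0 <= x : pospart_spec x x
  | PospartNeg of x <= 0 : pospart_spec x 0.

Lemma pospartP x : pospart_spec x (pospart x).
Proof. by rewrite /pospart; case: (leP 0 x) => h; constructor => //; apply: ltW. Qed.

Lemma pospart_ge0 x : 0 <= pospart x. Proof. by case: pospartP. Qed.
Lemma pospart_le x : x <= pospart x. Proof. by case: pospartP. Qed.
Lemma pospart_id x : 0 <= x -> pospart x = x. Proof. by case: pospartP => // *; apply/le_anti/andP. Qed.
Lemma pospart_0 x : x <= 0 -> pospart x = 0.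
Proof. by case: pospartP => // h1 h2; apply/le_anti/andP. Qed.
Lemma pospart_pospart x mu : 0 <= mu -> pospart (pospart x - mu) = pospart (x - mu).
Proof. by move=> m0; do !case: pospartP; lra. Qed.

Lemma pospart_lip x t : `|pospart x - pospart t| <= `|x - t|.
Proof.
rewrite ler_norml; have := ler_norm (x - t); have := ler_norm (t - x).
by rewrite (distrC t); case: pospartP; case: pospartP; lra.
Qed.

(** The minimum of x and t, written so that case analyses concern positive parts only *)
Definition mn x t : R := x - pospart (x - t).
Lemma mn_lip x s t : `|mn x s - mn x t| <= `|s - t|.
Proof.
rewrite [leLHS](_ : _ = `|pospart (x - t) - pospart (x - s)|); last by congr (`| _ |); rewrite /mn; lra.
by apply: le_trans (pospart_lip _ _) _; rewrite le_eqVlt; apply/orP; left; apply/eqP; congr (`| _ |); lra.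
Qed.
Lemma pospart_mn_le x s (p : R) : 0 <= x -> 0 <= p -> pospart (mn x s - p) <= x.
Proof. by move=> x0 p0; rewrite /mn; case: pospartP; case: pospartP; lra. Qed.

(** P + (min(Q, tau) - P)^+ is the maximum of P and min(Q, tau). Its excess over a level
mu depends on whether tau or mu is larger. *)
Lemma pospart_level_ge P Q tau mu : 0 <= P -> 0 <= tau -> tau <= mu ->
  pospart (P + pospart (Q - pospart (Q - tau) - P) - mu) = pospart (P - mu).
Proof.
move=> P0 t0 tm; have [h|h] := pospartP (Q - tau).
  by have [h1|h1] := pospartP (Q - (Q - tau) - P); case: pospartP; case: pospartP; lra.
by have [h1|h1] := pospartP (Q - 0 - P); case: pospartP; case: pospartP; lra.
Qed.

Lemma pospart_level_lt P Q tau mu : 0 <= P -> mu < tau ->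
  pospart (P + pospart (Q - pospart (Q - tau) - P) - mu) <=
  P + pospart (Q - pospart (Q - tau) - P) - (Q - pospart (Q - mu)).
Proof.
move=> P0 tm; have [h|h] := pospartP (Q - tau).
  by have [h1|h1] := pospartP (Q - (Q - tau) - P); case: pospartP; case: pospartP; lra.
by have [h1|h1] := pospartP (Q - 0 - P); case: pospartP; case: pospartP; lra.
Qed.

Lemma pospart_le_abs x mu : 0 <= mu -> `|pospart (x - mu)| <= `|x|.
Proof.
move=> mu0; rewrite ger0_norm ?pospart_ge0 //; have := ler_norm x; have := normr_ge0 x.
by case: pospartP; lra.
Qed.

Lemma summ_pospart z mu : summ z -> 0 <= mu -> summ (fun i => pospart (z i - mu)).
Proof.
by move=> hz m0; apply: summ_le (summ_abs hz) _ => i; apply: pospart_le_abs.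
Qed.

Lemma summ_pospartN z mu : summ z -> 0 <= mu -> summ (fun i => pospart (- z i - mu)).
Proof. by move=> /summN; apply: summ_pospart. Qed.

Lemma summ_pospart0 z : summ z -> summ (fun i => pospart (z i)).
Proof. by move=> hz; apply: summ_eq (summ_pospart hz (lexx 0)) => i; rewrite subr0. Qed.

(** z is majorised by c. No ordering of the terms is involved: the partial sums of the
decreasing rearrangement are replaced by the sums of the excesses over all levels, the
negative terms being treated separately. *)
Definition maj z c := [/\ summ z, summ c,
  forall mu, 0 <= mu -> tsum (fun i => pospart (z i - mu)) <= tsum (fun i => pospart (c i - mu)),
  forall mu, 0 <= mu -> tsum (fun i => pospart (- z i - mu)) <= tsum (fun i => pospart (- c i - mu)) &
  tsum z = tsum c].

Lemma majN z c : maj z c -> maj (fun i => - z i) (fun i => - c i).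
Proof.
move=> [hz hc h1 h2 h3]; split; rewrite ?tsumN ?h3 //; try exact: summN.
by move=> mu /h1 h; under eq_fun do rewrite opprK; under [X in _ <= tsum X]eq_fun do rewrite opprK.
Qed.

Lemma maj_abs z c : maj z c -> tsum (fun i => `|z i|) <= tsum (fun i => `|c i|).
Proof.
move=> [hz hc h1 h2 _].
have E a : summ a -> tsum (fun i => `|a i|) =
    tsum (fun i => pospart (a i - 0)) + tsum (fun i => pospart (- a i - 0)).
  move=> ha; rewrite -(tsumD (summ_pospart ha (lexx 0)) (summ_pospartN ha (lexx 0))).
  apply: tsum_eq => i; rewrite !subr0.
  by case: (ler0P (a i)); case: pospartP; case: pospartP; lra.
by rewrite !E // lerD ?h1 ?h2.
Qed.

(** Domination by m and the Lipschitz condition make the sum continuous in tau. *)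
Lemma tsum_ivt (g : R -> nat -> R) (m : nat -> R) (T v : R) : summ m -> 0 <= T ->
  (forall tau b, 0 <= tau <= T -> 0 <= g tau b <= m b) ->
  (forall s t b, `|g s b - g t b| <= `|s - t|) ->
  Num.min (tsum (g 0)) (tsum (g T)) <= v <= Num.max (tsum (g 0)) (tsum (g T)) ->
  exists2 tau, 0 <= tau <= T & tsum (g tau) = v.
Proof.
move=> sm T0 g0m lip hv.
(* Composing with the projection to [0, T] makes the sum continuous on the whole line. *)
pose cl (t : R) := mn T (pospart t).
have cl0 t : 0 <= cl t <= T by rewrite /cl /mn; do !case: pospartP; lra.
have clip s t : `|cl s - cl t| <= `|s - t|.
  exact: le_trans (mn_lip _ _ _) (pospart_lip _ _).
have clid t : 0 <= t <= T -> cl t = t.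
  by move=> /andP [h1 h2]; rewrite /cl /mn pospart_id // pospart_id ?subr_ge0 // subKr.
have sg t : summ (g (cl t)).
  by apply: summ_le sm _ => b; have /andP [h1 h2] := g0m _ b (cl0 t); rewrite ger0_norm.
pose f t := tsum (g (cl t)).
have cf : continuous f.
  move=> s; apply/cvgrPdist_le => eps e0.
  have e2 : 0 < eps / 2 by rewrite divr_gt0.
  have [N hN] := summ_tail sm e2; have {}hN := hN N (leqnn _).
  have d0 : 0 < eps / 2 / N.+1%:R by rewrite divr_gt0.
  exists (eps / 2 / N.+1%:R) => // t /= /ltW st; rewrite /f -tsumB //.
  have sd := summB (sg s) (sg t); apply: le_trans (abs_tsum_le sd) _.
  rewrite (tsum_split N (summ_abs sd)) (splitr eps); apply: lerD.
    apply: (@le_trans _ _ (\sum_(0 <= i < N) (eps / 2 / N.+1%:R))).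
      by apply: ler_sum => i _; apply: le_trans (lip _ _ _) _; apply: le_trans (clip _ _) _.
    rewrite sumr_const_nat subn0 -(mulr_natr (_ / _)) -mulrA ler_piMr ?(ltW e2) //.
    by rewrite ler_pdivrMl ?mulr1 // ler_nat.
  apply: le_trans hN.
  apply: (tsum_le (summ_shift N (summ_abs sd)) (summ_abs (summ_shift N sm))) => i.
  have /andP [h1 h2] := g0m _ (N + i)%N (cl0 s).
  have /andP [h3 h4] := g0m _ (N + i)%N (cl0 t).
  by apply: le_trans _ (ler_norm _); rewrite ler_norml; lra.
have [|tau] := @IVT R f 0 T v T0 (continuous_subspaceT cf).
  by rewrite /f !clid // ?lexx ?T0.
by rewrite in_itv /= => htau <-; exists tau => //; rewrite /f clid.
Qed.

(** If the positive terms of z other than z_0 suffice to raise z_0 to c_0, they are truncated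
at some level tau. Otherwise they are removed altogether, and the missing mass is put on the
negative side, where the modulus of each term is raised to the minimum of tau and of the
modulus of the corresponding negative term of c, unless it is larger already. In both cases
tau is found by the intermediate value theorem. The excesses over levels above tau do not
increase, and those over lower levels are computed from the total mass. *)
Lemma maj_split z c : maj z c -> 0 < c 0 -> (forall i, c i <= c 0) ->
  (forall b, z b.+1 <= pospart (z 0)) ->
  exists d, [/\ forall b, 0 <= d b, summ d, tsum d = c 0 - z 0,
    forall b, d b <> 0 -> z b.+1 <> 0 \/ c b.+1 <> 0 &
    maj (fun b => z b.+1 - d b) (fun b => c b.+1)].
Proof.
move=> [hz hc h1 h2 h3] c0 cmax zmax.
set y := fun b => z b.+1; set c' := fun b => c b.+1.
have hy : summ y := summ_shift 1 hz.
have hc' : summ c' := summ_shift 1 hc.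
have h1' mu : 0 <= mu -> pospart (z 0 - mu) + tsum (fun b => pospart (y b - mu)) <=
    pospart (c 0 - mu) + tsum (fun b => pospart (c' b - mu)).
  by move=> m0; have := h1 mu m0; rewrite (tsum_recl (summ_pospart hz m0)) (tsum_recl (summ_pospart hc m0)).
have h2' mu : 0 <= mu -> tsum (fun b => pospart (- y b - mu)) <= tsum (fun b => pospart (- c' b - mu)).
  move=> m0; have := h2 mu m0; rewrite (tsum_recl (summ_pospartN hz m0)) (tsum_recl (summ_pospartN hc m0)).
  by rewrite (@pospart_0 (- c 0 - mu)); [have := pospart_ge0 (- z 0 - mu); lra|lra].
have h3' : z 0 + tsum y = c 0 + tsum c' by rewrite -!tsum_recl.
have zc : z 0 <= c 0.
  have := h1 (c 0) (ltW c0); rewrite [leRHS](tsum_eq (b := fun=> 0)) ?tsum0.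
    move=> h; have := ler_term_tsum 0 (summ_pospart hz (ltW c0)) (fun i => pospart_ge0 _).
    by have := pospart_le (z 0 - c 0); lra.
  by move=> i; rewrite pospart_0 // subr_le0.
have ppy : summ (fun b => pospart (y b)) := summ_pospart0 hy.
have [A|B] := leP (c 0 - z 0) (tsum (fun b => pospart (y b))).
  have z0 : 0 <= z 0.
    rewrite leNgt; apply/negP => z0.
    have : tsum (fun b => pospart (y b)) = 0.
      rewrite -[RHS](@tsum0 R); apply: tsum_eq => b; rewrite pospart_0 //.
      by have := zmax b; rewrite pospart_0 // ltW.
    lra.
  have [|||tau /andP [t0 tz] ht] := @tsum_ivt (fun tau b => pospart (y b - tau))
     (fun b => pospart (y b)) (z 0) (c 0 - z 0) ppy z0.
  - move=> tau b /andP [t0 _]; rewrite pospart_ge0 /=; by case: pospartP; case: pospartP; lra.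
  - move=> s t b; apply: le_trans (pospart_lip _ _) _; rewrite -[leRHS]normrN.
    by rewrite le_eqVlt; apply/orP; left; apply/eqP; congr (`| _ |); lra.
  - have -> : tsum (fun b => pospart (y b - z 0)) = 0.
      rewrite -[RHS](@tsum0 R); apply: tsum_eq => b; rewrite pospart_0 // subr_le0.
      by have := zmax b; rewrite pospart_id.
    rewrite [tsum _ in X in _ <= _ <= X](tsum_eq (b := fun b => pospart (y b))); last first.
      by move=> b; rewrite subr0.
    by rewrite ge_min subr_ge0 zc orbT le_max A.
  have sd := summ_pospart hy t0.
  exists (fun b => pospart (y b - tau)); split => //.
  - by move=> b; apply: pospart_ge0.
  - by move=> b h; left => yb; apply: h; rewrite /y yb pospart_0 // sub0r oppr_le0.
  split => //; first exact: summB.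
  - move=> mu m0; have [tm|mt] := leP tau mu.
      rewrite (tsum_eq (b := fun=> 0)) ?tsum0 ?tsum_ge0 //; first exact: summ_pospart.
        by move=> i; apply: pospart_ge0.
      by move=> b; rewrite -/(y b) pospart_0 //; case: pospartP; lra.
    rewrite (tsum_eq (b := fun b => pospart (y b - mu) - pospart (y b - tau))).
      rewrite tsumB ?ht //; last exact: summ_pospart.
      by have := h1' mu m0; rewrite !pospart_id; lra.
    by move=> b; rewrite -/(y b); case: pospartP; case: pospartP; case: pospartP; lra.
  - move=> mu m0; apply: le_trans (h2' mu m0); rewrite le_eqVlt; apply/orP; left; apply/eqP.
    apply: tsum_eq => b; rewrite -/(y b).
    by case: pospartP; case: pospartP; case: pospartP; lra.
  - rewrite tsumB // ht -/y; lra.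
pose p b := pospart (- y b); pose q b := pospart (- c' b).
have sp : summ p := summ_pospart0 (summN hy).
have sq' : summ q := summ_pospart0 (summN hc').
have yE b : y b = pospart (y b) - p b by rewrite /p; case: pospartP; case: pospartP; lra.
have cE b : c' b = pospart (c' b) - q b by rewrite /q; case: pospartP; case: pospartP; lra.
have spc : summ (fun b => pospart (c' b)) := summ_pospart0 hc'.
have Sy : tsum y = tsum (fun b => pospart (y b)) - tsum p by rewrite -tsumB //; apply: tsum_eq.
have Sc : tsum c' = tsum (fun b => pospart (c' b)) - tsum q by rewrite -tsumB //; apply: tsum_eq.
have Spc : 0 <= tsum (fun b => pospart (c' b)) by apply: tsum_ge0 => // b; apply: pospart_ge0.
have q0 b : 0 <= q b by apply: pospart_ge0.
have p0 b : 0 <= p b by apply: pospart_ge0.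
pose e := c 0 - z 0 - tsum (fun b => pospart (y b)).
have [|||tau /andP [t0 tq] ht] := @tsum_ivt (fun tau b => pospart (mn (q b) tau - p b))
   q (tsum q) e sq' (tsum_ge0 sq' q0).
- by move=> tau b /andP [t0 _]; rewrite pospart_ge0 /= pospart_mn_le.
- move=> s t b; apply: le_trans (pospart_lip _ _) _; apply: le_trans (mn_lip (q b) _ _).
  by rewrite le_eqVlt; apply/orP; left; apply/eqP; congr (`| _ |); lra.
- have -> : tsum (fun b => pospart (mn (q b) 0 - p b)) = 0.
    rewrite -[RHS](@tsum0 R); apply: tsum_eq => b; rewrite pospart_0 //.
    by rewrite /mn subr0 pospart_id // subrr sub0r oppr_le0.
  rewrite ge_min le_max /e; apply/andP; split; first by apply/orP; left; lra.
  apply/orP; right.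
  have : tsum (fun b => q b - p b) <= tsum (fun b => pospart (mn (q b) (tsum q) - p b)).
    apply: tsum_le; [exact: summB| |].
      apply: summ_le sq' _ => b; rewrite ger0_norm ?pospart_ge0 //.
      exact: pospart_mn_le.
    move=> b; have := ler_term_tsum b sq' q0.
    by rewrite /mn => h; rewrite (@pospart_0 (q b - tsum q)) ?subr0 ?pospart_le // subr_le0.
  by rewrite tsumB //; lra.
pose k b := pospart (mn (q b) tau - p b).
have sk : summ k.
  apply: summ_le sq' _ => b; rewrite /k ger0_norm ?pospart_ge0 //.
  exact: pospart_mn_le.
have Sk : tsum k = e by [].
have sd : summ (fun b => pospart (y b) + k b) by exact: summD.
have Sd : tsum (fun b => pospart (y b) + k b) = c 0 - z 0 by rewrite tsumD // Sk /e; lra.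
exists (fun b => pospart (y b) + k b); split => //.
- by move=> b; rewrite addr_ge0 ?pospart_ge0.
- move=> b; have [yb|/eqP yb] := eqVneq (z b.+1) 0; last by left.
  have [cb|/eqP cb] := eqVneq (c b.+1) 0; last by right.
  have pp00 : pospart 0 = 0 by exact: pospart_0.
  have qb : q b = 0 by rewrite /q /c' cb oppr0.
  have pb : p b = 0 by rewrite /p /y yb oppr0.
  have pt : pospart (0 - tau) = 0 by rewrite pospart_0 // sub0r oppr_le0.
  by case; rewrite /k qb pb /y yb pp00 add0r /mn pt !subr0.
have y'E b : y b - (pospart (y b) + k b) = - (p b + k b) by rewrite {1}yE; lra.
have pk0 b : 0 <= p b + k b by rewrite addr_ge0 // pospart_ge0.
split; [exact: (summB hy sd)|exact: hc'| | |].
- move=> mu m0; rewrite (tsum_eq (b := fun=> 0)) ?tsum0.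
    by apply: (tsum_ge0 (summ_pospart hc' m0)) => i; apply: pospart_ge0.
  by move=> b; rewrite -/(y b) y'E pospart_0 //; have := pk0 b; lra.
- move=> mu m0.
  have [tm|mt] := leP tau mu.
    apply: le_trans (h2' mu m0); rewrite le_eqVlt; apply/orP; left; apply/eqP.
    apply: tsum_eq => b; rewrite -/(y b) y'E opprK -[in RHS](pospart_pospart _ m0) -/(p b) /k /mn.
    exact: pospart_level_ge (p0 b) t0 tm.
  pose m b := mn (q b) mu.
  have sm : summ m.
    apply: summ_le sq' _ => b; have := q0 b; rewrite /m /mn ler_norml.
    by case: pospartP; lra.
  apply: (@le_trans _ _ (tsum (fun b => (p b + k b) - m b))).
    apply: tsum_le.
    - exact: summ_pospartN (summB hy sd) m0.
    - exact: summB (summD sp sk) sm.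
    move=> b; rewrite -/(y b) y'E opprK /k /m /mn.
    exact: pospart_level_lt (p0 b) mt.
  rewrite (tsumB (summD sp sk) sm) tsumD // Sk.
  apply: (@le_trans _ _ (tsum q - tsum m)); first by rewrite /e; lra.
  rewrite -tsumB //; apply: (tsum_le (summB sq' sm) (summ_pospartN hc' m0)) => b.
  rewrite -(pospart_pospart _ m0) -/(q b) /m /mn.
  by move: (pospartP (q b - mu)) => []; lra.
- by rewrite tsumB // Sd -/y; lra.
Qed.

(** As z and c have the same sum, the negative terms of c exceed those of z in total by the
sum K of its positive terms. Hence the excesses of -c and -z over small levels differ by
nearly K, which leaves room for merging two terms of z that are small in comparison. *)
Lemma maj_merge z c : maj z c -> (forall i, z i < 0) -> (exists i, 0 < c i) ->
  exists a, maj (fun i => if i == a then 0 else if i == a.+1 then z a + z a.+1 else z i) c.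
Proof.
move=> [hz hc h1 h2 h3] zneg [i0 ci0].
pose q i := pospart (- c i); have hq : summ q := summ_pospart0 (summN hc).
have hpc : summ (fun i => pospart (c i)) := summ_pospart0 hc.
pose K := tsum (fun i => pospart (c i)).
have K0 : 0 < K.
  apply: lt_le_trans (ler_term_tsum i0 hpc (fun i => pospart_ge0 _)).
  by rewrite pospart_id ?(ltW ci0).
have Sq : tsum q = K - tsum z.
  rewrite h3 -[tsum c](tsum_eq (a := fun i => pospart (c i) - q i)) ?tsumB //; first by rewrite /K; lra.
  by move=> i; rewrite /q; do !case: pospartP; lra.
have q0 i : 0 <= q i by apply: pospart_ge0.
have e0 : 0 < K / 4 by rewrite divr_gt0.
have [N hN] := summ_tail hq e0; have {}hN := hN N (leqnn _).
have low mu : 0 <= mu -> tsum q - K / 4 - N%:R * mu <= tsum (fun i => pospart (q i - mu)).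
  move=> m0; have sqm := summ_pospart hq m0.
  apply: (@le_trans _ _ (\sum_(0 <= i < N) (q i - mu))).
    rewrite sumrB sumr_const_nat subn0 -[_ *+ N]mulr_natl.
    have := tsum_split N hq; move: hN.
    by rewrite (tsum_eq (b := fun i => q (N + i)%N)) => [|i]; [lra|rewrite ger0_norm].
  apply: le_trans (sum_le_tsum N sqm (fun i => pospart_ge0 _)).
  by apply: ler_sum => i _; apply: pospart_le.
have e1 : 0 < K / (8 * N.+1%:R) by rewrite divr_gt0 // mulr_gt0.
have [a ha] := summ_small hz e1; exists a.
have za := ha a (leqnn _); have za1 := ha a.+1 (leqnSn _).
rewrite !ltr0_norm // in za za1; have na := zneg a; have na1 := zneg a.+1.
have aa : a != a.+1 by rewrite neq_ltn ltnSn.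
set z' := fun i : nat => _.
have ch (f : R -> R) : f 0 = 0 -> forall i : nat, f (z' i) = f (z i) + (if i == a then - f (z a) else 0) +
   (if i == a.+1 then f (z a + z a.+1) - f (z a.+1) else 0).
  move=> f0 i; rewrite /z'; have [->|ia] := eqVneq i a; first by rewrite (negbTE aa) f0; lra.
  by have [->|] := eqVneq i a.+1; lra.
have [hz' Sz'] := summ_change2 hz aa (ch id erefl).
have z'neg i : z' i <= 0.
  by rewrite /z'; case: ifP => // _; case: ifP => _; [lra|exact: ltW].
split => //; last by rewrite Sz' /=; lra.
  move=> mu m0; rewrite (tsum_eq (b := fun=> 0)) ?tsum0.
    by apply: tsum_ge0; [exact: summ_pospart|move=> i; apply: pospart_ge0].
  by move=> i; rewrite pospart_0 //; have := z'neg i; lra.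
move=> mu m0.
have f0 : pospart (- 0 - mu) = 0 by rewrite pospart_0 // oppr0 sub0r oppr_le0.
have [_ ->] := summ_change2 (summ_pospartN hz m0) aa (ch (fun x => pospart (- x - mu)) f0).
have [big|small] := leP (- (z a + z a.+1)) mu.
  apply: le_trans (h2 mu m0); rewrite (@pospart_0 (- (z a + _) - _)); last by lra.
  by have := pospart_ge0 (- z a - mu); have := pospart_ge0 (- z a.+1 - mu); lra.
have Sle : tsum (fun i => pospart (- z i - mu)) <= - tsum z.
  rewrite -tsumN //; apply: (tsum_le (summ_pospartN hz m0) (summN hz)) => i.
  by have := zneg i; case: pospartP; lra.
have inc : pospart (- (z a + z a.+1) - mu) - pospart (- z a.+1 - mu) <= - z a.
  by do !case: pospartP; lra.
have m1 : N%:R * mu <= K / 4.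
  have N1 : N%:R <= N.+1%:R :> R by rewrite ler_nat.
  apply: (@le_trans _ _ (N.+1%:R * (2 * (K / (8 * N.+1%:R))))).
    rewrite ler_pM //; move: za za1 small; move: (K / (8 * _)) => e'.
    by lra.
  by rewrite le_eqVlt; apply/orP; left; apply/eqP; field.
have za2 : - z a <= K / 8.
  apply: le_trans za _; rewrite ler_pM2l // lef_pV2 ?posrE ?mulr_gt0 // ler_pMr //.
  by rewrite ler1n.
have := low mu m0.
rewrite [X in _ <= X](tsum_eq (b := fun i => pospart (- c i - mu))); last first.
  by move=> i; exact: pospart_pospart.
by have := pospart_ge0 (- z a - mu); lra.
Qed.

End majorisation.

(** * Spreading eigenvalues by rotations *)

Section planar_rotation.
Context {R : realType}.

Lemma exists_angle (k r : R) : 0 <= k -> 0 <= r <= 1 ->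
  exists a s : R, [/\ 0 <= a, 0 <= s, a ^+ 2 + s ^+ 2 = 1 & s ^+ 2 + k * (s * a) = r].
Proof.
move=> k0 /andP [r0 r1].
pose f (s : R) := s ^+ 2 + k * (s * Num.sqrt (1 - s ^+ 2)).
have cf : continuous f.
  have cid : continuous (fun s : R => s) by move=> s; apply: cvg_id.
  have c2 : continuous (fun s : R => s ^+ 2) by move=> s; apply: exprn_continuous.
  have csq : continuous (fun s : R => Num.sqrt (1 - s ^+ 2)).
    move=> s; apply: (@continuous_comp _ _ _ (fun s : R => 1 - s ^+ 2) Num.sqrt).
      by apply: cvgB; [apply: cvg_cst|apply: c2].
    exact: sqrt_continuous.
  move=> s; apply: cvgD; first exact: c2.
  by apply: cvgMr; apply: cvgM; [apply: cid|apply: csq].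
have [|s] := @IVT R f 0 (Num.sqrt r) r (sqrtr_ge0 r) (continuous_subspaceT cf).
  rewrite /f expr0n mul0r mulr0 addr0 sqr_sqrtr // ge_min r0 /= le_max; apply/orP; right.
  by rewrite lerDl !mulr_ge0 ?sqrtr_ge0.
rewrite in_itv /= => /andP [s0 sr] fs.
have s1 : s ^+ 2 <= 1.
  apply: le_trans r1; rewrite -[leRHS](sqr_sqrtr r0) ler_sqr // nnegrE sqrtr_ge0 //.
exists (Num.sqrt (1 - s ^+ 2)), s; split; rewrite ?sqrtr_ge0 //.
by rewrite sqr_sqrtr ?subr_ge0 // subrK.
Qed.

(** The phase w for which the cross terms of a quadratic form become real and
nonnegative. *)
Lemma exists_phase (b c : R[i]) :
  exists (w : R[i]) (k : R), [/\ sq w = 1, 0 <= k & w * b + Num.conj w * c = k%:C].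
Proof.
pose z := b - Num.conj c.
have [w [w1 wz]] : exists w : R[i], sq w = 1 /\ Im (w * z) = 0.
  have [z0|z0] := eqVneq z 0.
    by exists 1; rewrite z0 mulr0 /sq /= expr1n expr0n addr0.
  have sz : 0 < sq z.
    by rewrite lt_neqAle sq_ge0 andbT eq_sym; apply/eqP => /sq_eq0; apply/eqP.
  exists ((Num.sqrt (sq z))^-1%:C * Num.conj z).
  rewrite sqM sqR sqJ exprVn sqr_sqrtr ?sq_ge0 // mulVf ?gt_eqF //; split=> //.
  by rewrite -mulrA [_ * z]mulrC mulzJ -rmorphM.
pose g := w * b + Num.conj w * c.
have Ig : Im g = 0.
  rewrite /g -[RHS]wz /z ImD !ImM ReB ImB ReJ ImJ ReJ ImJ; ring.
have gE : g = (Re g)%:C by exact: eqC.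
have [h|/ltW h] := leP 0 (Re g); first by exists w, (Re g); split.
exists (- w), (- Re g); split; rewrite ?sqN ?oppr_ge0 //.
by rewrite !rmorphN !mulNr -opprD -/g; congr (- _).
Qed.

Context {H : hilbertType R}.
Implicit Types (A : H -> H) (u v e : H).

(** In the plane of the orthonormal vectors v and e the eigenvalues x and y can be spread
to x + d and y - d without changing the value of the form on the operator; since the phase
makes the cross term help, the rotation is not larger than for a diagonal form. This is the
elliptical range theorem with control of the angle. *)
Lemma planar_spread A v e (x y d : R) : linear A -> nr v = 1 -> nr e = 1 -> ip v e = 0 ->
  0 <= d -> y <= x + d ->
  exists (a s : R) (w : R[i]), [/\ 0 <= a, a ^+ 2 + s ^+ 2 = 1, sq w = 1,
    s ^+ 2 * (x - y + 2 * d) <= d &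
    let v' := a%:C *: v + (s%:C * w) *: e in
    let e' := - s%:C *: v + (a%:C * w) *: e in
    (x + d)%:C * ip (A v') v' + (y - d)%:C * ip (A e') e' =
    x%:C * ip (A v) v + y%:C * ip (A e) e].
Proof.
move=> lA nv ne ve d0 yx.
pose al := ip (A v) v; pose et := ip (A e) e; pose T := x - y + 2 * d.
pose f w := w * ip (A e) v + Num.conj w * ip (A v) e.
have key a s w : a ^+ 2 + s ^+ 2 = 1 -> sq w = 1 ->
    T%:C * ((s ^+ 2)%:C * (et - al) + (s * a)%:C * f w) = d%:C * (et - al) ->
    let v' := a%:C *: v + (s%:C * w) *: e in
    let e' := - s%:C *: v + (a%:C * w) *: e in
    (x + d)%:C * ip (A v') v' + (y - d)%:C * ip (A e') e' = x%:C * al + y%:C * et.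
  move=> as1 w1 E v' e'.
  have ww : w * Num.conj w = 1 by rewrite mulzJ w1.
  have Ev : ip (A v') v' = (a ^+ 2)%:C * al + (s ^+ 2)%:C * et + (s * a)%:C * f w.
    rewrite /v' (linD lA) !(linZ lA) !ipDl !ipDr !ipZl !ipZr.
    rewrite !rmorphM /= !conjR -/al -/et ?rmorphXn /= /f.
    rewrite -[X in _ + X * _ + _]mulr1 -ww; ring.
  have Ee : ip (A e') e' = (s ^+ 2)%:C * al + (a ^+ 2)%:C * et - (s * a)%:C * f w.
    rewrite /e' (linD lA) !(linZ lA) !ipDl !ipDr !ipZl !ipZr.
    rewrite !rmorphM /= !rmorphN /= !conjR -/al -/et ?rmorphXn /= /f.
    rewrite -[X in _ + X * _ - _]mulr1 -ww; ring.
  have a2 : (a ^+ 2)%:C = 1 - (s ^+ 2)%:C :> R[i].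
    by apply: eqC; rewrite ?ReB ?ImB /= ?subrr //; move: as1; lra.
  rewrite Ev Ee a2; apply/eqP; rewrite -subr_eq0; apply/eqP.
  transitivity (T%:C * ((s ^+ 2)%:C * (et - al) + (s * a)%:C * f w) - d%:C * (et - al)).
    by rewrite /T !rmorphD !rmorphN !rmorphM /= !rmorphD /=; ring.
  by rewrite E subrr.
have trivial : T%:C * 0 = d%:C * (et - al) -> exists (a s : R) (w : R[i]),
  [/\ 0 <= a, a ^+ 2 + s ^+ 2 = 1, sq w = 1, s ^+ 2 * (x - y + 2 * d) <= d &
    let v' := a%:C *: v + (s%:C * w) *: e in
    let e' := - s%:C *: v + (a%:C * w) *: e in
    (x + d)%:C * ip (A v') v' + (y - d)%:C * ip (A e') e' =
    x%:C * ip (A v) v + y%:C * ip (A e) e].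
  move=> E; exists 1, 0, 1; split => //.
  - by rewrite expr1n expr0n addr0.
  - by rewrite /sq /= expr1n expr0n addr0.
  - by rewrite expr0n mul0r.
  - apply: key; first by rewrite expr1n expr0n addr0.
      by rewrite /sq /= expr1n expr0n addr0.
    by rewrite -E expr0n !mul0r add0r.
have [D0|D0] := eqVneq (et - al) 0; first by apply: trivial; rewrite D0 !mulr0.
have [T0|T0] := eqVneq T 0.
  have d00 : d = 0 by move: T0; rewrite /T; lra.
  by apply: trivial; rewrite mulr0 d00 mul0r.
have Tp : 0 < T by rewrite lt_neqAle eq_sym T0 /= /T; lra.
have [w [k [w1 k0 hw]]] := exists_phase (ip (A e) v / (et - al)) (ip (A v) e / (et - al)).
have fw : f w = k%:C * (et - al).
  by rewrite -hw /f mulrDl -!mulrA mulVf // !mulr1.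
have [|a [s [a0 s0 as1 hs]]] := @exists_angle k (d / T) k0.
  by rewrite divr_ge0 ?(ltW Tp) //= ler_pdivrMr // mul1r /T; lra.
exists a, s, w; split => //.
  by rewrite -/T -ler_pdivlMr // -hs lerDl; do 2?apply: mulr_ge0.
apply: key => //; rewrite fw.
transitivity ((T * (s ^+ 2 + k * (s * a)))%:C * (et - al)).
  by rewrite !(rmorphM, rmorphD) /=; ring.
by rewrite hs mulrC mulrCA divff // mulr1 mulrC.
Qed.

End planar_rotation.

Section pivot.
Context {R : realType} {H : hilbertType R}.
Implicit Types (A : H -> H) (u v h : H) (e w : nat -> H) (x : R) (y d : nat -> R).

(** Values of A are handled as pairs of real numbers, indexed by a boolean, so that only
real series occur. *)
Definition qf A (k : bool) u : R := if k then Re (ip (A u) u) else Im (ip (A u) u).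

Lemma tends_orth (a : nat -> H) u h N : tends a u ->
  (forall n, (N <= n)%N -> ip (a n) h = 0) -> ip u h = 0.
Proof.
move=> /(tends_shift N) ta h0; apply: (etrans (tends_ip_eq ta (tends_cst 0) (y := h) (z := 0) _)).
  by move=> n; rewrite h0 ?leq_addl // ip0r.
by rewrite ip0r.
Qed.

Lemma qf_le A (M : R) k u : (forall h, nr (A h) <= M * nr h) -> `|qf A k u| <= M * nr u ^+ 2.
Proof.
move=> hM; rewrite /qf expr2 mulrA.
by case: k; [apply: le_trans (absRe_ip _ _) _|apply: le_trans (absIm_ip _ _) _];
  rewrite ler_wpM2r ?nr_ge0.
Qed.

Lemma tends_qf A k (a : nat -> H) u : bounded_op A -> tends a u ->
  (fun n => qf A k (a n)) @ \oo --> qf A k u.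
Proof.
move=> bA ta; have [lA [M [M0 hM]]] := (bounded_opP _).1 bA.
apply: (@cvg_dist0 _ _ (fun n => M * nr (a n - u) * nr (a n) + M * nr u * nr (a n - u))).
  have l1 : (fun n => M * nr (a n - u) * nr (a n)) @ \oo --> M * 0 * nr u.
    by apply: cvgM; [apply: cvgMr|apply: tends_nr].
  have l2 : (fun n => M * nr u * nr (a n - u)) @ \oo --> M * nr u * 0.
    exact: cvgMr.
  have -> : 0 = M * 0 * nr u + M * nr u * 0 by rewrite !mulr0 mul0r addr0.
  exact: cvgD.
move=> n.
have E : ip (A (a n)) (a n) - ip (A u) u = ip (A (a n - u)) (a n) + ip (A u) (a n - u).
  by rewrite (linB lA) ipBl ipBr addrA subrK.
have B (f : R[i] -> R) : (forall z1 z2, f (z1 - z2) = f z1 - f z2) ->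
    (forall z1 z2, f (z1 + z2) = f z1 + f z2) ->
    (forall h1 h2, `|f (ip h1 h2)| <= nr h1 * nr h2) ->
    `|f (ip (A (a n)) (a n)) - f (ip (A u) u)| <=
    M * nr (a n - u) * nr (a n) + M * nr u * nr (a n - u).
  move=> fB fD fn; rewrite -fB E fD; apply: le_trans (ler_normD _ _) _; apply: lerD.
    by apply: le_trans (fn _ _) _; rewrite ler_wpM2r ?nr_ge0.
  by apply: le_trans (fn _ _) _; rewrite ler_wpM2r ?nr_ge0.
by rewrite /qf; case: k; apply: B; first [exact: ReB|exact: ReD|exact: ImB|exact: ImD|
  exact: absRe_ip|exact: absIm_ip].
Qed.

(** v is rotated successively in the planes that it spans with e_0, e_1, ..., so that its
weight x grows to x + \sum_n d_n while the weight of e_n drops from y_n to y_n - d_n. The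
square of the n-th angle is at most of the order of d_n, so that the rotated vectors form a
Cauchy sequence: the increments are orthogonal up to terms of second order. *)
Lemma infinite_spread A v e x y d : bounded_op A ->
  nr v = 1 -> ortho_sys setT e -> (forall b, ip v (e b) = 0) ->
  (forall b, 0 <= d b) -> summ d -> summ y -> (forall b, d b <> 0 -> nr (e b) = 1) ->
  (forall b, d b <> 0 -> y b <= x) -> 0 < x + tsum d ->
  exists u w, [/\ nr u = 1, ortho_sys setT w /\ (forall b, ip u (w b) = 0),
    forall b, nr (w b) = nr (e b),
    forall h, ip v h = 0 -> (forall b, ip (e b) h = 0) ->
      ip u h = 0 /\ forall b, ip (w b) h = 0 &
    forall k, (x + tsum d) * qf A k u + tsum (fun b => (y b - d b) * qf A k (w b)) =
      x * qf A k v + tsum (fun b => y b * qf A k (e b))].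
Proof.
move=> bA nv oe ve d0 sd sy de dy X0; have [lA [M [M0 hM]]] := (bounded_opP _).1 bA.
pose xs n := x + \sum_(0 <= i < n) d i.
have xsS n : xs n.+1 = xs n + d n by rewrite /xs big_nat_recr //= addrA.
have xx n : x <= xs n by rewrite lerDl sumr_ge0.
have step (bv : nat * H) : exists t : R * R * R[i],
    nr bv.2 = 1 -> ip bv.2 (e bv.1) = 0 ->
    [/\ 0 <= t.1.1, t.1.1 ^+ 2 + t.1.2 ^+ 2 = 1, sq t.2 = 1,
      t.1.2 ^+ 2 * (xs bv.1 - y bv.1 + 2 * d bv.1) <= d bv.1 /\
      (t.1.2 <> 0 -> nr (e bv.1) = 1) &
      let v' := t.1.1%:C *: bv.2 + (t.1.2%:C * t.2) *: e bv.1 in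
      let e' := - t.1.2%:C *: bv.2 + (t.1.1%:C * t.2) *: e bv.1 in
      (xs bv.1 + d bv.1)%:C * ip (A v') v' + (y bv.1 - d bv.1)%:C * ip (A e') e' =
      (xs bv.1)%:C * ip (A bv.2) bv.2 + (y bv.1)%:C * ip (A (e bv.1)) (e bv.1)].
  case: bv => b u /=; have [db|/eqP db] := eqVneq (d b) 0.
    exists (1, 0, 1) => _ _ /=; split => //.
    - by rewrite expr1n expr0n addr0.
    - by rewrite /sq /= expr1n expr0n addr0.
    - by rewrite expr0n mul0r.
    - rewrite db addr0 subr0 !rmorph0 !rmorph1 oppr0 !mulr1 !scale0r !scale1r.
      by rewrite addr0 add0r.
  have [/andP [nu ue]|nh] := pselect ((nr u == 1) && (ip u (e b) == 0)); last first.
    by exists (0, 0, 0) => h1 h2; case: nh; rewrite h1 h2 !eqxx.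
  have [|a [s [w [a0 as1 w1 sT E]]]] :=
    @planar_spread R H A u (e b) (xs b) (y b) (d b) lA (eqP nu) (de b db) (eqP ue) (d0 b).
    by apply: le_trans (dy b db) _; apply: le_trans (xx b) _; rewrite lerDl.
  exists (a, s, w) => _ _ /=; split => //; split => // _; exact: de.
have [F hF] := choice step.
pose vv := fix vv n : H := if n is m.+1 then
   let t := F (m, vv m) in t.1.1%:C *: vv m + (t.1.2%:C * t.2) *: e m else v.
pose a n := (F (n, vv n)).1.1; pose s n := (F (n, vv n)).1.2; pose p n := (F (n, vv n)).2.
pose w n := - (s n)%:C *: vv n + ((a n)%:C * p n) *: e n.
have vvS n : vv n.+1 = (a n)%:C *: vv n + ((s n)%:C * p n) *: e n by [].
have vve n m : (n <= m)%N -> ip (vv n) (e m) = 0.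
  elim: n => [|n IH] nm; first exact: ve.
  by rewrite vvS ipDl !ipZl IH ?(ltnW nm) // oe.1 ?ltn_eqF // !mulr0 addr0.
have [nvv hvv] : (forall n, nr (vv n) = 1) /\ forall n, [/\ 0 <= a n, a n ^+ 2 + s n ^+ 2 = 1, sq (p n) = 1,
      s n ^+ 2 * (xs n - y n + 2 * d n) <= d n /\ (s n <> 0 -> nr (e n) = 1) &
      (xs n + d n)%:C * ip (A (vv n.+1)) (vv n.+1) + (y n - d n)%:C * ip (A (w n)) (w n) =
      (xs n)%:C * ip (A (vv n)) (vv n) + (y n)%:C * ip (A (e n)) (e n)].
  have nvv n : nr (vv n) = 1.
    elim: n => [//|n IH].
    have [h1 h2 h3 [h4 h5] h6] := hF (n, vv n) IH (vve n n (leqnn n)).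
    apply/eqP; rewrite -(eqrXn2 (n := 2)) ?nr_ge0 // expr1n vvS nr2D_orth.
      rewrite !nr2Z sqM !sqR h3 mulr1 IH expr1n mulr1; apply/eqP.
      have [s0|/eqP /h5 /= ->] := eqVneq (s n) 0; last by rewrite expr1n mulr1; exact: h2.
      by move: h2; rewrite -/(a n) -/(s n) s0 expr0n mul0r.
    by rewrite ipZl ipZr vve // !mulr0.
  by split => // n; have := hF (n, vv n) (nvv n) (vve n n (leqnn n)).
have nw n : nr (w n) = nr (e n).
  have [a0 as1 p1 [_ se] _] := hvv n.
  apply/eqP; rewrite -(eqrXn2 (n := 2)) ?nr_ge0 // /w nr2D_orth.
    rewrite !nr2Z sqM sqN !sqR p1 mulr1 nvv expr1n mulr1; apply/eqP.
    have [s0|/eqP /se ->] := eqVneq (s n) 0; last by rewrite expr1n mulr1 addrC.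
    by move: as1; rewrite s0 expr0n addr0 => ->; rewrite add0r mul1r.
  by rewrite ipZl ipZr vve // !mulr0.
have wvv b m : (b < m)%N -> ip (vv m) (w b) = 0.
  elim: m => // m IH; rewrite ltnS leq_eqVlt => /orP [/eqP <-|bm].
    have [a0 as1 p1 [_ se] _] := hvv b.
    rewrite vvS /w ipDl !ipDr !ipZl !ipZr vve // (ip_eq0C (vve b b _)) // !ipxx nvv expr1n.
    rewrite !mulr0 addr0 add0r mulr1 !rmorphM rmorphN /= !conjR.
    rewrite (_ : _ + _ = (s b * a b)%:C * ((p b * Num.conj (p b)) * (nr (e b) ^+ 2)%:C - 1)).
      rewrite mulzJ p1 mul1r; have [->|/eqP /se ->] := eqVneq (s b) 0; first by rewrite !mul0r.
      by rewrite expr1n subrr mulr0.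
    by rewrite !rmorphM /=; ring.
  rewrite vvS ipDl !ipZl IH // mulr0 add0r /w ipDr !ipZr (ip_eq0C (vve b m _)) ?(ltnW bm) //.
  by rewrite oe.1 ?gtn_eqF // !mulr0 addr0 mulr0.
have wo : ortho_sys setT w.
  split=> [i j _ _|i _]; last first.
    by have [ei|ei] := oe.2 i I; [left; apply: nr_eq0|right]; rewrite nw ei ?nr0.
  suff h i' j' : (i' < j')%N -> ip (w j') (w i') = 0.
    by rewrite neq_ltn => /orP [/h /ip_eq0C|/h].
  move=> ij; rewrite {1}/w ipDl !ipZl wvv // mulr0 add0r /w ipDr !ipZr.
  rewrite (ip_eq0C (vve i' j' _)) ?(ltnW ij) // oe.1 ?gtn_eqF //.
  by rewrite !mulr0 addr0 mulr0.
have orth h : ip v h = 0 -> (forall b, ip (e b) h = 0) -> forall n, ip (vv n) h = 0.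
  by move=> vh eh; elim=> // n IH; rewrite vvS ipDl !ipZl IH eh !mulr0 addr0.
(* s_n^2 is of the order of d_n once x_n - y_n stays away from 0. *)
have ss : summ (fun n => s n ^+ 2).
  have e1 : 0 < (x + tsum d) / 4 by rewrite divr_gt0.
  have [N1 hN1] := summ_tail sd e1; have [N2 hN2] := summ_small sy e1.
  pose K := 2 / (x + tsum d).
  have big n : (N1 + N2 <= n)%N -> s n ^+ 2 <= K * d n.
    move=> Nn; have [_ _ _ [h _] _] := hvv n.
    have h1 := hN1 n (leq_trans (leq_addr _ _) Nn).
    have h2 := hN2 n (leq_trans (leq_addl _ _) Nn).
    have h3 : xs n >= (x + tsum d) - (x + tsum d) / 4.
      have := tsum_split n sd; rewrite /xs.
      have := abs_tsum_le (summ_shift n sd); move: h1; rewrite ler_norml; lra.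
    have h4 : (x + tsum d) / 2 <= xs n - y n + 2 * d n.
      by move: h2; rewrite ler_norml; have := d0 n; lra.
    rewrite /K mulrAC ler_pdivlMr //; have := sqr_ge0 (s n); nra.
  have s1 n : s n ^+ 2 <= 1.
    by have [_ h _ _ _] := hvv n; have := sqr_ge0 (a n); lra.
  exists ((N1 + N2)%:R + tsum (fun n => `|K * d n|)) => n.
  have sK := summZ K sd.
  apply: (@le_trans _ _ (\sum_(0 <= i < n) ((if (i < N1 + N2)%N then 1 else 0) + K * d i))).
    apply: ler_sum => i _; rewrite ger0_norm ?sqr_ge0 //; case: ltnP => h.
      by apply: le_trans (s1 i) _; rewrite lerDl !mulr_ge0 ?invr_ge0 ?(ltW X0).
    by rewrite add0r big.
  rewrite big_split /=; apply: lerD.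
    apply: (@le_trans _ _ (minn n (N1 + N2))%:R); last by rewrite ler_nat geq_minr.
    elim: (n) => [|m IH]; first by rewrite big_nil min0n.
    rewrite big_nat_recr //=; have [mN|Nm] := ltnP m (N1 + N2).
      by rewrite (minn_idPl mN) -natr1 lerD2r; move: IH; rewrite (minn_idPl (ltnW mN)).
    by rewrite addr0 (minn_idPr (leqW Nm)); move: IH; rewrite (minn_idPr Nm).
  apply: le_trans (sum_abs_le_tsum n sK); apply: ler_sum => i _; exact: ler_norm.
have dist n m : nr (vv (n + m)%N - vv n) ^+ 2 <= 2 * tsum (fun i => `|s (n + i)%N ^+ 2|).
  have h : 1 - \sum_(0 <= i < m) s (n + i)%N ^+ 2 <= Re (ip (vv (n + m)%N) (vv n)).
    elim: m => [|m IH]; first by rewrite big_nil subr0 addn0 ipxx nvv expr1n.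
    rewrite addnS vvS ipDl !ipZl (ip_eq0C (vve n _ _)) ?leq_addr // mulr0 addr0.
    rewrite ReM /= mul0r subr0 big_nat_recr //=.
    have [a0 as1 _ _ _] := hvv (n + m)%N.
    have := le_trans (ler_norm _) (absRe_ip (vv (n + m)%N) (vv n)); rewrite !nvv mulr1.
    move: IH; set r := Re _; set q := \sum_(0 <= i < m) _; have := sqr_ge0 (s (n + m)%N).
    move=> s2 hr r1; have a1 : a (n + m)%N <= 1 by nra.
    have a2 : 1 - a (n + m)%N <= s (n + m)%N ^+ 2 by nra.
    suff : r - (1 - a (n + m)%N) <= a (n + m)%N * r by lra.
    nra.
  rewrite nr2B !nvv expr1n.
  have := sum_abs_le_tsum m (summ_shift n ss); under eq_bigr do rewrite ger0_norm ?sqr_ge0 //.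
  by move: h; lra.
have [u hu] : exists u, tends vv u.
  apply: complete_nr => eps e0.
  have e1 : 0 < (eps / 2) ^+ 2 / 2 by rewrite divr_gt0 // exprn_gt0 // divr_gt0.
  have [N hN] := summ_tail ss e1; exists N.
  have near m : (N <= m)%N -> nr (vv m - vv N) <= eps / 2.
    move=> /subnKC <-; rewrite -ler_sqr ?nnegrE ?nr_ge0 ?divr_ge0 ?(ltW e0) //.
    by apply: le_trans (dist _ _) _; have := hN N (leqnn _); lra.
  move=> m n Nm Nn; rewrite (splitr eps) -(subrKA (vv N)); apply: le_trans (nrD _ _) _.
  by rewrite lerD ?near // nrB near.
exists u, w; split => //.
- apply: (@cvgR_unique _ (fun n => nr (vv n))); first exact: (tends_nr hu).
  by under eq_fun do rewrite nvv; apply: cvg_cst.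
- by split => // b; apply: (tends_orth (N := b.+1) hu) => n; apply: wvv.
- move=> h vh eh; have o := orth h vh eh; split.
    by apply: (tends_orth (N := 0) hu) => n _.
  by move=> b; rewrite /w ipDl !ipZl o eh !mulr0 addr0.
move=> k.
have fin n : xs n * qf A k (vv n) + \sum_(0 <= i < n) (y i - d i) * qf A k (w i) =
    x * qf A k v + \sum_(0 <= i < n) y i * qf A k (e i).
  elim: n => [|n IH]; first by rewrite /xs !big_nil !addr0.
  have rec (f : nat -> R) : \sum_(0 <= i < n.+1) f i = \sum_(0 <= i < n) f i + f n.
    by rewrite big_nat_recr.
  rewrite !rec [in RHS]addrA -IH xsS.
  have [_ _ _ _] := hvv n.
  have E (f : R[i] -> R) : (forall z1 z2, f (z1 + z2) = f z1 + f z2) ->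
    (forall (t : R) z, f (t%:C * z) = t * f z) ->
    forall (t1 t2 t3 t4 : R) z1 z2 z3 z4, t1%:C * z1 + t2%:C * z2 = t3%:C * z3 + t4%:C * z4 ->
    t1 * f z1 + t2 * f z2 = t3 * f z3 + t4 * f z4.
    by move=> fD fM t1 t2 t3 t4 z1 z2 z3 z4 /(congr1 f); rewrite !fD !fM.
  have ReZ (t : R) z : Re (t%:C * z) = t * Re z by rewrite ReM /= mul0r subr0.
  have ImZ (t : R) z : Im (t%:C * z) = t * Im z by rewrite ImM /= mul0r addr0.
  move: (xs n) => X; rewrite /qf; case: k {IH} => E1.
    by have := E _ (@ReD R) ReZ _ _ _ _ _ _ _ _ E1; lra.
  by have := E _ (@ImD R) ImZ _ _ _ _ _ _ _ _ E1; lra.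
have qle h : nr h <= 1 -> `|qf A k h| <= M.
  move=> h1; apply: le_trans (qf_le k _ hM) _; rewrite -[leRHS]mulr1 ler_wpM2l //.
  by rewrite -(expr1n _ 2) ler_sqr ?nnegrE ?nr_ge0.
have smul (z : nat -> R) (g : nat -> H) : summ z -> ortho_sys setT g ->
    summ (fun i => z i * qf A k (g i)).
  move=> sz og; apply: summ_le (summZ M (summ_abs sz)) _ => i.
  by rewrite normrM mulrC ler_wpM2r // qle // (nr_sys_le1 og).
apply: (cvgR_unique (f := fun n => xs n * qf A k (vv n) +
    \sum_(0 <= i < n) (y i - d i) * qf A k (w i))).
  apply: cvgD; last by apply: (summ_cvg (smul _ _ (summB sy sd) wo)).
  apply: cvgM; last by apply: tends_qf.
  by apply: cvgD; [apply: cvg_cst|apply: summ_cvg].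
under eq_fun do rewrite fin.
by apply: cvgD; [apply: cvg_cst|apply: summ_cvg; apply: smul].
Qed.

End pivot.

(** * Realising the values of majorised operators *)

Section realising_majorised_sums.
Context {R : realType} {H : hilbertType R}.
Variables (A : H -> H) (bA : bounded_op A).
Implicit Types (u v h : H) (e w : nat -> H) (c z d : nat -> R).

Lemma summ_qf k z e : summ z -> ortho_sys setT e -> summ (fun i => z i * qf A k (e i)).
Proof.
move=> sz oe; have [lA [M [M0 hM]]] := (bounded_opP _).1 bA.
apply: summ_le (summZ M (summ_abs sz)) _ => i.
rewrite normrM mulrC ler_wpM2r //; apply: le_trans (qf_le k _ hM) _.
rewrite -[leRHS]mulr1 ler_wpM2l //.
by rewrite -(expr1n _ 2) ler_sqr ?nnegrE ?nr_ge0 // (nr_sys_le1 oe).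
Qed.

Lemma tsum_qf_le (M : R) k z e : 0 <= M -> (forall h, nr (A h) <= M * nr h) ->
  summ z -> ortho_sys setT e ->
  `|tsum (fun i => z i * qf A k (e i))| <= M * tsum (fun i => `|z i|).
Proof.
move=> M0 hM sz oe; have sq := summ_qf k sz oe.
apply: le_trans (abs_tsum_le sq) _; rewrite -(tsumZ M (summ_abs sz)).
apply: (tsum_le (summ_abs sq) (summZ M (summ_abs sz))) => i.
rewrite normrM mulrC ler_wpM2r //; apply: le_trans (qf_le k _ hM) _.
rewrite -[leRHS]mulr1 ler_wpM2l //.
by rewrite -(expr1n _ 2) ler_sqr ?nnegrE ?nr_ge0 // (nr_sys_le1 oe).
Qed.

(** The operator \sum_i z_i <., e_i> e_i is majorised by c, and there is room for as many
orthonormal vectors as there are nonzero terms in c. *)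
Definition good e z c := [/\ ortho_sys setT e, forall i, e i = 0 -> e i.+1 = 0,
  forall i, z i <> 0 -> nr (e i) = 1, forall i, c i <> 0 -> nr (e i) = 1 & maj z c].

(** c0 <., u> u + \sum_b z'_b <., e'_b> e'_b has the same trace against A as
\sum_b z_b <., e_b> e_b, and its vectors lie in the closed span of the e_b. *)
Definition same_form e z u e' z' (c0 : R) := [/\ forall b, ip u (e' b) = 0,
  forall h, (forall b, ip (e b) h = 0) -> ip u h = 0 /\ forall b, ip (e' b) h = 0 &
  forall k, c0 * qf A k u + tsum (fun b => z' b * qf A k (e' b)) =
    tsum (fun b => z b * qf A k (e b))].

Lemma nr1_neq0 (e : nat -> H) i : ortho_sys setT e -> e i <> 0 <-> nr (e i) = 1.
Proof.
move=> oe; have [e0|e1] := oe.2 i I; split => // h; first by rewrite e0 nr0 in h;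
  move: h => /esym/eqP; rewrite oner_eq0.
by move=> e0; rewrite e0 nr0 in e1; move: e1 => /esym/eqP; rewrite oner_eq0.
Qed.

Lemma good_downward e z c i j : good e z c -> (i <= j)%N -> nr (e j) = 1 -> nr (e i) = 1.
Proof.
move=> [oe ez _ _ _] /subnKC <-; elim: (j - i)%N => [|n IH]; first by rewrite addn0.
rewrite addnS => /(nr1_neq0 _ oe) h; apply: IH; apply/(nr1_neq0 _ oe) => h0.
by apply: h; apply: ez.
Qed.

Lemma split_first e z c : good e z c -> 0 < c 0 -> (forall i, c i <= c 0) ->
  (forall b, nr (e b) = 1 -> z b <= z 0) ->
  exists u e' z', [/\ nr u = 1, good e' z' (fun i => c i.+1) & same_form e z u e' z' (c 0)].
Proof.
move=> [oe ez ze ce mzc] c0 cmax zmax; have [sz _ _ _ _] := mzc.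
have [b|d [d0 sd Sd dne mzc']] := maj_split mzc c0 cmax.
  have [->|/eqP /ze /zmax h] := eqVneq (z b.+1) 0; first exact: pospart_ge0.
  exact: le_trans h (pospart_le _).
have e0 : nr (e 0) = 1 by apply: ce => h; rewrite h ltxx in c0.
have oe' : ortho_sys setT (fun b => e b.+1).
  by split=> [i j _ _ ij|i _]; [apply: oe.1|apply: oe.2].
have de b : d b <> 0 -> nr (e b.+1) = 1 by move=> /dne [/ze|/ce].
have [b|b /de||u [w [nu [ow uw] nw orth val]]] := @infinite_spread R H A (e 0) (fun b => e b.+1) (z 0)
    (fun b => z b.+1) d bA e0 oe' _ d0 sd (summ_shift 1 sz) de.
- exact: oe.1.
- exact: zmax.
- by rewrite Sd addrC subrK.
exists u, w, (fun b => z b.+1 - d b); split => //.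
  split => //.
  - by move=> b wb; apply: nr_eq0; rewrite nw ez ?nr0 //; apply: nr_eq0; rewrite -nw wb nr0.
  - move=> b zd; rewrite nw; have [db|/eqP /de //] := eqVneq (d b) 0.
    by apply: ze => zb; apply: zd; rewrite zb db subr0.
  - by move=> b /ce; rewrite nw.
split=> [//|h eh|k]; first by apply: orth => // b; apply: eh.
by have := val k; rewrite Sd (addrC (z 0)) subrK => ->; rewrite -(tsum_recl (summ_qf k sz oe)).
Qed.

Definition swap0 (a i : nat) : nat := if i == 0%N then a else if i == a then 0%N else i.

Lemma swap0_inj a : injective (swap0 a).
Proof.
by move=> i j; rewrite /swap0; do !case: eqP => //; move=> *; subst.
Qed.

Lemma summ_swap0 a (f : nat -> R) : summ f -> summ (fun i => f (swap0 a i)) /\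
  tsum (fun i => f (swap0 a i)) = tsum f.
Proof.
move=> sf; have [->|a0] := eqVneq a 0%N.
  have e : (fun i => f (swap0 0 i)) = f.
    by apply/funext => i; rewrite /swap0; case: eqP => [->|].
  by rewrite e.
have a0' : 0%N != a by rewrite eq_sym.
have [i|s1 tsum1] := @summ_change2 _ f (fun i => f (swap0 a i)) 0%N a (f a - f 0) (f 0 - f a) sf a0'.
  rewrite /swap0; have [->|i0] := eqVneq i 0%N; first by rewrite (negbTE a0'); lra.
  by have [->|ia] := eqVneq i a; lra.
by split => //; rewrite tsum1; lra.
Qed.

Lemma maj_swap0 a z c : maj z c -> maj (fun i => z (swap0 a i)) c.
Proof.
move=> [sz sc h1 h2 h3]; have [sz' Sz'] := summ_swap0 a sz; split => //.
- by move=> mu m0; have [_ ->] := summ_swap0 a (summ_pospart sz m0); apply: h1.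
- by move=> mu m0; have [_ ->] := summ_swap0 a (summ_pospartN sz m0); apply: h2.
- by rewrite Sz'.
Qed.

Lemma split_at a e z c : good e z c -> 0 < c 0 -> (forall i, c i <= c 0) ->
  nr (e a) = 1 -> (forall b, nr (e b) = 1 -> z b <= z a) ->
  exists u e' z', [/\ nr u = 1, good e' z' (fun i => c i.+1) & same_form e z u e' z' (c 0)].
Proof.
move=> g c0 cmax ea za; have [oe ez ze ce mzc] := g; have [sz _ _ _ _] := mzc.
have e0 : nr (e 0) = 1 by apply: ce => h; rewrite h ltxx in c0.
have esw i : nr (e (swap0 a i)) = 1 <-> nr (e i) = 1.
  by rewrite /swap0; case: eqP => [->|_]; [|case: eqP => [->|]].
have oe' : ortho_sys setT (fun i => e (swap0 a i)).
  split=> [i j _ _ ij|i _]; last exact: oe.2.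
  by apply: oe.1 => //; apply: contra ij => /eqP /swap0_inj ->.
have sw0 : swap0 a 0 = a by rewrite /swap0.
have [||||u [e' [z' [nu g' [ue orth val]]]]] := @split_first (fun i => e (swap0 a i)) (fun i => z (swap0 a i)) c.
- split => //; last exact: maj_swap0.
  + move=> i ei; apply: contrapT => /(nr1_neq0 _ oe') /esw h.
    have [_ h2] := nr1_neq0 i oe'; apply: h2 => //; apply/esw.
    exact: good_downward g (leqnSn i) h.
  + by move=> i /ze.
  + by move=> i /ce /esw.
- by [].
- by [].
- by move=> b; rewrite sw0; apply: za.
exists u, e', z'; split => //; split => //.
  by move=> h eh; apply: orth => b; apply: eh.
by move=> k; rewrite val; have [_ ->] := summ_swap0 a (summ_qf k sz oe).
Qed.

Lemma exists_argmax (P : nat -> Prop) (f : nat -> R) n : (exists2 i, (i < n)%N & P i) ->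
  exists2 a, (a < n)%N & P a /\ forall b, (b < n)%N -> P b -> f b <= f a.
Proof.
elim: n => [[] //|n IH [i il Pi]].
have [[j jl Pj]|no] := pselect (exists2 i, (i < n)%N & P i); last first.
  have E b : (b < n.+1)%N -> P b -> b = n.
    rewrite ltnS leq_eqVlt => /orP [/eqP //|bn] Pb; case: no; by exists b.
  by exists i => //; split=> // b bn Pb; rewrite (E b bn Pb) (E i il Pi).
have [|a al [Pa ha]] := IH; first by exists j.
have [[Pn fan]|h] := pselect (P n /\ f a <= f n).
  exists n => //; split => // b; rewrite ltnS leq_eqVlt => /orP [/eqP -> //|bn] Pb.
  exact: le_trans (ha b bn Pb) fan.
exists a; first exact: leqW.
split => // b; rewrite ltnS leq_eqVlt => /orP [/eqP -> Pn|bn Pb]; last exact: ha.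
by rewrite leNgt; apply/negP => /ltW fan; apply: h.
Qed.

(** Since z tends to 0, it has a largest term, unless there are infinitely many terms and
all of them are negative. *)
Lemma exists_pivot e z c : good e z c -> nr (e 0) = 1 ->
  (exists2 a, nr (e a) = 1 & forall b, nr (e b) = 1 -> z b <= z a) \/
  (forall i, nr (e i) = 1 /\ z i < 0).
Proof.
move=> g e0; have [oe ez ze ce mzc] := g; have [sz _ _ _ _] := mzc.
have [[i zi]|no] := pselect (exists i, 0 < z i).
  have [N hN] := summ_small sz zi.
  have ei : nr (e i) = 1 by apply: ze => h; rewrite h ltxx in zi.
  have [|a _ [ea ha]] := @exists_argmax (fun i => nr (e i) = 1) z (maxn N i.+1).
    by exists i => //; rewrite leq_maxr.
  left; exists a => // b eb; have [bn|] := ltnP b (maxn N i.+1); first exact: ha.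
  rewrite geq_max => /andP [/hN h _]; apply: le_trans (ha i _ ei); last by rewrite leq_maxr.
  exact: le_trans (ler_norm _) h.
have zle i : z i <= 0 by rewrite leNgt; apply/negP => h; apply: no; exists i.
have [[a [ea za]]|no2] := pselect (exists a, nr (e a) = 1 /\ z a = 0).
  by left; exists a => // b _; rewrite za.
have [[j ej]|no3] := pselect (exists j, e j = 0).
  have lj b : nr (e b) = 1 -> (b < j)%N.
    move=> eb; rewrite ltnNge; apply/negP => jb.
    by have /(nr1_neq0 _ oe) := good_downward g jb eb; apply.
  have [|a _ [ea ha]] := @exists_argmax (fun i => nr (e i) = 1) z j.
    by exists 0%N => //; apply: lj.
  by left; exists a => // b eb; apply: ha => //; apply: lj.
right=> i; have ei : nr (e i) = 1 by apply/(nr1_neq0 _ oe) => h; apply: no3; exists i.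
split=> //; rewrite lt_neqAle zle andbT; apply/eqP => zi; apply: no2; by exists i.
Qed.

(** A planar rotation merges two terms into a zero and their sum; the zero is then the
largest term. *)
Lemma split_negative e z c : good e z c -> 0 < c 0 -> (forall i, c i <= c 0) ->
  (forall i, nr (e i) = 1 /\ z i < 0) ->
  exists u e' z', [/\ nr u = 1, good e' z' (fun i => c i.+1) & same_form e z u e' z' (c 0)].
Proof.
move=> g c0 cmax neg; have [oe ez ze ce mzc] := g; have [sz _ _ _ _] := mzc.
have [|a mzc'] := maj_merge mzc (fun i => (neg i).2); first by exists 0%N.
have [lA _] := (bounded_opP _).1 bA.
have aa : a != a.+1 by rewrite neq_ltn ltnSn.
have [||al [s [p [al0 als p1 _ E]]]] := @planar_spread R H A (e a) (e a.+1) (z a) (z a.+1) (- z a)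
  lA (neg a).1 (neg a.+1).1 (oe.1 a a.+1 I I aa).
- by rewrite oppr_ge0 ltW // (neg a).2.
- by rewrite subrr ltW // (neg a.+1).2.
set z1 := fun i : nat => _ in mzc'.
pose e1 i := if i == a then al%:C *: e a + (s%:C * p) *: e a.+1
  else if i == a.+1 then - s%:C *: e a + (al%:C * p) *: e a.+1 else e i.
have e1a : e1 a = al%:C *: e a + (s%:C * p) *: e a.+1 by rewrite /e1 eqxx.
have e1a1 : e1 a.+1 = - s%:C *: e a + (al%:C * p) *: e a.+1.
  by rewrite /e1 eq_sym (negbTE aa) eqxx.
have e1o i : i != a -> i != a.+1 -> e1 i = e i.
  by move=> i1 i2; rewrite /e1 (negbTE i1) (negbTE i2).
have ni i : ~ (i = a \/ i = a.+1) -> e1 i = e i.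
  by move=> h; apply: e1o; apply/eqP => hh; apply: h; [left|right].
have n1 (t1 t2 : R) : t1 ^+ 2 + t2 ^+ 2 = 1 ->
    nr (t1%:C *: e a + (t2%:C * p) *: e a.+1) = 1.
  move=> t12; apply/eqP; rewrite -(eqrXn2 (n := 2)) ?nr_ge0 // expr1n nr2D_orth.
    by rewrite !nr2Z sqM !sqR p1 (neg a).1 (neg a.+1).1 expr1n !mulr1 t12.
  by rewrite ipZl ipZr oe.1 // !mulr0.
have ne1 i : nr (e1 i) = 1.
  have [->|ia] := eqVneq i a; first by rewrite e1a n1.
  have [->|ia1] := eqVneq i a.+1; last by rewrite e1o // (neg i).1.
  by rewrite e1a1 -rmorphN n1 // sqrrN addrC.
have orth1 h : ip (e a) h = 0 -> ip (e a.+1) h = 0 -> forall b : nat,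
    (b = a \/ b = a.+1) -> ip (e1 b) h = 0.
  by move=> h1 h2 b [->|->]; rewrite ?e1a ?e1a1 ipDl !ipZl h1 h2 !mulr0 addr0.
have oe1 : ortho_sys setT e1.
  split=> [i j _ _|i _]; last by right.
  have aorth : ip (e1 a) (e1 a.+1) = 0.
    rewrite e1a e1a1 ipDl !ipDr !ipZl !ipZr (oe.1 a a.+1 I I aa) (ip_eq0C (oe.1 a a.+1 I I aa)).
    rewrite !ipxx (neg a).1 (neg a.+1).1 expr1n !mulr0 !addr0 add0r !mulr1 !rmorphM rmorphN /= !conjR.
    transitivity ((s * al)%:C * (p * Num.conj p - 1)); last by rewrite mulzJ p1 subrr mulr0.
    by rewrite !rmorphM /=; ring.
  have mix i' j' : (i' = a \/ i' = a.+1) -> ~ (j' = a \/ j' = a.+1) -> ip (e1 i') (e1 j') = 0.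
    move=> hi hj; have ja : a != j' by apply/eqP => h; apply: hj; left.
    have ja1 : a.+1 != j' by apply/eqP => h; apply: hj; right.
    by rewrite (e1o j') 1?eq_sym //; apply: orth1 => //; apply: oe.1.
  have [hi|hi] := pselect (i = a \/ i = a.+1); have [hj|hj] := pselect (j = a \/ j = a.+1).
  - by move: hi hj => [->|->] [->|->]; rewrite ?eqxx // => _; apply: ip_eq0C.
  - by move=> _; apply: mix.
  - by move=> _; apply: ip_eq0C; apply: mix.
  - by move=> ij; rewrite !ni //; apply: oe.1.
have g1 : good e1 z1 c.
  split => // i h; first by move: (ne1 i); rewrite h nr0 => /esym/eqP; rewrite oner_eq0.
have z1le i : z1 i <= 0.
  rewrite /z1; case: ifP => // _; case: ifP => _; last exact: ltW (neg i).2.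
  by have := (neg a).2; have := (neg a.+1).2; lra.
have [|u [e' [z' [nu g' [ue orth val]]]]] := split_at g1 c0 cmax (ne1 a).
  by move=> b _; rewrite {2}/z1 eqxx.
exists u, e', z'; split => //; split => //.
  move=> h eh; apply: orth => b.
  have [hb|hb] := pselect (b = a \/ b = a.+1); first exact: orth1.
  by rewrite ni.
move=> k; rewrite val.
have [i|_ ->] := @summ_change2 _ (fun b => z b * qf A k (e b)) (fun b => z1 b * qf A k (e1 b)) a a.+1
  (- (z a * qf A k (e a))) ((z a + z a.+1) * qf A k (e1 a.+1) - z a.+1 * qf A k (e a.+1))
  (summ_qf k sz oe) aa.
  rewrite /z1; have [->|ia] := eqVneq i a; first by rewrite (negbTE aa) mul0r; lra.
  by have [->|ia1] := eqVneq i a.+1; [lra|rewrite e1o // !addr0].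
suff : (z a + z a.+1) * qf A k (e1 a.+1) = z a * qf A k (e a) + z a.+1 * qf A k (e a.+1) by lra.
move: E; rewrite /= -e1a -e1a1 subrr mul0r add0r opprK /qf => E.
by case: k; [move: E => /(congr1 (@Re R))|move: E => /(congr1 (@Im R))];
  rewrite ?ReD ?ImD !(ReM, ImM) /= !mul0r ?subr0 ?addr0 addrC => <-; rewrite addrC.
Qed.

Lemma split_positive e z c : good e z c -> 0 < c 0 -> (forall i, c i <= c 0) ->
  exists u e' z', [/\ nr u = 1, good e' z' (fun i => c i.+1) & same_form e z u e' z' (c 0)].
Proof.
move=> g c0 cmax; have [_ _ _ ce _] := g.
have e0 : nr (e 0) = 1 by apply: ce => h; rewrite h ltxx in c0.
have [[a ea za]|neg] := exists_pivot g e0; first exact: split_at g c0 cmax ea za.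
exact: split_negative.
Qed.

Lemma goodN e z c : good e z c -> good e (fun i => - z i) (fun i => - c i).
Proof.
move=> [oe ez ze ce mzc]; split => //; last exact: majN.
  by move=> i h; apply: ze => zi; apply: h; rewrite zi oppr0.
by move=> i h; apply: ce => ci; apply: h; rewrite ci oppr0.
Qed.

(** The case c_0 < 0 is reduced to c_0 > 0 by a change of sign; if c_0 = 0, all the terms of
c, and with them those of z, vanish. *)
Lemma split_off e z c : good e z c -> (forall i, `|c i| <= `|c 0|) ->
  exists u e' z', [/\ nr u = 1 \/ u = 0 /\ c 0 = 0, good e' z' (fun i => c i.+1) &
    same_form e z u e' z' (c 0)].
Proof.
move=> g cmax; have [oe ez ze ce mzc] := g; have [sz sc _ _ _] := mzc.
have [c0|c0|c0] := ltgtP (c 0) 0.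
- have [||u [e' [z' [nu g' [ue orth val]]]]] := split_positive (goodN g).
  + by rewrite oppr_gt0.
  + move=> i; apply: le_trans (ler_norm _) _; rewrite normrN; apply: le_trans (cmax i) _.
    by rewrite ltr0_norm.
  exists u, e', (fun i => - z' i); split; first by left.
    have := goodN g'; congr good; apply/funext => i; exact: opprK.
  have [oe' _ _ _ [sz' _ _ _ _]] := g'.
  split => // k; have := val k.
  have N (t : nat -> R) (f : nat -> H) : summ t -> ortho_sys setT f ->
      tsum (fun b => - t b * qf A k (f b)) = - tsum (fun b => t b * qf A k (f b)).
    move=> st' of'; rewrite -(tsumN (summ_qf k st' of')); apply: tsum_eq => b; exact: mulNr.
  by rewrite !N //; lra.
- have [|u [e' [z' [nu g' sf]]]] := split_positive g c0.
    move=> i; apply: le_trans (ler_norm _) _; apply: le_trans (cmax i) _.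
    by rewrite gtr0_norm.
  by exists u, e', z'; split => //; left.
have cz i : c i = 0.
  by apply/eqP; rewrite -normr_le0; apply: le_trans (cmax i) _; rewrite c0 normr0.
have zz i : z i = 0.
  apply/eqP; rewrite -normr_le0.
  apply: le_trans (ler_term_tsum i (summ_abs sz) (fun _ => normr_ge0 _)) _.
  apply: le_trans (maj_abs mzc) _; rewrite (tsum_eq (b := fun=> 0)) ?tsum0 // => j.
  by rewrite cz normr0.
have -> : c = fun=> 0 by apply/funext.
have -> : z = fun=> 0 by apply/funext.
exists 0, (fun=> 0), (fun=> 0); split; first by right.
  split => //; first by split=> [i j _ _ _|i _]; [rewrite ip0l|left].
  by split => //; [exact: summ0|exact: summ0].
split=> [b|h _|k]; rewrite ?ip0l //.
rewrite mul0r add0r; apply: tsum_eq => b; by rewrite !mul0r.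
Qed.

(** Splitting off the terms of c one after the other, in the order of decreasing modulus,
leaves after n steps a remainder that is majorised by the rest of c, hence is small in
norm. Therefore the orthonormal vectors found in this way carry the whole value. *)
Theorem realise_majorised e z c : good e z c -> (forall i, `|c i.+1| <= `|c i|) ->
  exists u : nat -> H, [/\ ortho_sys setT u, forall i, c i <> 0 -> nr (u i) = 1 &
    forall k, tsum (fun i => c i * qf A k (u i)) = tsum (fun i => z i * qf A k (e i))].
Proof.
move=> g cdecr.
have cd i j : `|c (i + j)%N| <= `|c i|.
  by elim: j => [|j IH]; rewrite ?addn0 // addnS (le_trans (cdecr _)).
pose cs n i := c (n + i)%N.
have csS n : (fun i => cs n i.+1) = cs n.+1 by apply/funext => i; rewrite /cs addnS.
pose X := (H * ((nat -> H) * (nat -> R)))%type.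
pose prev n (p : nat -> X) := if n is m.+1 then (p m).2 else (e, z).
pose G n (p : nat -> X) := [/\ nr (p n).1 = 1 \/ (p n).1 = 0 /\ c n = 0,
  good (p n).2.1 (p n).2.2 (cs n.+1) &
  same_form (prev n p).1 (prev n p).2 (p n).1 (p n).2.1 (p n).2.2 (c n)].
have gprev n p : (forall i, (i < n)%N -> G i p) -> good (prev n p).1 (prev n p).2 (cs n).
  by case: n => [|n] h //=; have [] := h n (ltnSn n).
have [p hp] : exists p, forall n, G n p.
  apply: (strong_choice (0, (e, z))) => [n p q pq|n p hp].
    rewrite /G -pq //; have -> // : prev n q = prev n p.
    by case: n pq => [|n] pq //=; rewrite pq.
  have [|u [e' [z' [h1 h2 h3]]]] := split_off (gprev n p hp).
    by move=> i; rewrite /cs addn0 cd.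
  exists (u, (e', z')); rewrite /G eqxx /= -csS; split => //.
    by rewrite /cs addn0 in h1.
  rewrite /cs addn0 in h3; suff -> : prev n (fun i => if i == n then (u, (e', z')) else p i) = prev n p by [].
  by case: n {hp h1 h2 h3} => [|n] //=; rewrite ltn_eqF.
pose u n := (p n).1; exists u.
have gn n : good (prev n p).1 (prev n p).2 (cs n) by apply: gprev.
have ortho m n b : (m < n)%N -> ip (u n) (u m) = 0 /\ ip ((p n).2.1 b) (u m) = 0.
  elim: n b => // n IH b mn; have [_ _ [_ orth _]] := hp n.+1.
  have [|h1 h2] := orth (u m); last by split.
  move=> b'; move: mn; rewrite ltnS leq_eqVlt => /orP [/eqP ->|/(IH b') []//].
  by have [_ _ [h _ _]] := hp n; apply: ip_eq0C; apply: h.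
split.
- split=> [i j _ _|i _]; last by have [[h|[h _]] _ _] := hp i; [right|left].
  rewrite neq_ltn => /orP [ij|ji]; first by apply: ip_eq0C; apply: (ortho _ _ 0%N ij).1.
  exact: (ortho _ _ 0%N ji).1.
- by move=> i ci; have [[h|[_ h]] _ _] := hp i.
move=> k; have [_ _ _ _ [_ sc _ _ _]] := g.
pose r n := tsum (fun i => (prev n p).2 i * qf A k ((prev n p).1 i)).
have fin n : \sum_(0 <= i < n) c i * qf A k (u i) + r n = r 0.
  elim: n => [|n IH]; first by rewrite big_nil add0r.
  rewrite big_nat_recr //= -IH -addrA; congr (_ + _).
  by have [_ _ [_ _ val]] := hp n; apply: val.
apply: tsum_unique; rewrite -/(r 0).
have [lA [M [M0 hM]]] := (bounded_opP _).1 bA.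
apply: (@cvg_dist0 _ _ (fun n => M * tsum (fun i => `|cs n i|))).
  rewrite -[X in _ --> X](mulr0 M); apply: cvgMr; apply/cvg0P => [n|eps e0].
    by apply: (tsum_ge0 (summ_abs (summ_shift n sc))) => i; apply: normr_ge0.
  exact: summ_tail.
move=> n; rewrite seriesE -(fin n) opprD addrA subrr sub0r normrN.
have [oe _ _ _ mz] := gn n; have [sz _ _ _ _] := mz.
apply: le_trans (tsum_qf_le k M0 hM sz oe) _; rewrite ler_wpM2l //; exact: maj_abs mz.
Qed.

End realising_majorised_sums.

(** * Unitary operators *)

Section unitaries.
Context {R : realType} {H : hilbertType R}.
Implicit Types (x y z h : H) (U V : H -> H).

Lemma unitaryI U V : bounded_op U -> (forall x y, ip (U x) y = ip x (V y)) ->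
  (forall x, V (U x) = x) -> (forall x, U (V x) = x) -> unitary U.
Proof.
move=> bU adj VU UV; have e := adjoint_unique bU adj.
by split; rewrite ?e //; apply/funext.
Qed.

Lemma unitaryE U : unitary U -> [/\ forall x y, ip (U x) y = ip x (adjoint U y),
  forall x, adjoint U (U x) = x & forall x, U (adjoint U x) = x].
Proof.
move=> [bU h1 h2]; have [_ adj] := adjointP bU; split => // x.
  exact: (congr1 (fun f => f x) h1).
exact: (congr1 (fun f => f x) h2).
Qed.

Lemma unitary_ip U x y : unitary U -> ip (U x) (U y) = ip x y.
Proof. by move=> /unitaryE [adj h _]; rewrite adj h. Qed.

Lemma unitary_comp U V : unitary U -> unitary V -> unitary (U \o V).
Proof.
move=> uU uV; have [a1 b1 c1] := unitaryE uU; have [a2 b2 c2] := unitaryE uV.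
have [bU _ _] := uU; have [bV _ _] := uV.
apply: (@unitaryI _ (adjoint V \o adjoint U)) => /=; first exact: bounded_op_comp.
- by move=> x y; rewrite a1 a2.
- by move=> x; rewrite b1 b2.
- by move=> x; rewrite c2 c1.
Qed.

Lemma unitary_id : unitary (id : H -> H).
Proof.
apply: (@unitaryI _ id) => //; apply/bounded_opP; split => //.
by exists 1; split => // x; rewrite mul1r.
Qed.

(** For a unit vector w this is multiplication by p on the line of w and the identity on its
orthogonal complement. *)
Definition phase_on w (p : R[i]) x := x + ((p - 1) * ip x w) *: w.

Lemma phase_on_unitary w p : nr w = 1 -> sq p = 1 -> unitary (phase_on w p).
Proof.
move=> nw p1; have ww : ip w w = 1 by rewrite ipxx nw expr1n.
have inv q x : sq q = 1 -> phase_on w (Num.conj q) (phase_on w q x) = x.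
  move=> q1; rewrite /phase_on ipDl ipZl ww mulr1 -addrA -scalerDl.
  have -> : (q - 1) * ip x w + (Num.conj q - 1) * (ip x w + (q - 1) * ip x w) =
      (q * Num.conj q - 1) * ip x w by ring.
  by rewrite mulzJ q1 subrr mul0r scale0r addr0.
apply: (@unitaryI _ (phase_on w (Num.conj p))); last first.
- by move=> x; rewrite -{1}(conjCK p) inv // sqJ.
- by move=> x; apply: inv.
- move=> x y; rewrite /phase_on ipDl ipDr ipZl ipZr rmorphM rmorphB rmorph1 /= conjCK -ipC.
  by congr (_ + _); ring.
apply/bounded_opP; split.
  move=> a x y; rewrite /phase_on ipDl ipZl scalerDr addrACA; congr (_ + _).
  by rewrite scalerA -scalerDl; congr (_ *: _); ring.
exists (1 + Num.sqrt (sq (p - 1))); split=> [|x]; first by rewrite addr_ge0 ?sqrtr_ge0.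
apply: le_trans (nrD _ _) _; rewrite [leRHS]mulrDl mul1r lerD //.
rewrite nrZ nw mulr1 sqM sqrtrM ?sq_ge0 // ler_wpM2l ?sqrtr_ge0 //.
rewrite -[leRHS]ger0_norm ?nr_ge0 // -sqrtr_sqr ler_wsqrtr //.
by apply: le_trans (cauchy_schwarz _ _) _; rewrite nw expr1n mulr1.
Qed.

Lemma phase_on_fix w p x : ip x w = 0 -> phase_on w p x = x.
Proof. by move=> h; rewrite /phase_on h mulr0 scale0r addr0. Qed.

(** A reflection carries x to a multiple of y, and a phase on the line of y corrects it. *)
Lemma exists_rotation x y : nr x = 1 -> nr y = 1 ->
  exists U, [/\ unitary U, U x = y & forall h, ip h x = 0 -> ip h y = 0 -> U h = h].
Proof.
move=> nx ny; have [w [k [w1 k0 hk]]] := exists_phase 0 (ip x y).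
rewrite mulr0 add0r in hk.
pose y' := w *: y; have xy' : ip x y' = k%:C by rewrite ipZr.
have ny' : nr y' = 1 by rewrite /y' nrZ w1 ny mulr1 sqrtr1.
have y'y : phase_on y (Num.conj w) y' = y.
  rewrite /phase_on /y' ipZl ipxx ny expr1n mulr1 -scalerDl.
  have -> : w + (Num.conj w - 1) * w = w * Num.conj w by ring.
  by rewrite mulzJ w1 scale1r.
have [U [uU Ux Uh]] : exists U, [/\ unitary U, U x = y' &
    forall h, ip h x = 0 -> ip h y = 0 -> U h = h].
  have [e|xy] := eqVneq (x - y') 0.
    exists id; split => //; first exact: unitary_id.
    by apply/eqP; rewrite -subr_eq0 e.
  have n0 : nr (x - y') != 0 by apply: contra xy => /eqP /nr_eq0 ->.
  pose v := (nr (x - y'))^-1%:C *: (x - y').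
  have nv : nr v = 1 by rewrite nrZR ger0_norm ?invr_ge0 ?nr_ge0 // mulVf.
  exists (phase_on v (-1)); split.
  - by apply: phase_on_unitary => //; rewrite sqN /sq /= expr1n expr0n addr0.
  - have n2 : nr (x - y') ^+ 2 = 2 * (1 - k) by rewrite nr2B nx ny' xy' expr1n /=; ring.
    rewrite /phase_on /v ipZr ipBr xy' ipxx nx expr1n conjR scalerA.
    rewrite (_ : _ * _ = -1); first by rewrite scaleN1r opprB addrC subrK.
    have -> : (-1 - 1 : R[i]) = (-2)%:C by rewrite rmorphN /= rmorphD /=; ring.
    rewrite -rmorphB -!rmorphM /=; transitivity ((-1)%:C : R[i]); last by rewrite rmorphN1.
    apply: (congr1 (real_complex R)).
    apply: (mulIf (expf_neq0 2 n0)); rewrite mulN1r {2}n2.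
    transitivity (-2 * (1 - k) * ((nr (x - y'))^-1 * nr (x - y')) ^+ 2); first by ring.
    by rewrite mulVf // expr1n; ring.
  - move=> h hx hy; apply: phase_on_fix.
    by rewrite ipZr ipBr hx ipZr hy mulr0 subrr mulr0.
exists (phase_on y (Num.conj w) \o U); split=> [||h hx hy] /=.
- by apply: unitary_comp => //; apply: phase_on_unitary; rewrite ?sqJ.
- by rewrite Ux.
- by rewrite Uh // phase_on_fix.
Qed.

(** The vectors are carried over one at a time: the rotation that takes U f_N to u_N fixes
the previous u_i, which are orthogonal to both. *)
Lemma exists_unitary (f u : nat -> H) N : ortho_sys setT f -> ortho_sys setT u ->
  exists2 U, unitary U & forall i, (i < N)%N -> nr (f i) = 1 -> nr (u i) = 1 -> U (f i) = u i.
Proof.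
move=> of_ ou; elim: N => [|N [U uU hU]]; first by exists id; [exact: unitary_id|].
have [[fN uN]|no] := pselect (nr (f N) = 1 /\ nr (u N) = 1); last first.
  exists U => // i; rewrite ltnS leq_eqVlt => /orP [/eqP -> fN uN|iN]; last exact: hU.
  by case: no.
have nx : nr (U (f N)) = 1.
  apply/eqP; rewrite -(eqrXn2 (n := 2)) ?nr_ge0 // expr1n; apply/eqP/(@complexI R).
  by rewrite -ipxx unitary_ip // ipxx fN expr1n.
have [V [uV Vx Vh]] := exists_rotation nx uN.
exists (V \o U); first exact: unitary_comp.
move=> i; rewrite ltnS leq_eqVlt => /orP [/eqP -> //|iN] fi ui /=.
rewrite hU // Vh //; last by apply: ou.1 => //; rewrite ltn_eqF.
by rewrite -(hU i) // unitary_ip //; apply: of_.1 => //; rewrite ltn_eqF.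
Qed.

End unitaries.

(** * Diagonal operators *)

Section diagonal_operators.
Context {R : realType} {H : hilbertType R}.
Implicit Types (x y h : H) (T X Y : H -> H) (u v g : nat -> H) (c : nat -> R).

Lemma nr2_diagonal_sum c u x n : ortho_sys setT u ->
  nr (\sum_(0 <= i < n) ((c i)%:C * ip x (u i)) *: u i) ^+ 2 <=
  \sum_(0 <= i < n) c i ^+ 2 * sq (ip x (u i)).
Proof.
move=> ou; rewrite (nr2_comb ou) ?iota_uniq //; apply: ler_sum => i _.
rewrite sqM sqR; have [->|->] := ou.2 i I; last by rewrite expr1n mulr1.
by rewrite nr0 expr0n mulr0 mulr_ge0 ?sqr_ge0 ?sq_ge0.
Qed.

Lemma bessel_nat u x n : ortho_sys setT u -> \sum_(0 <= i < n) sq (ip x (u i)) <= nr x ^+ 2.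
Proof. by move=> ou; apply: (bessel ou); rewrite ?iota_uniq. Qed.

Lemma bessel_nat1 u g n i : ortho_sys setT u -> ortho_sys setT g ->
  \sum_(0 <= j < n) sq (ip (g j) (u i)) <= 1.
Proof.
move=> ou og; under eq_bigr do rewrite sq_ipC.
apply: le_trans (bessel_nat _ _ og) _.
by rewrite -(expr1n _ 2) ler_sqr ?nnegrE ?nr_ge0 // (nr_sys_le1 ou).
Qed.

Lemma diagonal_exists c u : summ c -> ortho_sys setT u -> exists T, diagonal_in T c u.
Proof.
move=> sc ou.
have lim x : exists y, tends (fun n => \sum_(0 <= i < n) ((c i)%:C * ip x (u i)) *: u i) y.
  apply: complete_nr => eps e0.
  have x1 : 0 < nr x + 1 by rewrite ltr_wpDl ?nr_ge0.
  have e1 : 0 < eps / (nr x + 1) by rewrite divr_gt0.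
  have [N hN] := summ_tail sc e1; exists N.
  have main m n : (N <= n <= m)%N -> nr (\sum_(0 <= i < m) ((c i)%:C * ip x (u i)) *: u i -
      \sum_(0 <= i < n) ((c i)%:C * ip x (u i)) *: u i) <= eps.
    move=> /andP [Nn nm]; rewrite (big_cat_nat _ nm) //= addrAC subrr add0r.
    apply: le_trans (nr_sum _ _ _) _.
    apply: (@le_trans _ _ (\sum_(n <= i < m) `|c i| * (nr x + 1))).
      apply: ler_sum => i _; rewrite -scalerA nrZR ler_wpM2l // nrZ.
      have u1 := nr_sys_le1 ou (i := i) I.
      apply: (@le_trans _ _ (nr x * 1)); last by rewrite mulr1 lerDl.
      rewrite ler_pM ?sqrtr_ge0 ?nr_ge0 // -[leRHS]ger0_norm ?nr_ge0 // -sqrtr_sqr ler_wsqrtr //.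
      apply: le_trans (cauchy_schwarz _ _) _; rewrite ler_piMr ?sqr_ge0 //.
      by rewrite -(expr1n _ 2) ler_sqr ?nnegrE ?nr_ge0.
    rewrite -mulr_suml -ler_pdivlMr //; apply: le_trans (hN n Nn).
    rewrite -{1}(subnKC nm) -(sum_shift (fun i => `|c i|)).
    exact: sum_abs_le_tsum (summ_shift n sc).
  move=> m n Nm Nn; have [mn|/ltnW nm] := leqP m n.
    by rewrite nrB main // Nm.
  by rewrite main // Nn.
have [T hT] := choice lim; by exists T.
Qed.

Section properties.
Variables (T : H -> H) (c : nat -> R) (u : nat -> H).
Hypotheses (sc : summ c) (ou : ortho_sys setT u) (dT : diagonal_in T c u).

Lemma diagonal_linear : linear T.
Proof.
move=> a x y; apply: (tends_unique (dT _)).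
rewrite (_ : (fun n => _) = (fun n => a *: \sum_(0 <= i < n) ((c i)%:C * ip x (u i)) *: u i +
  \sum_(0 <= i < n) ((c i)%:C * ip y (u i)) *: u i)).
  by apply: tendsD => //; apply: tendsZ.
apply/funext => n; rewrite scaler_sumr -big_split; apply: eq_bigr => i _ /=.
by rewrite ipDl ipZl mulrDr scalerDl !scalerA mulrCA.
Qed.

Lemma diagonal_symmetric : symmetric T.
Proof.
move=> x y; apply: (tends_ip_eq (dT x) (dT y)) => n.
rewrite ip_suml ip_sumr; apply: eq_bigr => i _.
by rewrite ipZl ipZr rmorphM /= conjR -ipC mulrAC.
Qed.

Let B := tsum (fun i => `|c i|).
Let B0 : 0 <= B. Proof. by apply: (tsum_ge0 (summ_abs sc)). Qed.
Let cB i : c i ^+ 2 <= `|c i| * B.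
Proof.
rewrite -real_normK ?num_real // expr2 ler_wpM2l //.
exact: (ler_term_tsum i (summ_abs sc) (fun _ => normr_ge0 _)).
Qed.

(** By Parseval the Hilbert-Schmidt norm is the square root of \sum_i c_i^2, which is at most
\sum_i |c_i|. *)
Lemma diagonal_hs : hs_le T (B * B).
Proof.
move=> s bs.
have hc e : (fun n => nr (\sum_(0 <= i < n) ((c i)%:C * ip e (u i)) *: u i) ^+ 2) @ \oo -->
    nr (T e) ^+ 2.
  rewrite expr2; under eq_fun => n do rewrite expr2.
  by apply: cvgM; apply: (tends_nr (dT e)).
apply: (cvgR_le (cvg_sum_seq s hc)) => n.
apply: (@le_trans _ _ (\sum_(e <- s) \sum_(0 <= i < n) c i ^+ 2 * sq (ip e (u i)))).
  by apply: ler_sum => e _; apply: nr2_diagonal_sum.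
rewrite exchange_big /=; apply: (@le_trans _ _ (\sum_(0 <= i < n) `|c i| * B)).
  apply: ler_sum => i _; apply: le_trans _ (cB i).
  rewrite -mulr_sumr ler_piMr ?sqr_ge0 //; under eq_bigr do rewrite sq_ipC.
  apply: le_trans (bessel basis_sys _ bs.1 bs.2) _.
  by rewrite -(expr1n _ 2) ler_sqr ?nnegrE ?nr_ge0 // (nr_sys_le1 ou).
by rewrite -mulr_suml ler_wpM2r // sum_abs_le_tsum.
Qed.

Lemma diagonal_bounded : bounded_op T.
Proof.
apply/bounded_opP; split; first exact: diagonal_linear.
exists B; split => // x; rewrite -ler_sqr ?nnegrE ?mulr_ge0 ?nr_ge0 //.
apply: le_trans (hs_nr _ diagonal_symmetric diagonal_hs) _.
by rewrite exprMn expr2.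
Qed.

Lemma diagonal_has_trace (A : H -> H) z : bounded_op A ->
  Re z = tsum (fun i => c i * qf A true (u i)) -> Im z = tsum (fun i => c i * qf A false (u i)) ->
  has_trace (T \o A) z.
Proof. by move=> bA; apply: has_trace_diagonal. Qed.

Lemma diagonal_trace : (forall i, c i <> 0 -> nr (u i) = 1) -> has_trace T (tsum c)%:C.
Proof.
move=> cu; have cq (a b : R) i : c i * (nr (u i) ^+ 2) = c i.
  have [->|/eqP /cu ->] := eqVneq (c i) 0; first by rewrite mul0r.
  by rewrite expr1n mulr1.
have bid : bounded_op (id : H -> H).
  by apply/bounded_opP; split=> //; exists 1; split => // x; rewrite mul1r.
apply: (@has_trace_diagonal _ _ T id c u _ bid ou sc dT) => /=.
  by apply: tsum_eq => i; rewrite ipxx /= (cq 0 0).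
by rewrite (tsum_eq (b := fun=> 0)) ?tsum0 // => i; rewrite ipxx /= mulr0.
Qed.

End properties.

(** The first N terms of the two operators cancel, and each of the other terms contributes at
most |c_i| twice to the diagonal entries, by Bessel's inequality. *)
Lemma trace_norm_diagonal_diff T1 T2 c u v N : summ c -> ortho_sys setT u -> ortho_sys setT v ->
  diagonal_in T1 c u -> diagonal_in T2 c v ->
  (forall i, (i < N)%N -> c i <> 0 -> u i = v i) ->
  (trace_norm (T1 \- T2)%R <= (2 * tsum (fun i => `|c (N + i)%N|))%:E)%E.
Proof.
move=> sc ou ov d1 d2 uv.
have l1 := diagonal_linear d1; have l2 := diagonal_linear d2.
have s1 := diagonal_symmetric d1; have s2 := diagonal_symmetric d2.
set B := tsum (fun i => `|c i|).
apply: (@trace_norm_le _ _ _ (2 * (B * B + B * B))).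
- by apply: bounded_opB; [exact: diagonal_bounded d1|exact: diagonal_bounded d2].
- by move=> x y; rewrite /= ipBl ipBr s1 s2.
- move=> s bs; have h1 := diagonal_hs sc ou d1 bs; have h2 := diagonal_hs sc ov d2 bs.
  apply: (@le_trans _ _ (\sum_(e <- s) 2 * (nr (T1 e) ^+ 2 + nr (T2 e) ^+ 2))).
    apply: ler_sum => e _; have := sqr_ge0 (nr (T1 e) - nr (T2 e)).
    have := nrD (T1 e) (- T2 e); rewrite nrN; have := nr_ge0 (T1 e - T2 e).
    have := nr_ge0 (T1 e); have := nr_ge0 (T2 e) => /=.
    by move: (nr (T1 e - T2 e)) (nr (T1 e)) (nr (T2 e)) => a b d; clear; nra.
  by rewrite -mulr_sumr big_split /= ler_wpM2l // lerD.
move=> g n og.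
have hc j : (fun m => `|\sum_(0 <= i < m) c i * (sq (ip (g j) (u i)) - sq (ip (g j) (v i)))|)
    @ \oo --> `|Re (ip ((T1 \- T2)%R (g j)) (g j))|.
  apply: cvg_norm; rewrite /= ipBl ReB.
  rewrite (_ : (fun m => _) = (fun m => \sum_(0 <= i < m) c i * sq (ip (g j) (u i)) -
     \sum_(0 <= i < m) c i * sq (ip (g j) (v i)))).
    by apply: cvgB; apply: diagonal_quad.
  by apply/funext => m; rewrite -sumrB; apply: eq_bigr => i _; rewrite mulrBr.
apply: (cvgR_le (cvg_sum_seq (index_iota 0 n) hc)) => m.
pose b i := if (i < N)%N then 0 else `|c i|.
apply: (@le_trans _ _ (\sum_(0 <= j < n) \sum_(0 <= i < m)
    b i * (sq (ip (g j) (u i)) + sq (ip (g j) (v i))))).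
  apply: ler_sum => j _; apply: le_trans (ler_norm_sum _ _ _) _.
  apply: ler_sum => i _; rewrite /b normrM; case: ltnP => iN.
    have [->|/eqP /(uv i iN) ->] := eqVneq (c i) 0; first by rewrite normr0 !mul0r.
    by rewrite subrr normr0 mulr0 mul0r.
  rewrite ler_wpM2l //; apply: le_trans (ler_normB _ _) _.
  by rewrite !ger0_norm ?sq_ge0.
rewrite exchange_big /=; apply: (@le_trans _ _ (\sum_(0 <= i < m) 2 * b i)).
  apply: ler_sum => i _; rewrite -mulr_sumr mulrC ler_wpM2r //.
    by rewrite /b; case: ifP.
  by rewrite big_split /= (_ : 2 = 1 + 1) // lerD // bessel_nat1.
rewrite -mulr_sumr ler_wpM2l //.
have [mN|/ltnW Nm] := leqP m N.
  rewrite big_nat big1 => [|i /andP [_ im]]; last by rewrite /b (leq_trans im mN).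
  exact: (tsum_ge0 (summ_abs (summ_shift N sc))).
rewrite (big_cat_nat _ Nm) //= big_nat big1 => [|i /andP [_ iN]]; last by rewrite /b iN.
rewrite add0r -{1}(subnKC Nm) -sum_shift.
rewrite (eq_bigr (fun i => `|c (N + i)%N|)); first exact: sum_abs_le_tsum (summ_shift N sc).
by move=> i _; rewrite /b ltnNge leq_addr.
Qed.

Lemma unitary_sys U u : unitary U -> ortho_sys setT u -> ortho_sys setT (fun i => U (u i)).
Proof.
move=> uU ou; split=> [i j _ _ ij|i _]; first by rewrite unitary_ip // ou.1.
have [ui|ui] := ou.2 i I; [left|right].
  by rewrite ui; have [bU _ _] := uU; rewrite lin0 //; have [] := (bounded_opP _).1 bU.
apply/eqP; rewrite -(eqrXn2 (n := 2)) ?nr_ge0 // expr1n; apply/eqP/(@complexI R).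
by rewrite -ipxx unitary_ip // ipxx ui expr1n.
Qed.

Lemma diagonal_conj U T c u : unitary U -> diagonal_in T c u ->
  diagonal_in (U \o T \o adjoint U) c (fun i => U (u i)).
Proof.
move=> uU dT x /=; have [bU _ _] := uU; have [adj _ _] := unitaryE uU.
have [lU _] := (bounded_opP _).1 bU.
have := tends_op bU (dT (adjoint U x)); rewrite /tends.
under eq_fun => n do rewrite (lin_sum _ _ _ lU); move=> h.
rewrite (_ : (fun n => _) = (fun n => nr (\sum_(0 <= i < n)
   U (((c i)%:C * ip (adjoint U x) (u i)) *: u i) - U (T (adjoint U x))))) //.
apply/funext => n; congr (nr (_ - _)); apply: eq_bigr => i _.
by rewrite (linZ lU) [ip x _]ipC adj -ipC.
Qed.

End diagonal_operators.

(** * Majorisation of operators *)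

Section majorisation_of_operators.
Context {R : realType} {H : hilbertType R}.
Implicit Types (x y h : H) (X Y Z : H -> H) (u g : nat -> H) (c : nat -> R).

(** Z is majorised by the sequence c, expressed by the diagonal entries of Z in
orthonormal systems, so that the condition passes to limits and to convex combinations. *)
Definition op_maj c Z := (forall g n (sg mu : R), ortho_sys setT g -> `|sg| = 1 -> 0 <= mu ->
    \sum_(0 <= j < n) pospart (sg * Re (ip (Z (g j)) (g j)) - mu) <= tsum (fun i => pospart (sg * c i - mu))) /\
  has_trace Z (tsum c)%:C.

Lemma op_maj_diagonal c u Z : summ c -> ortho_sys setT u ->
  (forall i, c i <> 0 -> nr (u i) = 1) -> diagonal_in Z c u -> op_maj c Z.
Proof.
move=> sc ou cu dZ; split; last exact: (diagonal_trace sc ou dZ cu).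
move=> g n sg mu og sg1 mu0.
have ssc : summ (fun i => sg * c i) := summZ sg sc.
have sp := summ_pospart ssc mu0.
pose w j i := sq (ip (g j) (u i)).
have w0 j i : 0 <= w j i by apply: sq_ge0.
have g1 j : nr (g j) ^+ 2 <= 1.
  by rewrite -(expr1n _ 2) ler_sqr ?nnegrE ?nr_ge0 // (nr_sys_le1 og).
have w1 j i : w j i <= 1.
  apply: le_trans (cauchy_schwarz _ _) _; rewrite -[leRHS]mulr1 ler_pM ?sqr_ge0 //.
  by rewrite -(expr1n _ 2) ler_sqr ?nnegrE ?nr_ge0 // (nr_sys_le1 ou).
have spw j : summ (fun i => w j i * pospart (sg * c i - mu)).
  apply: summ_le sp _ => i; rewrite ger0_norm ?mulr_ge0 ?pospart_ge0 //.
  by rewrite ler_piMl ?pospart_ge0.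
have jensen j : pospart (sg * Re (ip (Z (g j)) (g j)) - mu) <= tsum (fun i => w j i * pospart (sg * c i - mu)).
  case: pospartP => _; last first.
    by apply: (tsum_ge0 (spw j)) => i; rewrite mulr_ge0 ?pospart_ge0.
  have hc : (fun m => sg * \sum_(0 <= i < m) c i * w j i - mu) @ \oo -->
      sg * Re (ip (Z (g j)) (g j)) - mu.
    by apply: cvgB; [apply: cvgMr; apply: diagonal_quad|apply: cvg_cst].
  apply: (cvgR_le hc) => m.
  apply: le_trans (sum_le_tsum m (spw j) (fun i => mulr_ge0 (w0 j i) (pospart_ge0 _))).
  apply: (@le_trans _ _ (\sum_(0 <= i < m) w j i * (sg * c i - mu))).
    have -> : \sum_(0 <= i < m) w j i * (sg * c i - mu) =
        sg * \sum_(0 <= i < m) c i * w j i - (\sum_(0 <= i < m) w j i) * mu.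
      rewrite mulr_sumr mulr_suml -sumrB; apply: eq_bigr => i _; ring.
    rewrite lerD2l lerN2 ler_piMl //; apply: le_trans (g1 j); exact: bessel_nat.
  by apply: ler_sum => i _; rewrite ler_wpM2l // pospart_le.
apply: le_trans (ler_sum _ (fun j _ => jensen j)) _.
have [s2 <-] := tsum_sum (index_iota 0 n) spw.
apply: (tsum_le s2 sp) => i; rewrite -mulr_suml ler_piMl ?pospart_ge0 //.
exact: bessel_nat1.
Qed.

Lemma op_maj_convex c X Y (l : R) : 0 <= l <= 1 -> op_maj c X -> op_maj c Y ->
  op_maj c (fun x => l%:C *: X x + (1 - l)%:C *: Y x).
Proof.
move=> /andP [l0 l1] [hX tX] [hY tY]; split; last first.
  have := has_traceD l (1 - l) tX tY.
  by rewrite -mulrDl -rmorphD (_ : l + (1 - l) = 1) ?rmorph1 ?mul1r //; ring.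
move=> g n sg mu og sg1 mu0.
have h1 := hX g n sg mu og sg1 mu0; have h2 := hY g n sg mu og sg1 mu0.
set r := tsum _ in h1 h2 *.
apply: (@le_trans _ _ (l * \sum_(0 <= j < n) pospart (sg * Re (ip (X (g j)) (g j)) - mu) +
   (1 - l) * \sum_(0 <= j < n) pospart (sg * Re (ip (Y (g j)) (g j)) - mu))).
  rewrite !mulr_sumr -big_split; apply: ler_sum => j _ /=.
  rewrite ipDl !ipZl ReD !ReM /= !mul0r !subr0.
  have p1 := pospart_le (sg * Re (ip (X (g j)) (g j)) - mu).
  have p2 := pospart_le (sg * Re (ip (Y (g j)) (g j)) - mu).
  have p3 := pospart_ge0 (sg * Re (ip (X (g j)) (g j)) - mu).
  have p4 := pospart_ge0 (sg * Re (ip (Y (g j)) (g j)) - mu).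
  have l2 : 0 <= 1 - l by rewrite subr_ge0.
  case: pospartP => _; last by rewrite addr_ge0 ?mulr_ge0.
  have := ler_wpM2l l0 p1; have := ler_wpM2l l2 p2; lra.
have -> : r = l * r + (1 - l) * r by ring.
by rewrite lerD // ler_wpM2l // subr_ge0.
Qed.

Lemma op_maj_limit c X : (forall eps : R, 0 < eps -> exists2 Y, op_maj c Y &
    bounded_op (X \- Y)%R /\ symmetric (X \- Y)%R /\ (trace_norm (X \- Y)%R <= eps%:E)%E) ->
  (exists z : R, has_trace X z%:C) -> op_maj c X.
Proof.
move=> hX [z hz]; split.
  move=> g n sg mu og sg1 mu0; apply/ler_addgt0Pl => eps e0.
  have e1 : 0 < eps / n.+1%:R by rewrite divr_gt0.
  have [Y [hY _] [bD [sD tD]]] := hX _ e1.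
  have h := hY g n sg mu og sg1 mu0; rewrite addrC; apply: le_trans (lerD h (lexx eps)).
  apply: (@le_trans _ _ (\sum_(0 <= j < n) (pospart (sg * Re (ip (Y (g j)) (g j)) - mu) + eps / n.+1%:R))).
    apply: ler_sum => j _.
    have d : `|Re (ip (X (g j)) (g j)) - Re (ip (Y (g j)) (g j))| <= eps / n.+1%:R.
      rewrite -ReB -ipBl; apply: le_trans (absRe_ip _ _) _.
      have g1 := nr_sys_le1 og (i := j) I.
      apply: (@le_trans _ _ (eps / n.+1%:R * 1 * 1)); last by rewrite !mulr1.
      rewrite ler_pM ?nr_ge0 //; apply: le_trans (nr_le_trace_norm bD tD _) _.
      by rewrite ler_wpM2l // ltW.
    have d2 : sg * Re (ip (X (g j)) (g j)) - sg * Re (ip (Y (g j)) (g j)) <= eps / n.+1%:R.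
      apply: le_trans d; apply: le_trans (ler_norm _) _.
      by rewrite -mulrBr normrM sg1 mul1r.
    have := pospart_le (sg * Re (ip (Y (g j)) (g j)) - mu).
    have := pospart_ge0 (sg * Re (ip (Y (g j)) (g j)) - mu).
    move: d2 e1; move: (eps / _) => q.
    by case: (pospartP (sg * Re (ip (X (g j)) (g j)) - mu)); lra.
  rewrite big_split /= lerD2l sumr_const_nat subn0 -(mulr_natr (eps / _)) -mulrA.
  by rewrite ler_piMr ?(ltW e0) // ler_pdivrMl ?mulr1 // ler_nat.
suff -> : tsum c = z by [].
apply/eqP; rewrite -subr_eq0 -normr_le0; apply/ler_addgt0Pl => eps e0; rewrite addr0.
have [Y [_ tY] [bD [sD tD]]] := hX _ e0.
have [h [t [oh th _ hz0 [dD sumt]]]] := trace_class_diagonal bD sD tD.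
have st : summ t := summ_bound sumt.
have tr : has_trace (X \- Y)%R (tsum t)%:C.
  by apply: (diagonal_trace st oh dD) => i ti; have [/hz0 [/ti]|] := oh.2 i I.
have := has_traceD 1 (-1) hz tY.
rewrite (_ : (fun x => _) = (X \- Y)%R); last first.
  by apply/funext => x; rewrite /= rmorph1 rmorphN1 scale1r scaleN1r.
move=> /(has_trace_unique tr); rewrite -!rmorphM -rmorphD => /complexI e.
have -> : tsum c - z = - tsum t by rewrite e; lra.
rewrite normrN; apply: le_trans (abs_tsum_le st) _.
by apply: (tsum_le_bound (summ_abs st)).
Qed.

(** If e_i vanishes, the space has dimension at most i, hence c, whose moduli decrease, cannot
have a nonzero i-th term. *)
Lemma frame_room (f e : nat -> H) c i : ortho_sys setT f -> ortho_sys setT e ->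
  (forall n, f n = 0 -> c n = 0) -> (forall n, `|c n.+1| <= `|c n|) ->
  (forall n, e n = 0 -> forall x, (forall j, (j < n)%N -> ip x (e j) = 0) -> x = 0) ->
  c i <> 0 -> nr (e i) = 1.
Proof.
move=> of_ oe fc cdecr full ci; have [ei|//] := oe.2 i I.
have cj j : (j <= i)%N -> c j <> 0.
  move=> ji cj; apply: ci; apply/eqP; rewrite -normr_le0 -(normr0 R) -cj.
  by move: ji => /subnKC <-; elim: (i - j)%N => [|k IH]; rewrite ?addn0 // addnS (le_trans (cdecr _)).
have nf j : (j <= i)%N -> nr (f j) = 1.
  by move=> /cj h; have [/fc|] := of_.2 j I.
have exp j : (j <= i)%N -> 1 = \sum_(0 <= l < i) sq (ip (f j) (e l)).
  move=> /nf fj.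
  have := bessel_eq oe (f j) (iota_uniq 0 (i - 0)) (fun _ _ => I).
  rewrite (full i ei (f j - _)) ?nr0 ?fj => [|l li].
    by move/eqP; rewrite expr0n expr1n eq_sym subr_eq0 => /eqP.
  by apply: (proj_orth oe) => //; rewrite ?iota_uniq // mem_index_iota.
have : \sum_(0 <= j < i.+1) (1 : R) <= \sum_(0 <= l < i) (1 : R).
  apply: (@le_trans _ _ (\sum_(0 <= j < i.+1) \sum_(0 <= l < i) sq (ip (f j) (e l)))).
    by rewrite !big_nat; apply: ler_sum => j /andP [_ ji]; rewrite -exp.
  rewrite exchange_big /=; apply: ler_sum => l _; exact: bessel_nat1.
by rewrite !sumr_const_nat !subn0 ler_nat ltnn.
Qed.

End majorisation_of_operators.

(** * The orbit closure and its numerical range *)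

Section orbit_closures.
Context {R : realType} {H : hilbertType R}.
Variables (C : H -> H) (tC : trace_class C) (saC : selfadjoint C).

Let bC : bounded_op C. Proof. by have [] := tC. Qed.
Let sC : symmetric C := selfadjoint_sym bC saC.

Lemma trace_class_le (T : H -> H) : trace_class T -> exists r : R, (trace_norm T <= r%:E)%E.
Proof.
move=> [_ h]; have h0 : (0 <= trace_norm T)%E.
  by apply: ereal_sup_ubound; exists set0; [split|rewrite fsbig_set0].
by exists (fine (trace_norm T)); rewrite fineK // ge0_fin_numE.
Qed.

Lemma trace_class_spectral (T : H -> H) : trace_class T -> symmetric T ->
  exists (h : nat -> H) (t : nat -> R), [/\ ortho_sys setT h, summ t, diagonal_in T t h,
    forall n, h n = 0 -> t n = 0 & forall n, `|t n.+1| <= `|t n|].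
Proof.
move=> tT sT; have [r hr] := trace_class_le tT.
have [h [t [oh _ td hz [dT st]]]] := trace_class_diagonal tT.1 sT hr.
by exists h, t; split => // [|n /hz []]; first exact: summ_bound st.
Qed.

Lemma orbit_symmetric Y : unitary_orbit C Y -> bounded_op Y /\ symmetric Y.
Proof.
move=> [U uU <-]; have [bU _ _] := uU; have [bA _] := adjointP bU.
have [adj _ _] := unitaryE uU; split.
  by apply: bounded_op_comp => //; apply: bounded_op_comp.
by move=> x y /=; rewrite adj sC [RHS]ipC adj -ipC.
Qed.

Lemma orbit_closure_symmetric X : orbit_closure C X -> symmetric X.
Proof.
move=> [[bX _] hX] x y.
have key (f : R[i] -> R) : (forall z1 z2, f (z1 - z2) = f z1 - f z2) ->
    (forall h1 h2 : H, `|f (ip h1 h2)| <= nr h1 * nr h2) -> f (ip (X x) y) = f (ip x (X y)).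
  move=> fB fn; apply/eqP; rewrite -subr_eq0 -normr_le0; apply/ler_addgt0Pl => eps e0.
  rewrite addr0; pose K := 2 * (nr x * nr y) + 1.
  have K0 : 0 < K by rewrite ltr_wpDl // !mulr_ge0 ?nr_ge0.
  have [Y oY /ltW tY] := hX (eps / K) (divr_gt0 e0 K0).
  have [bY sY] := orbit_symmetric oY; have bD := bounded_opB bX bY.
  have nD h : nr (X h - Y h) <= eps / K * nr h by apply: (nr_le_trace_norm bD tY).
  have -> : f (ip (X x) y) - f (ip x (X y)) = f (ip (X x - Y x) y) - f (ip x (X y - Y y)).
    by rewrite ipBl ipBr !fB sY; ring.
  apply: le_trans (ler_normB _ _) _.
  apply: (@le_trans _ _ (eps / K * nr x * nr y + nr x * (eps / K * nr y))).
    apply: lerD; first by apply: le_trans (fn _ _) _; rewrite ler_wpM2r ?nr_ge0.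
    by apply: le_trans (fn _ _) _; rewrite ler_wpM2l ?nr_ge0.
  have -> : eps / K * nr x * nr y + nr x * (eps / K * nr y) = eps * (2 * (nr x * nr y) / K) by ring.
  by rewrite ler_piMr ?(ltW e0) // ler_pdivrMr // mul1r lerDl.
by apply: eqC; apply: key; [exact: ReB|exact: absRe_ip|exact: ImB|exact: absIm_ip].
Qed.

Section spectrum.
Variables (f : nat -> H) (c : nat -> R).
Hypotheses (of_ : ortho_sys setT f) (sc : summ c) (dC : diagonal_in C c f).
Hypotheses (fc : forall n, f n = 0 -> c n = 0).

Let cf i : c i <> 0 -> nr (f i) = 1.
Proof. by move=> ci; have [/fc|] := of_.2 i I. Qed.

Lemma orbit_op_maj Y : unitary_orbit C Y -> op_maj c Y.
Proof.
move=> [U uU <-]; have oU := unitary_sys uU of_.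
apply: (op_maj_diagonal sc oU) => [i ci|]; last exact: diagonal_conj.
apply/eqP; rewrite -(eqrXn2 (n := 2)) ?nr_ge0 // expr1n; apply/eqP/(@complexI R).
by rewrite -ipxx unitary_ip // ipxx cf // expr1n.
Qed.

Lemma orbit_closure_op_maj X : orbit_closure C X -> op_maj c X.
Proof.
move=> oX; have sX := orbit_closure_symmetric oX; have [tX hX] := oX.
apply: op_maj_limit.
  move=> eps e0; have [Y oY /ltW tY] := hX _ e0; exists Y; first exact: orbit_op_maj.
  have [bY sY] := orbit_symmetric oY; split; first exact: bounded_opB tX.1 bY.
  by split => // x y; rewrite /= ipBl ipBr sX sY.
have [h [t [oh st dX hz _]]] := trace_class_spectral tX sX.
exists (tsum t); apply: (diagonal_trace st oh dX) => i ti.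
by have [/hz|] := oh.2 i I.
Qed.

(** A unitary operator carries the first N eigenvectors of C to the u_i, and the tail of c
bounds what remains in the trace norm. *)
Lemma diagonal_orbit_closure X u : ortho_sys setT u -> (forall i, c i <> 0 -> nr (u i) = 1) ->
  diagonal_in X c u -> orbit_closure C X.
Proof.
move=> ou cu dX; split.
  split; first exact: diagonal_bounded dX.
  have oz : ortho_sys setT (fun _ : nat => 0 : H).
    by split=> [i j _ _ _|i _]; [rewrite ip0l|left].
  have dz : diagonal_in (fun=> 0 : H) c (fun=> 0).
    move=> x; apply: (tends_squeeze (cvg_cst (0 : R))) => n.
    by rewrite big1 ?subrr ?nr0 // => i _; rewrite scaler0.
  have := @trace_norm_diagonal_diff _ _ X (fun=> 0) c u (fun=> 0) 0 sc ou oz dX dz _.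
  rewrite (_ : (X \- (fun=> 0))%R = X); last by apply/funext => x /=; rewrite subr0.
  by move=> /(_ (fun _ h => False_ind _ (notF h))) h; apply: le_lt_trans h _; apply: ltry.
move=> eps e0; have e1 : 0 < eps / 4 by rewrite divr_gt0.
have [N hN] := summ_tail sc e1; have {}hN := hN N (leqnn _).
have [U uU hU] := exists_unitary N of_ ou.
exists (U \o C \o adjoint U); first by exists U.
apply: le_lt_trans (trace_norm_diagonal_diff sc ou (unitary_sys uU of_) dX (diagonal_conj uU dC)
  (N := N) _) _.
  by move=> i iN ci; rewrite hU ?cf ?cu.
by rewrite lte_fin; lra.
Qed.

End spectrum.
End orbit_closures.

Theorem corollary4p6 (R : realType) (H : hilbertType R) (A C : H -> H)
    (sepH : separable H) (bA : bounded_op A)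
    (tC : trace_class C) (saC : selfadjoint C) :
  @convex_set R (Rcomplex R) (numerical_range C A).
Proof.
have sC := selfadjoint_sym tC.1 saC.
have [f [c [of_ sc dC fc cdecr]]] := trace_class_spectral tC sC.
move=> a b l /[!inE] -[X oX <-] [Y oY <-].
pose t : R := l%:num.
have t01 : 0 <= t <= 1 by rewrite /t ge0 le1.
pose Z x := t%:C *: X x + (1 - t)%:C *: Y x.
have sX := orbit_closure_symmetric tC saC oX; have sY := orbit_closure_symmetric tC saC oY.
have mZ : op_maj c Z.
  by apply: op_maj_convex => //; apply: (orbit_closure_op_maj tC saC of_ sc dC fc).
have val (V : H -> H) : orbit_closure C V -> symmetric V ->
    has_trace (V \o A) (trace (V \o A)) /\ exists M, hs_le V M.
  move=> [tV _] sV; have [h [k [oh sk dV _ _]]] := trace_class_spectral tV sV.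
  split; last by eexists; apply: diagonal_hs sk oh dV.
  have hh : has_trace (V \o A) (tsum (fun i => k i * qf A true (h i)) +i* tsum (fun i => k i * qf A false (h i))).
    by apply: (diagonal_has_trace sk oh dV bA).
  by rewrite (has_traceE hh).
have [tX [M1 hX]] := val X oX sX; have [tY [M2 hY]] := val Y oY sY.
have [bX bY] : bounded_op X /\ bounded_op Y by split; [have [[]] := oX|have [[]] := oY].
have [[lX _] [lY _]] := ((bounded_opP _).1 bX, (bounded_opP _).1 bY).
have lZ : linear Z.
  move=> p x y; rewrite /Z lX lY !scalerDr !scalerA ![_%:C * p]mulrC -!scalerA.
  by rewrite addrACA.
have sZ : symmetric Z.
  by move=> x y; rewrite /Z ipDl ipDr !ipZl !ipZr !conjR sX sY.
have hZ : hs_le Z (2 * (M1 + M2)).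
  move=> s bs; have h1 := hX s bs; have h2 := hY s bs.
  apply: (@le_trans _ _ (\sum_(e <- s) 2 * (nr (X e) ^+ 2 + nr (Y e) ^+ 2))); last first.
    by rewrite -mulr_sumr big_split /= ler_wpM2l // lerD.
  apply: ler_sum => e _; have := nrD (t%:C *: X e) ((1 - t)%:C *: Y e).
  rewrite !nrZR; have [t0 t1] := andP t01; rewrite !ger0_norm ?subr_ge0 // -/(Z e).
  have := nr_ge0 (X e); have := nr_ge0 (Y e); have := nr_ge0 (Z e).
  move: (nr (X e)) (nr (Y e)) (nr (Z e)) t0 t1 => p q r t0 t1 r0 q0 p0 h.
  have rpq : r <= p + q by nra.
  have := sqr_ge0 (p - q); nra.
have [e [z [oe ze _ ez dZ]]] := spectral_theorem lZ sZ hZ.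
have qz i : Re (ip (Z (e i)) (e i)) = z i.
  rewrite ze ipZl ipxx -rmorphM /=.
  by have [/ez [-> _]|->] := oe.2 i I; rewrite ?mul0r // expr1n mulr1.
have part n (sg mu : R) : `|sg| = 1 -> 0 <= mu ->
    \sum_(0 <= j < n) pospart (sg * z j - mu) <= tsum (fun i => pospart (sg * c i - mu)).
  move=> s1 m0; have := mZ.1 e n sg mu oe s1 m0.
  by under eq_bigr do rewrite qz.
have sz : summ z.
  exists (tsum (fun i => pospart (1 * c i - 0)) + tsum (fun i => pospart (-1 * c i - 0))) => n.
  apply: le_trans (lerD (part n 1 0 _ _) (part n (-1) 0 _ _)); rewrite ?normrN1 ?normr1 //.
  rewrite -big_split; apply: ler_sum => i _ /=; rewrite !subr0 mul1r mulN1r.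
  by case: (ler0P (z i)); case: pospartP; case: pospartP; lra.
have zne i : z i <> 0 -> nr (e i) = 1.
  by move=> zi; have [/ez [/zi]|] := oe.2 i I.
have mzc : maj z c.
  split => //.
  - move=> mu m0; apply: (tsum_le_bound (summ_pospart sz m0)) => n.
    have := part n 1 mu (normr1 _) m0; under eq_bigr do rewrite mul1r.
    by rewrite (tsum_eq (b := fun i => pospart (c i - mu))) // => i; rewrite mul1r.
  - move=> mu m0; apply: (tsum_le_bound (summ_pospartN sz m0)) => n.
    have := part n (-1) mu (normrN1 _) m0; under eq_bigr do rewrite mulN1r.
    by rewrite (tsum_eq (b := fun i => pospart (- c i - mu))) // => i; rewrite mulN1r.
  - by have /complexI := has_trace_unique (diagonal_trace sz oe dZ zne) mZ.2.
have g : good e z c.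
  split => // [i ei|i ci].
    have [_ full] := ez i ei; apply: full => j ji; apply: oe.1 => //.
    by rewrite gtn_eqF // ltnW.
  by apply: (frame_room of_ oe fc cdecr _ ci) => n /ez [].
have [u [ou cu hu]] := realise_majorised bA g cdecr.
have [W dW] := diagonal_exists sc ou.
exists W; first exact: (diagonal_orbit_closure of_ sc dC fc ou cu dW).
pose w := t%:C * trace (X \o A) + (1 - t)%:C * trace (Y \o A).
have wE : w = tsum (fun i => z i * qf A true (e i)) +i* tsum (fun i => z i * qf A false (e i)).
  apply: (has_trace_unique (has_traceD t (1 - t) tX tY)).
  exact: (diagonal_has_trace sz oe dZ bA).
transitivity w.
  by apply: has_traceE; apply: (diagonal_has_trace sc ou dW bA); rewrite wE hu.
rewrite /w; case: (trace (X \o A)) => a1 a2; case: (trace (Y \o A)) => b1 b2.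
transitivity ((t * a1 + (1 - t) * b1) +i* (t * a2 + (1 - t) * b2)) => //.
by apply: eqC; rewrite ?ReD ?ImD ?ReM ?ImM /=; ring.
Qed.
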